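(* Let $\gamma=(\gamma_u)_{u\in\mathcal U}$ be POD weights, $\gamma_u=\Gamma_{|u|}\prod_{j\in u}\gamma_j$, such that $p^*:=\mathrm{decay}_{\gamma,1}>1$ and such that there exist $q<p^*$ and $C_q>0$ with $\Gamma_k\le C_q(k!)^q$ for all $k\in\mathbb N$. Let $\lambda_0\in(0,1-1/\mathrm{decay}_\gamma)$ and let $0<\tau<\lambda_0\cdot\mathrm{decay}_\gamma/2$ be such that the following building-block condition holds: there are constants $c_1\ge1$, $C\ge C_0$, $\lambda_1\ge0$, $\lambda_2\in[0,1]$ and, for each $u\in\mathcal U\setminus\{\emptyset\}$ and $n\in\mathbb N$, algorithms $Q_{n,u}$ using $n$ function evaluations of functions $f_u\in H_u$ with $$e(Q_{n,u};H_u)^2\le\frac{c_1C^{|u|}}{(n+1)^{2\tau}}\left(1+\frac{\ln(n+1)}{(|u|-1)^{\lambda_2}}\right)^{\lambda_1(|u|-1)^{\lambda_2}}\qquad( * )$$ (the last factor being $1$ for $|u|=1$). Then the changing dimension algorithms $Q^{\mathrm{CD}}_\varepsilon$, $\varepsilon>0$, satisfy $$e(Q^{\mathrm{CD}}_\varepsilon;\mathcal H_\gamma)\le\varepsilon^{1-o(1)}\quad\text{as }\varepsilon\to0,$$ and their cost satisfies $$\mathrm{cost}_{\mathrm{unr}}(Q^{\mathrm{CD}}_\varepsilon)=O\big(\$(d(\varepsilon))\,\varepsilon^{-1/\tau}\big),\qquad\text{where}\quad d(\varepsilon)=O\left(\frac{\ln(1/\varepsilon)}{\ln\ln(1/\varepsilon)}\right)=o(\ln(1/\varepsilon)).$$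 If the cost function satisfies $\$(d)=O(e^{\ell d})$ for some $\ell\ge0$, then the integration problem is strongly tractable in the unrestricted subspace sampling model with exponent $$p^{\mathrm{unr}}\le\max\left\{\frac1\tau,\frac{2}{\mathrm{decay}_\gamma-1}\right\}.$$ Assume now additionally that $\$(d)=\Omega(d)$ and that the $n$th minimal worst case error of univariate integration satisfies $e(n;H(K))=\Omega(n^{-\alpha})$. If $( * )$ holds for $\tau$ arbitrarily close to $\alpha$, then $$p^{\mathrm{unr}}=\max\left\{\frac1\alpha,\frac{2}{\mathrm{decay}_\gamma-1}\right\}.$$
   Context: Setting. $\mathbb N=\{1,2,\dots\}$, $\mathbb N_0=\mathbb N\cup\{0\}$, $[n]=\{1,\dots,n\}$; $\mathcal U$ is the set of all finite subsets of $\mathbb N$. $D\subseteq\mathbb R$ is a Borel set, $K:D\times D\to\mathbb R$ is a measurable, not identically zero reproducing kernel (symmetric, positive semidefinite) with anchor $c\in D$, i.e. $K(c,c)=0$; $H=H(K)$ is its reproducing kernel Hilbert space (RKHS). $\rho$ is a probability measure on $D$ with $M:=\int_DK(x,x)\,\rho(dx)<\infty$ and $C_0:=\int_D\int_DK(x,y)\,\rho(dx)\rho(dy)>0$. For $u\in\mathcal U$ put $K_u(x,y)=\prod_{j\in u}K(x_j,y_j)$ for $x,y\in D^{\mathbb N}$ ($K_\emptyset\equiv1$), $H_u=H(K_u)$; functions in $H_u$ depend only on the coordinates in $u$ and are identified with functions on $D^u$. Weights are families $\gamma=(\gamma_u)_{u\in\mathcal U}$ of non-negative reals with $\sum_u\gamma_uM^{|u|}<\infty$;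 the set $\mathcal A=\{u\in\mathcal U:\gamma_u>0\}$ is assumed to contain a non-empty set. Let $\mathfrak X=\{x\in D^{\mathbb N}:\sum_{u\in\mathcal A}\gamma_u\prod_{j\in u}K(x_j,x_j)<\infty\}$ and let $\mathcal H_\gamma$ be the RKHS on $\mathfrak X$ with kernel $\sum_{u\in\mathcal A}\gamma_uK_u$. Every $f\in\mathcal H_\gamma$ has a unique representation $f=\sum_{u\in\mathcal A}f_u$, $f_u\in H_u$, and $\|f\|_\gamma^2=\sum_{u\in\mathcal A}\gamma_u^{-1}\|f_u\|_{H_u}^2$. $\mu$ is the infinite product of $\rho$ on $D^{\mathbb N}$ (it satisfies $\mu(\mathfrak X)=1$) and $I(f)=\int_{\mathfrak X}f\,d\mu$. Algorithms and errors. For $u\in\mathcal U$, $x\in D^u$, $(x;c)$ is the point of $D^{\mathbb N}$ whose $j$th coordinate is $x_j$ for $j\in u$ and $c$ otherwise. Admissible algorithms: $Q(f)=\sum_{i=1}^na_if(t_{v_i};c)$ with $n\in\mathbb N_0$, $a_i\in\mathbb R$, $v_i\in\mathcal U$, $t_{v_i}\in(D\setminus\{c\})^{v_i}$ (coordinates equal to $c$ are dropped from $v_i$). $e(Q;\mathcal H_\gamma)=\sup_{\|f\|_\gamma\le1}|I(f)-Q(f)|$. For a linear quadrature $Q_{n,u}(g)=\sum_{i=1}^na_ig(x^{(i)})$, $a_i\in\mathbb R$, $x^{(i)}\in D^u$, on $H_u$: $e(Q_{n,u};H_u)=\sup_{\|g\|_{H_u}\le1}|\int_{D^u}g\,d\rho^u-Q_{n,u}(g)|$.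 The univariate minimal error is $e(n;H)=\inf\sup_{\|g\|_H\le1}|\int_Dg\,d\rho-\sum_{i=1}^na_ig(x^{(i)})|$, infimum over $a_i\in\mathbb R$, $x^{(i)}\in D$. Cost (unrestricted subspace sampling). $\$:\mathbb N_0\to[1,\infty)$ is a non-decreasing cost function and $\mathrm{cost}_{\mathrm{unr}}(Q)=\sum_{i=1}^n\$(|v_i|)$. Tractability. $\mathrm{comp}_{\mathrm{unr}}(\varepsilon)=\inf\{\mathrm{cost}_{\mathrm{unr}}(Q): Q\text{ admissible},\ e(Q;\mathcal H_\gamma)\le\varepsilon\}$. The problem is strongly tractable if there are $C,p\ge0$ with $\mathrm{comp}_{\mathrm{unr}}(\varepsilon)\le C\varepsilon^{-p}$ for all $\varepsilon>0$; the exponent $p^{\mathrm{unr}}$ is the infimum of all such $p$. POD weights. Product and order-dependent (POD) weights are weights $\gamma_u=\Gamma_{|u|}\prod_{j\in u}\gamma_j$ with reals $\gamma_1\ge\gamma_2\ge\cdots\ge0$, $\Gamma_0=\Gamma_1=1$, $\Gamma_2,\Gamma_3,\ldots\ge0$. Decay. $\widehat\gamma_u=\gamma_uC_0^{|u|}$. For $\sigma\in\mathbb N\cup\{\infty\}$ let $u_1(\sigma),u_2(\sigma),\dots$ be the distinct non-empty $u$ with $\gamma_u>0$ and $|u|\le\sigma$, ordered so that $\widehat\gamma_{u_1(\sigma)}\ge\widehat\gamma_{u_2(\sigma)}\ge\cdots$. $\mathrm{decay}_{\gamma,\sigma}=\sup\{p\in\mathbb R:\lim_{j\to\infty}\widehat\gamma_{u_j(\sigma)}j^p=0\}$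 (equal to $\infty$ if there are only finitely many $u_j(\sigma)$); $\mathrm{decay}_\gamma=\mathrm{decay}_{\gamma,\infty}$. Changing dimension algorithms. For given $\lambda_0,\tau$ and building blocks $Q_{n,u}$ as in $( * )$, put $L_{1-\lambda_0}=\sum_{\emptyset\ne u\in\mathcal U}\gamma_u^{1-\lambda_0}$. For $\varepsilon>0$ and $u\neq\emptyset$: if $\gamma_u^{\lambda_0}L_{1-\lambda_0}c_1C^{|u|}\le\varepsilon^2$, set $n_u=0$ and let $Q_{0,u}$ be the zero algorithm; otherwise $n_u=\lfloor(\gamma_u^{\lambda_0}L_{1-\lambda_0}c_1C^{|u|}\varepsilon^{-2})^{1/(2\tau)}\rfloor$. Define $Q^{\mathrm{CD}}_\varepsilon(f)=f(c,c,\dots)+\sum_{\emptyset\neq u\in\mathcal U}Q_{n_u,u}(f_u)$, where values of $f_u$ are computed by $f_u(x)=\sum_{v\subseteq u}(-1)^{|u\setminus v|}f(x_v;c)$, $x_v=(x_j)_{j\in v}$. Finally $d(\varepsilon)=\max\{\ell\in\mathbb N:\ c_1C^\ell L_{1-\lambda_0}\gamma_{[\ell]}^{\lambda_0}>\varepsilon^2\}$, where $\gamma_{[\ell]}$ is the weight of the set $[\ell]$. *)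

(* Defs.v *)
From HB Require Import structures.
From mathcomp Require Import all_boot all_order all_algebra finmap.
From mathcomp Require Import all_classical all_reals all_analysis.

Set Implicit Arguments.
Unset Strict Implicit.
Unset Printing Implicit Defensive.
Import Order.TTheory GRing.Theory Num.Theory.
Import numFieldNormedType.Exports.
Local Open Scope classical_set_scope.
Local Open Scope ring_scope.

(* Coordinates are numbered from 0: index j stands for the (j+1)-st coordinate,
   so [n] = {1,..,n} is encoded as {0,..,n-1}. Finite coordinate sets are
   elements of {fset nat}. *)

(* The Borel set D with its trace sigma-algebra. A measurableType must be
   inhabited; the anchor c provides the witness. *)
Definition dom_base (R : realType) (D : set R) (c : R) (Dc : D c) : Type :=
  set_type D.

HB.instance Definition _ (R : realType) (D : set R) (c : R) (Dc : D c) :=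
  Choice.copy (dom_base Dc) (set_type D).
HB.instance Definition _ (R : realType) (D : set R) (c : R) (Dc : D c) :=
  isPointed.Build (dom_base Dc) (exist _ c (mem_set Dc) : set_type D).

Definition dom (R : realType) (D : set R) (c : R) (Dc : D c) :=
  g_sigma_algebra_preimageType
    (fun x : dom_base Dc => set_val (x : set_type D) : measurableTypeR R).

Definition anchor (R : realType) (D : set R) (c : R) (Dc : D c) : dom Dc :=
  exist _ c (mem_set Dc).

Definition cylinders d (T : measurableType d) : set_system (nat -> T) :=
  [set B | exists j, exists2 A, measurable A & B = [set x | A (x j)]].

Definition seqspace d (T : measurableType d) :=
  g_sigma_algebraType (@cylinders d T).

Definition infinite_product (R : realType) d (T : measurableType d)
    (rho : probability T R) (mu : probability (seqspace T) R) :=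
  forall (n : nat) (A : nat -> set T), (forall j, measurable (A j)) ->
    mu [set x : seqspace T | forall j, (j < n)%N -> A j (x j)] =
    (\prod_(j < n) rho (A j))%E.

Definition pos_semidef (R : realType) (X : Type) (k : X -> X -> R) :=
  forall (n : nat) (a : 'I_n -> R) (x : 'I_n -> X),
    0 <= \sum_i \sum_j a i * a j * k (x i) (x j).

Record rkhs (R : realType) (X : Type) (k : X -> X -> R) := Rkhs {
  carrier : set (X -> R) ;
  inner : (X -> R) -> (X -> R) -> R ;
  norm := fun f => Num.sqrt (inner f f) ;
  carrier0 : carrier (fun=> 0) ;
  carrierD : forall a f g, carrier f -> carrier g ->
    carrier (fun x => a * f x + g x) ;
  innerC : forall f g, carrier f -> carrier g -> inner f g = inner g f ;
  innerD : forall a f g h, carrier f -> carrier g -> carrier h ->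
    inner (fun x => a * f x + g x) h = a * inner f h + inner g h ;
  inner_ge0 : forall f, carrier f -> 0 <= inner f f ;
  inner_eq0 : forall f, carrier f -> inner f f = 0 -> f = fun=> 0 ;
  complete : forall f_ : nat -> X -> R, (forall n, carrier (f_ n)) ->
    (forall e, 0 < e -> exists N, forall m n, (N <= m)%N -> (N <= n)%N ->
       norm (fun x => f_ m x - f_ n x) < e) ->
    exists2 f, carrier f & norm (fun x => f_ n x - f x) @[n --> \oo] --> 0 ;
  kernel_in : forall x, carrier (k^~ x) ;
  reproducing : forall f x, carrier f -> inner f (k^~ x) = f x }.

Definition wce (R : realType) (X : Type) (k : X -> X -> R) (H : rkhs k)
    (I : (X -> R) -> \bar R) (Q : (X -> R) -> R) : \bar R :=
  ereal_sup [set `|I f - (Q f)%:E|%E |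
             f in [set f | carrier H f /\ norm H f <= 1]].

Definition quad (R : realType) (X : Type) (s : seq (R * X)) (f : X -> R) : R :=
  \sum_(p <- s) p.1 * f p.2.

Section Setting.
Context {R : realType} {d : measure_display} {T : measurableType d}.
Implicit Types (K : T -> T -> R) (rho : probability T R)
  (mu : probability (seqspace T) R) (c : T) (u v : {fset nat})
  (w : {fset nat} -> R).

Definition diag_mean K rho : \bar R := (\int[rho]_x (K x x)%:E)%E.

Definition double_mean K rho : R := \int[rho]_x \int[rho]_y K x y.

Definition min_err K rho (H : rkhs K) (n : nat) : \bar R :=
  ereal_inf [set wce H (fun g => (\int[rho]_x (g x)%:E)%E) (quad s) |
             s in [set: n.-tuple (R * T)]].

Definition Kset K u (x y : seqspace T) : R := \prod_(j <- u) K (x j) (y j).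

Definition active_sets w : set {fset nat} := [set u | 0 < w u].

Definition Xdom K w : set (seqspace T) :=
  [set x | (\esum_(u in active_sets w) (w u * Kset K u x x)%:E < +oo)%E].

(* The signed, absolutely convergent series of the w u * Kset K u x y. *)
Definition Kweighted K w (x y : set_type (Xdom K w)) : R :=
  let a u := (w u * Kset K u (set_val x) (set_val y))%:E in
  fine (\esum_(u in active_sets w) (a^\+ u)
        - \esum_(u in active_sets w) (a^\- u))%E.

(* (x; c): coordinates outside u are replaced by c. *)
Definition anch c u (x : nat -> T) : seqspace T :=
  fun j => if j \in u then x j else c.

(* D^u is represented by T^nat, the coordinates outside u being irrelevant:
   a function in H_u depends on the coordinates in u only, and the marginal of
   mu on these coordinates is rho^u. *)
Definition err_set K mu u (H : rkhs (Kset K u)) (s : seq (R * seqspace T)) :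
    \bar R :=
  wce H (fun g => (\int[mu]_x (g x)%:E)%E) (quad s).

(* The term  coef * f (node_v; c)  with v = active. *)
Record sample := Sample { coef : R ; active : {fset nat} ; node : nat -> T }.

Definition algorithm := seq sample.

Definition admissible c (Q : algorithm) : bool :=
  all (fun t => all (fun j => node t j != c) (active t)) Q.

Definition apply_alg c (Q : algorithm) (f : seqspace T -> R) : R :=
  quad [seq (coef t, anch c (active t) (node t)) | t <- Q] f.

(* Functions on Xdom are evaluated through their extension by 0; all points
   (t; c) lie in Xdom because K c c = 0. *)
Definition err_gamma K w mu c (H : rkhs (@Kweighted K w)) (Q : algorithm) :
    \bar R :=
  wce H (fun f => (\int[mu]_(x in Xdom K w) ('valL_0 f x)%:E)%E)
        (fun f => apply_alg c Q ('valL_0 f)).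

Definition cost_unr (cst : nat -> R) (Q : algorithm) : R :=
  \sum_(t <- Q) cst #|` active t|.

Definition comp_unr K w mu c (H : rkhs (@Kweighted K w)) (cst : nat -> R)
    (eps : R) : \bar R :=
  ereal_inf [set (cost_unr cst Q)%:E |
             Q in [set Q | admissible c Q /\
                           (err_gamma mu c H Q <= eps%:E)%E]].

Definition tract_exponents K w mu c (H : rkhs (@Kweighted K w))
    (cst : nat -> R) : set R :=
  [set p | 0 <= p /\ exists2 C, 0 <= C & forall eps, 0 < eps ->
     (comp_unr mu c H cst eps <= (C * eps `^ (- p))%:E)%E].

Definition strongly_tractable K w mu c (H : rkhs (@Kweighted K w))
    (cst : nat -> R) := exists p, tract_exponents mu c H cst p.

Definition p_unr K w mu c (H : rkhs (@Kweighted K w)) (cst : nat -> R) :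
    \bar R :=
  ereal_inf [set p%:E | p in tract_exponents mu c H cst].

Definition pod (Gam gam : nat -> R) u : R := Gam #|` u| * \prod_(j <- u) gam j.

(* sigma = None stands for sigma = oo. *)
Definition sets_upto w (sigma : option nat) : set {fset nat} :=
  [set u | [/\ u != fset0, 0 < w u &
               if sigma is Some s then (#|` u| <= s)%N else true]].

Definition hat K rho w u : R := w u * double_mean K rho ^+ #|` u|.

Definition decay_order K rho w sigma (e : nat -> {fset nat}) :=
  [/\ injective e, range e = sets_upto w sigma &
      forall i j, (i <= j)%N -> hat K rho w (e j) <= hat K rho w (e i)].

Definition decay K rho w sigma : \bar R :=
  if pselect (finite_set (sets_upto w sigma)) then +oo%E
  else ereal_sup [set p%:E | p in [set p : R |
    exists2 e, decay_order K rho w sigma e &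
      hat K rho w (e j) * j.+1%:R `^ p @[j --> \oo] --> 0]].

Definition bb_bound (tau c1 C lam1 lam2 : R) (n k : nat) : R :=
  c1 * C ^+ k / n.+1%:R `^ (2 * tau) *
  if k == 1%N then 1 else
    (1 + ln n.+1%:R / k.-1%:R `^ lam2) `^ (lam1 * k.-1%:R `^ lam2).

Definition bb_family := forall n : nat, {fset nat} -> n.-tuple (R * seqspace T).

Definition building_blocks K rho mu (H : forall u, rkhs (Kset K u))
    (tau c1 C lam1 lam2 : R) (Qb : bb_family) :=
  [/\ 1 <= c1, double_mean K rho <= C, 0 <= lam1 & 0 <= lam2 <= 1] /\
  forall u n, u != fset0 -> (0 < n)%N ->
    (err_set mu (H u) (Qb n u) ^+ 2 <=
     (bb_bound tau c1 C lam1 lam2 n #|` u|)%:E)%E.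

Section ChangingDimension.
Variables (w : {fset nat} -> R) (c : T) (lam0 tau c1 C : R) (Qb : bb_family).

Definition Lsum : R :=
  fine (\esum_(u in [set u : {fset nat} | u != fset0])
          (w u `^ (1 - lam0))%:E)%E.

Definition cd_thr u : R := w u `^ lam0 * Lsum * c1 * C ^+ #|` u|.

Definition cd_n (eps : R) u : nat :=
  if cd_thr u <= eps ^+ 2 then 0%N
  else Num.truncn ((cd_thr u * eps ^- 2) `^ (2 * tau)^-1).

Definition cd_sets (eps : R) : set {fset nat} :=
  [set u | u != fset0 /\ (0 < cd_n eps u)%N].

(* The samples used by sum_i a_i f_u(x_i), for s = [:: (a_i, x_i)], where
   f_u(x) = sum_(v subset u) (-1)^|u\v| f(x_v; c); coordinates equal to c are
   not active. *)
Definition cd_block (s : seq (R * seqspace T)) u : algorithm :=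
  [seq Sample ((-1) ^+ #|` (u `\` v)%fset| * p.1)
              [fset j in v | p.2 j != c]%fset p.2
  | p <- s, v <- enum_fset (fpowerset u)].

(* fset_set returns the finite set cd_sets eps as an fset (and the empty fset on
   an infinite set). For n = 0 the tuple Qb n u is empty. *)
Definition cd_alg (eps : R) : algorithm :=
  Sample 1 fset0 (fun=> c) ::
  flatten [seq cd_block (Qb (cd_n eps u) u) u
          | u <- enum_fset (fset_set (cd_sets eps))].

Definition cd_dims (eps : R) : set nat :=
  [set l | (0 < l)%N /\
           eps ^+ 2 <
           c1 * C ^+ l * Lsum * w [fset j in iota 0 l]%fset `^ lam0].

Definition is_max (A : set nat) (m : nat) :=
  A m /\ forall l, A l -> (l <= m)%N.

Definition cd_dim (eps : R) : nat := xget 0%N [set m | is_max (cd_dims eps) m].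

End ChangingDimension.

Definition anchored_part c u (f : seqspace T -> R) (x : nat -> T) : R :=
  \sum_(v <- enum_fset (fpowerset u))
     (-1) ^+ #|` (u `\` v)%fset| * f (anch c v x).

Lemma apply_cd_alg w c (lam0 tau c1 C : R) (Qb : bb_family) eps f :
  apply_alg c (cd_alg w c lam0 tau c1 C Qb eps) f =
  f (fun=> c) +
  \sum_(u <- enum_fset (fset_set (cd_sets w lam0 tau c1 C eps)))
    quad (Qb (cd_n w lam0 tau c1 C eps u) u) (anchored_part c u f).
Proof.
rewrite /apply_alg /quad big_map big_cons /= mul1r; congr (_ + _).
rewrite big_flatten big_map; apply: eq_bigr => u _.
rewrite /cd_block big_allpairs_dep; apply: eq_bigr => -[a x] _ /=.
rewrite /anchored_part big_distrr /=; apply: eq_bigr => v _.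
rewrite mulrCA mulrA /=; congr (_ * _); apply: congr1; apply/funext => j.
rewrite /anch !inE /=; case: (j \in v) => //=.
by case: eqVneq.
Qed.

Lemma cd_alg_admissible w c (lam0 tau c1 C : R) (Qb : bb_family) eps :
  admissible c (cd_alg w c lam0 tau c1 C Qb eps).
Proof.
rewrite /admissible /=.
elim: (enum_fset _) => //= u us IHu; rewrite all_cat {}IHu andbT /cd_block.
elim: (tval _) => //= p s IH; rewrite all_cat IH andbT all_map.
by apply/allP => v _ /=; apply/allP => j; rewrite !inE => /andP[].
Qed.

End Setting.

(* Main.v *)
(** For a bounded linear functional I - Q on a reproducing kernel Hilbert space,
    the squared worst case error is the double application of I - Q to the kernel.
    For the weighted kernel this double application splits, by dominated
    convergence, into the sum over u of gamma_u times the squared error of the same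
    functional on H_u. On anchored functions of H_u the changing dimension algorithm
    reduces, by Moebius inversion, to its building block Q_{n_u,u} (or to zero), so
    the errors and the costs are controlled by the sums over u of
    gamma_u^s B^|u|. These are finite for every B and every s > 1 / decay_{gamma,1}:
    the sum over |u| = k is at most Gamma_k^s (sum_j B gamma_j^s)^k / k!, and q < p*
    leaves a negative power of k!. The same bound gives decay_gamma = decay_{gamma,1}
    and d(eps) = O(ln(1/eps) / lnln(1/eps)), which makes the logarithmic factors of
    the building blocks eps^(-o(1)). For the lower bounds, dropping all but one
    summand reduces to univariate integration, and the summands of single coordinates
    not used by Q are incurred in full. *)
Require Import Defs.
From HB Require Import structures.
From mathcomp Require Import all_boot all_order all_algebra finmap.
From mathcomp Require Import all_classical all_reals all_analysis.
From mathcomp Require Import measurable_realfun ring lra zify.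

Set Implicit Arguments.
Unset Strict Implicit.
Unset Printing Implicit Defensive.
Import Order.TTheory GRing.Theory Num.Theory.
Import numFieldNormedType.Exports.
Local Open Scope classical_set_scope.
Local Open Scope ring_scope.

(** The spaces are given only as abstract records, so the measurability and integrability of their
    elements, and the representer of the error functional, have to be drawn from completeness and
    the reproducing property. The decomposition of an element of H_gamma into components f_u is
    never formed: everything is read off the kernel. All domains D^u are replaced by the one
    sequence space with [mu], so the errors on every H_u and on H_gamma are integrals against the
    same measure. The constraints on lam0 and tau say that 1 - lam0 and lam0 / (2 tau) exceed 1 /
    decay, the range in which the weight sums converge: the first exponent makes L finite (error),
    the second bounds the number of samples (cost). They also force tau < (decay - 1) / 2, so 1 /
    tau is the larger term in the first bound on the exponent. For the sharp exponent lam0 is chosen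
    afresh for each rate t below the minimum of alpha and (decay - 1) / 2; the maximum in the result
    is the reciprocal of this minimum. *)

(** * Abstract reproducing kernel Hilbert spaces: evaluation bounds, Riesz representation, density
    of kernel combinations *)

Section RkhsTheory.
Context {R : realType} {X : Type} {k : X -> X -> R} (H : rkhs k).
Implicit Types (f g h : X -> R) (a b : R).

Lemma carrierZ a f : carrier H f -> carrier H (fun x => a * f x).
Proof.
move=> Hf; have := carrierD a Hf (carrier0 H).
by congr (carrier H); apply/funext => x; rewrite addr0.
Qed.

Lemma carrierB f g : carrier H f -> carrier H g ->
  carrier H (fun x => f x - g x).
Proof.
move=> Hf Hg; have := carrierD (-1) Hg Hf.
by congr (carrier H); apply/funext => x; ring.
Qed.

Lemma inner0l h : carrier H h -> inner H (fun=> 0) h = 0.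
Proof.
move=> Hh; have := innerD 1 (carrier0 H) (carrier0 H) Hh.
rewrite (_ : (fun x => 1 * 0 + 0) = (fun=> 0)); last first.
  by apply/funext => x; ring.
lra.
Qed.

Lemma innerZl a f h : carrier H f -> carrier H h ->
  inner H (fun x => a * f x) h = a * inner H f h.
Proof.
move=> Hf Hh; have := innerD a Hf (carrier0 H) Hh.
rewrite inner0l// addr0 => <-; congr (inner H _ h).
by apply/funext => x; rewrite addr0.
Qed.

Lemma innerBl f g h : carrier H f -> carrier H g -> carrier H h ->
  inner H (fun x => f x - g x) h = inner H f h - inner H g h.
Proof.
move=> Hf Hg Hh; have := innerD (-1) Hg Hf Hh.
rewrite (_ : (fun x => -1 * g x + f x) = (fun x => f x - g x)); last first.
  by apply/funext => x; ring.
by move=> ->; ring.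
Qed.

Lemma inner_sqr a f g : carrier H f -> carrier H g ->
  inner H (fun x => a * f x + g x) (fun x => a * f x + g x) =
  a ^+ 2 * inner H f f + 2 * a * inner H f g + inner H g g.
Proof.
move=> Hf Hg; have Hfg := carrierD a Hf Hg.
rewrite innerD// innerC// [inner H g _]innerC// !innerD// (innerC Hg Hf).
by ring.
Qed.

Lemma norm_ge0 f : 0 <= norm H f.
Proof. exact: sqrtr_ge0. Qed.

Lemma norm_sqr f : carrier H f -> norm H f ^+ 2 = inner H f f.
Proof. by move=> Hf; rewrite /norm sqr_sqrtr// inner_ge0. Qed.

Lemma normZ a f : carrier H f -> norm H (fun x => a * f x) = `|a| * norm H f.
Proof.
move=> Hf; rewrite /norm innerZl//; last exact: carrierZ.
rewrite innerC//; last exact: carrierZ.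
by rewrite innerZl// mulrA -expr2 sqrtrM ?sqr_ge0// sqrtr_sqr.
Qed.

Lemma cauchy_schwarz f g : carrier H f -> carrier H g ->
  `|inner H f g| <= norm H f * norm H g.
Proof.
move=> Hf Hg.
have [f0|f0] := eqVneq (inner H f f) 0.
  by rewrite (inner_eq0 Hf f0) inner0l// normr0 mulr_ge0// norm_ge0.
have fgt0 : 0 < inner H f f by rewrite lt_neqAle eq_sym f0 inner_ge0.
have := inner_ge0 (carrierD (- (inner H f g / inner H f f)) Hf Hg).
rewrite inner_sqr// => le0.
rewrite -(ler_pXn2r (ltn0Sn 1)) ?nnegrE ?mulr_ge0 ?norm_ge0//.
rewrite exprMn !norm_sqr// real_normK ?num_real// -subr_ge0.
have := mulr_ge0 (ltW fgt0) le0; congr (0 <= _); field; exact: f0.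
Qed.

Lemma kernel_sym x y : k x y = k y x.
Proof.
rewrite -(reproducing x (kernel_in H y)) -(reproducing y (kernel_in H x)).
by rewrite innerC//; exact: kernel_in.
Qed.

Lemma kernel_diag_ge0 x : 0 <= k x x.
Proof.
rewrite -(reproducing x (kernel_in H x)); exact/inner_ge0/kernel_in.
Qed.

Lemma norm_kernel x : norm H (k^~ x) = Num.sqrt (k x x).
Proof. by rewrite /norm reproducing//; exact: kernel_in. Qed.

Lemma eval_le f x : carrier H f -> `|f x| <= norm H f * Num.sqrt (k x x).
Proof.
move=> Hf; rewrite -(reproducing x Hf) -norm_kernel; apply: cauchy_schwarz => //.
exact: kernel_in.
Qed.

(** Trading the square root for 1 + k x x gives a dominator that is integrable as soon as the
    diagonal is, and that is positive, so one can divide by it. *)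
Lemma eval_le1 f x : carrier H f -> `|f x| <= norm H f * (1 + k x x).
Proof.
move=> Hf; apply: (le_trans (eval_le x Hf)); rewrite ler_wpM2l ?norm_ge0//.
have := kernel_diag_ge0 x; set t := k x x => t0.
by rewrite -(ler_pXn2r (ltn0Sn 1)) ?nnegrE ?sqrtr_ge0 ?addr_ge0// sqr_sqrtr//; nra.
Qed.

(** Cauchy-Schwarz and the inequality of the means separate the two variables, so the diagonal alone
    dominates the whole kernel. *)
Lemma kernel_le x y : `|k x y| <= (k x x + k y y) / 2.
Proof.
apply: (le_trans (eval_le x (kernel_in H y))); rewrite norm_kernel.
rewrite -{2}(sqr_sqrtr (kernel_diag_ge0 x)) -{2}(sqr_sqrtr (kernel_diag_ge0 y)).
have := sqr_ge0 (Num.sqrt (k x x) - Num.sqrt (k y y)); nra.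
Qed.

(* The minimisers of |f|^2 - 2 l(f) over V form a Cauchy sequence by the
   parallelogram law. *)
Lemma representer (V : set (X -> R)) (l : (X -> R) -> R) B :
  V `<=` carrier H -> V (fun=> 0) ->
  (forall a f g, V f -> V g -> V (fun x => a * f x + g x)) ->
  (forall a f g, V f -> V g -> l (fun x => a * f x + g x) = a * l f + l g) ->
  (forall f, V f -> `|l f| <= B * norm H f) ->
  exists2 g_ : nat -> X -> R, (forall n, V (g_ n)) &
  exists2 h, carrier H h & norm H (fun x => g_ n x - h x) @[n --> \oo] --> 0 /\
    forall f, V f -> inner H f h = l f.
Proof.
move=> VH V0 VD lD lB.
pose J f := inner H f f - 2 * l f.
have JB f : V f -> - B ^+ 2 <= J f.
  move=> Vf; rewrite /J -norm_sqr; last exact: VH.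
  have /ler_normlP[_] := lB _ Vf; have := sqr_ge0 (norm H f - B).
  nra.
have hinf : has_inf [set J f | f in V].
  split; first by exists (J (fun=> 0)), (fun=> 0).
  by exists (- B ^+ 2) => _ [f Vf <-]; exact: JB.
set m := inf [set J f | f in V].
have Jm f : V f -> m <= J f by move=> Vf; apply: ge_inf; [case: hinf|exists f].
have /choice [g_ g_P] : forall n : nat, exists f, V f /\ J f < m + n.+1%:R^-1.
  move=> n; have [|_ [f Vf <-] ?] := @inf_adherent _ _ n.+1%:R^-1 _ hinf.
    by rewrite invr_gt0.
  by exists f.
have V_ n : V (g_ n) by case: (g_P n).
have H_ n : carrier H (g_ n) by exact/VH.
exists g_ => //.
have JD a f g : V f -> V g -> J (fun x => a * f x + g x) =
   a ^+ 2 * inner H f f + 2 * a * (inner H f g - l f) + J g.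
  move=> Vf Vg; rewrite /J inner_sqr ?lD//; [ring|exact: VH|exact: VH].
have dist i j : norm H (fun x => g_ i x - g_ j x) ^+ 2 <=
    2 * (i.+1%:R^-1 + j.+1%:R^-1).
  have VB : V (fun x => -1 * g_ j x + g_ i x) by exact: VD.
  have Bi : carrier H (fun x => g_ i x - g_ j x) by exact: carrierB.
  (* The test point is the midpoint of [g_ i] and [g_ j], written as [g_ i] minus half the
     difference so that [VD] applies. *)
  have := Jm _ (VD (- 2^-1) _ _ VB (V_ i)); rewrite JD//.
  have [_ ] := g_P i; have [_] := g_P j; rewrite /J lD//.
  rewrite (_ : (fun x => -1 * g_ j x + g_ i x) = (fun x => g_ i x - g_ j x)).
    rewrite norm_sqr// !innerBl//.
    rewrite ![inner H (g_ _) (fun x => _ - _)]innerC// !innerBl//.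
    rewrite (innerC (H_ j) (H_ i)) (_ : (- 2^-1) ^+ 2 = 4^-1 :> R); last by field.
    rewrite (_ : 2 * - 2^-1 = -1 :> R); last by field.
    move: (inner H (g_ i) (g_ i)) (inner H (g_ i) (g_ j)) (inner H (g_ j) (g_ j)).
    move: (l _) (l _) (_.+1%:R^-1) (_.+1%:R^-1) => li lj ei ej A C D0.
    lra.
  by apply/funext => x; ring.
have [||h Hh hcv] := @complete _ _ _ H g_; first exact: H_.
  move=> e e0; pose N := Num.truncn (4 / e ^+ 2); exists N => p q Np Nq.
  rewrite -(ltr_pXn2r (ltn0Sn 1)) ?nnegrE ?norm_ge0 ?(ltW e0)//.
  apply: (le_lt_trans (dist _ _)).
  have N4 : N.+1%:R^-1 < e ^+ 2 / 4.
    rewrite -[ltRHS]invf_div ltf_pV2 ?posrE ?divr_gt0 ?exprn_gt0//.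
    by rewrite truncnS_gt.
  have pN : p.+1%:R^-1 <= N.+1%:R^-1 :> R.
    by rewrite lef_pV2 ?posrE// ler_nat.
  have qN : q.+1%:R^-1 <= N.+1%:R^-1 :> R.
    by rewrite lef_pV2 ?posrE// ler_nat.
  move: (p.+1%:R^-1) (q.+1%:R^-1) (N.+1%:R^-1) N4 pN qN => x y z. lra.
exists h => //; split => // f Vf; have Hf := VH _ Vf.
have cvi : inner H f (g_ n) @[n --> \oo] --> inner H f h.
  apply/cvgrPdist_le => e e0.
  have d0 : 0 < e / (norm H f + 1) by rewrite divr_gt0// ltr_wpDl// norm_ge0.
  move/cvgrPdist_le: hcv => /(_ _ d0) [N _ NP]; exists N => // n /NP /=.
  rewrite sub0r normrN ger0_norm ?norm_ge0// => le_n.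
  rewrite [inner H f h]innerC// [inner H f _]innerC// distrC -innerBl//.
  apply: (le_trans (cauchy_schwarz (carrierB (H_ n) Hh) Hf)).
  apply: (le_trans (ler_wpM2r (norm_ge0 f) le_n)).
  rewrite mulrAC ler_pdivrMr ?ltr_wpDl ?norm_ge0//.
  by rewrite ler_wpM2l ?(ltW e0)// lerDl.
(* Near-minimality of [g_ n], tested in the direction of f, passes to the limit. A quadratic in t
   without constant term stays non-negative only if its linear coefficient vanishes. *)
have lim t : 0 <= t ^+ 2 * inner H f f + 2 * t * (inner H f h - l f).
  have c1 : t ^+ 2 * inner H f f + 2 * t * (inner H f (g_ n) - l f) + n.+1%:R^-1
     @[n --> \oo] --> t ^+ 2 * inner H f f + 2 * t * (inner H f h - l f) + 0.
    apply: cvgD; last exact: cvg_harmonic.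
    apply: cvgD; first exact: cvg_cst.
    apply: cvgM; first exact: cvg_cst.
    by apply: cvgB => //; exact: cvg_cst.
  rewrite -[leRHS]addr0 -(cvg_lim _ c1)//; apply: limr_ge.
    by apply/cvg_ex; exists (t ^+ 2 * inner H f f + 2 * t * (inner H f h - l f) + 0).
  near=> n; have := Jm _ (VD t _ _ Vf (V_ n)); rewrite JD//.
  have [_ lt_n] := g_P n; move=> le_n.
  by move: lt_n le_n => /=; move: (n.+1%:R^-1) (J _) => z y; lra.
(* The denominator [inner H f f + 1], in place of the [inner H f f] of the exact minimiser, also
   covers a vanishing f. *)
have := lim (- ((inner H f h - l f) / (inner H f f + 1))).
have := inner_ge0 Hf; set A := inner H f f; set d := inner H f h - l f.
move=> A0 key; have A1 : 0 < A + 1 by lra.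
apply/eqP; rewrite -subr_eq0 -/d -sqrf_eq0 eq_le sqr_ge0 andbT.
have /(mulr_ge0 (sqr_ge0 (A + 1))) := key.
rewrite (_ : _ * _ = - (d ^+ 2 * (A + 2))); last by field; lra.
by rewrite oppr_ge0 pmulr_lle0//; lra.
Unshelve. all: end_near.
Qed.

Lemma riesz (l : (X -> R) -> R) B :
  (forall a f g, carrier H f -> carrier H g ->
     l (fun x => a * f x + g x) = a * l f + l g) ->
  (forall f, carrier H f -> `|l f| <= B * norm H f) ->
  exists2 h, carrier H h & forall f, carrier H f -> inner H f h = l f.
Proof.
move=> lD lB.
have [//|||g_ _ [h Hh [_ hP]]] := @representer (carrier H) l B _ _ _ lD lB.
- exact: carrier0.
- by move=> a f g; exact: carrierD.
- by exists h.
Qed.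

Definition kernel_span : set (X -> R) :=
  [set f | exists s : seq (R * X), f = fun x => \sum_(p <- s) p.1 * k x p.2].

Lemma kernel_span_carrier : kernel_span `<=` carrier H.
Proof.
move=> _ [s ->]; elim: s => [|p s IH].
  by under eq_fun do rewrite big_nil; exact: carrier0.
under eq_fun do rewrite big_cons.
by apply: carrierD => //; exact: kernel_in.
Qed.

(** The representer h of g |-> <g, f> on the span is the projection of f: it has the same inner
    products as f with all kernel sections, hence the same values by the reproducing property, and
    it is a limit of span elements by construction. *)
Lemma kernel_span_dense f : carrier H f ->
  exists2 g_ : nat -> X -> R, (forall n, kernel_span (g_ n)) &
    norm H (fun x => g_ n x - f x) @[n --> \oo] --> 0.
Proof.
move=> Hf.
have [||||g_ sg [h Hh [hcv hP]]] :=
    @representer kernel_span (fun g => inner H g f) (norm H f)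
      kernel_span_carrier.
- by exists [::]; apply/funext => x; rewrite big_nil.
- move=> a _ _ [s ->] [t ->]; exists ([seq (a * p.1, p.2) | p <- s] ++ t).
  apply/funext => x; rewrite big_cat big_map mulr_sumr/=; congr (_ + _).
  by apply: eq_bigr => i _; rewrite mulrA.
- by move=> a g g' /kernel_span_carrier Hg /kernel_span_carrier Hg'; rewrite innerD.
- by move=> g /kernel_span_carrier Hg; rewrite mulrC; exact: cauchy_schwarz.
exists g_ => //; suff <- : h = f by [].
apply/funext => x; rewrite -(reproducing x Hh) -(reproducing x Hf).
have Hx := kernel_in H x.
rewrite innerC// [RHS]innerC// hP//; exists [:: (1, x)].
by apply/funext => y; rewrite big_seq1 mul1r.
Qed.

End RkhsTheory.

(** * Integration minus quadrature as a bounded functional, and its worst case error *)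

Section IntegralFunctional.
Context {R : realType} {d : measure_display} {S : measurableType d}.
Variables (nu : probability S R) (E : set S).
Hypothesis mE : measurable E.
Context {X : Type} {k : X -> X -> R} (H : rkhs k) (p : S -> X).
Hypothesis mk : forall x, measurable_fun E (fun s => k (p s) x).
Hypothesis ik : nu.-integrable E (fun s => (k (p s) (p s))%:E).

(** The space is not assumed to consist of measurable functions. Kernel sections are measurable, and
    norm convergence of their combinations implies pointwise convergence. *)
Lemma carrier_measurable f : carrier H f -> measurable_fun E (f \o p).
Proof.
move=> Hf; have [g_ sg gf] := kernel_span_dense Hf.
apply: (@measurable_fun_cvg _ _ _ _ (fun n => g_ n \o p)).
  move=> n; have [s ->] := sg n.
  by apply: measurable_sum => q; exact/measurable_funM/mk/measurable_cst.
move=> s Es /=; apply/cvgrPdist_le => e e0.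
set x := p s.
have d0 : 0 < e / (1 + k x x).
  by rewrite divr_gt0// ltr_pwDl// (kernel_diag_ge0 H).
move/cvgrPdist_le: gf => /(_ _ d0)[N _ NP]; exists N => // n /NP /=.
rewrite sub0r normrN ger0_norm ?norm_ge0// => le_n.
have Hg := kernel_span_carrier H (sg n).
rewrite distrC; apply: (le_trans (eval_le1 x (carrierB Hg Hf))).
by rewrite -ler_pdivlMr// ltr_pwDl// (kernel_diag_ge0 H).
Qed.

Lemma integrable_dominator : nu.-integrable E (fun s => (1 + k (p s) (p s))%:E).
Proof.
exact: (integrableD mE (finite_measure_integrable_cst nu 1 _) ik).
Qed.

Lemma carrier_integrable f : carrier H f ->
  nu.-integrable E (fun s => (f (p s))%:E).
Proof.
move=> Hf.
apply: (@le_integrable _ _ _ _ _ mE _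
  (fun s => (norm H f)%:E * (1 + k (p s) (p s))%:E)%E).
- by apply/measurable_EFinP; exact: carrier_measurable.
- move=> s Es; rewrite -EFinM !abse_EFin lee_fin.
  by apply: (le_trans (eval_le1 _ Hf)); exact: ler_norm.
- exact/integrableZl/integrable_dominator.
Qed.

(** The functional I - Q. The map [p] from the measure space to the domain of the functions is the
    identity for H(K) and H_u; for H_gamma, whose functions live on a subtype, it is [Xproj]. *)
Definition quad_diff (s : seq (R * X)) (f : X -> R) :=
  \int[nu]_(x in E) f (p x) - quad s f.

Lemma quadD (s : seq (R * X)) a (f g : X -> R) :
  quad s (fun x => a * f x + g x) = a * quad s f + quad s g.
Proof.
rewrite /quad mulr_sumr -big_split; apply: eq_bigr => i _ /=; ring.
Qed.

Lemma quad_diffD s a f g : carrier H f -> carrier H g ->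
  quad_diff s (fun x => a * f x + g x) = a * quad_diff s f + quad_diff s g.
Proof.
move=> Hf Hg; rewrite /quad_diff quadD RintegralD//; last exact: carrier_integrable.
  by rewrite RintegralZl//; [ring|exact: carrier_integrable].
by apply: (carrier_integrable (carrierZ a Hf)).
Qed.

Lemma quad_diff_bounded s : exists B,
  forall f, carrier H f -> `|quad_diff s f| <= B * norm H f.
Proof.
exists (\int[nu]_(x in E) (1 + k (p x) (p x)) +
        \sum_(q <- s) `|q.1| * (1 + k q.2 q.2)) => f Hf.
apply: (le_trans (ler_normB _ _)); rewrite mulrDl; apply: lerD.
  apply: (le_trans (le_normr_Rintegral mE (carrier_integrable Hf))).
  rewrite mulrC -RintegralZl//; last exact: integrable_dominator.
  apply: le_Rintegral => //.
  - exact/integrable_norm/carrier_integrable.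
  - exact: (integrableZl mE (norm H f) integrable_dominator).
  - by move=> x Ex; exact: eval_le1.
apply: (le_trans (ler_norm_sum _ _ _)); rewrite mulr_suml; apply: ler_sum => q _.
by rewrite normrM -mulrA ler_wpM2l// mulrC; exact: eval_le1.
Qed.

(** Riesz yields some representer; evaluating it through the reproducing property identifies it as
    the functional applied to one argument of the kernel. *)
Lemma quad_diff_representer s :
  let h x := quad_diff s (k^~ x) in
  carrier H h /\ (forall f, carrier H f -> inner H f h = quad_diff s f).
Proof.
have [B lB] := quad_diff_bounded s.
have [h Hh hP] := riesz (@quad_diffD s) lB.
rewrite /=; set h' := fun x => _; suff <- : h = h' by [].
apply/funext => x; rewrite /h' -hP; last exact: kernel_in.
by rewrite innerC ?reproducing//; exact: kernel_in.
Qed.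

Definition quad_diff2 s := quad_diff s (fun x => quad_diff s (k^~ x)).

Lemma quad_diff2_ge0 s : 0 <= quad_diff2 s.
Proof.
have [Hh hP] := quad_diff_representer s.
by rewrite /quad_diff2 -hP// inner_ge0.
Qed.

(** Cauchy-Schwarz gives the upper bound and the normalised representer attains it; if the
    representer vanishes, the zero function attains the value 0. *)
Lemma wceE (I : (X -> R) -> \bar R) (Q : (X -> R) -> R) s :
  (forall f, carrier H f -> I f = \int[nu]_(x in E) (f (p x))%:E)%E ->
  (forall f, carrier H f -> Q f = quad s f) ->
  wce H I Q = (Num.sqrt (quad_diff2 s))%:E.
Proof.
move=> IE QE; have [Hh hP] := quad_diff_representer s.
set h := fun x => quad_diff s (k^~ x) in Hh hP.
have IQE f : carrier H f -> `|I f - (Q f)%:E|%E = `|quad_diff s f|%:E.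
  move=> Hf; rewrite IE// QE// /quad_diff -abse_EFin EFinB /Rintegral fineK//.
  by apply: integrable_fin_num => //; exact: carrier_integrable.
have nh : norm H h = Num.sqrt (quad_diff2 s) by rewrite /norm hP.
apply/eqP; rewrite eq_le; apply/andP; split.
  apply: ge_ereal_sup => _ [f [Hf f1] <-]; rewrite IQE// lee_fin -hP//.
  apply: (le_trans (cauchy_schwarz Hf Hh)); rewrite nh.
  by rewrite ler_piMl ?sqrtr_ge0.
have [n0|n0] := eqVneq (norm H h) 0.
  pose z : X -> R := fun=> 0; have Hz : carrier H z by exact: carrier0.
  rewrite -nh n0; apply: (@le_trans _ _ (`|quad_diff s z|%:E)).
    by rewrite lee_fin.
  apply: ereal_sup_ubound; exists z; last by rewrite IQE.
  by split => //; rewrite /norm inner0l ?sqrtr0.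
apply: ereal_sup_ubound; exists (fun x => (norm H h)^-1 * h x) => /=.
  split; first exact: carrierZ.
  by rewrite normZ// ger0_norm ?invr_ge0 ?norm_ge0// mulVf.
rewrite IQE; last exact: carrierZ.
rewrite -hP ?innerZl//; last exact: carrierZ.
rewrite -norm_sqr// expr2 mulrA mulVf// mul1r ger0_norm ?norm_ge0//.
by rewrite nh.
Qed.

End IntegralFunctional.

(** * The infinite product measure: integrals of finite products of functions of single
    coordinates *)

Section SequenceSpace.
Context {R : realType} {d : measure_display} {T : measurableType d}.

Lemma measurable_coord (j : nat) :
  measurable_fun setT (fun x : seqspace T => x j).
Proof.
move=> _ Y mY; rewrite setTI; apply: sub_sigma_algebra.
by exists j, Y.
Qed.

(** [mu] is known on boxes only. Prepending a coordinate exhibits it as the image of [rho \x mu],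
    which opens the way to Fubini. *)
Definition scons (q : T * seqspace T) : seqspace T :=
  fun j => if j is j'.+1 then q.2 j' else q.1.

Lemma measurable_scons : measurable_fun setT scons.
Proof.
apply: (@measurability _ _ (T * seqspace T)%type (seqspace T) setT scons (@cylinders _ T)) => //.
move=> _ [_ [[|j] [A mA ->]] <-]; rewrite setTI.
- suff : measurable_fun setT (fun q : T * seqspace T => q.1).
    by move=> /(_ measurableT _ mA); rewrite setTI.
  exact: measurable_fst.
- suff : measurable_fun setT (fun q : T * seqspace T => q.2 j).
    by move=> /(_ measurableT _ mA); rewrite setTI.
  exact: (measurableT_comp (measurable_coord j) measurable_snd).
Qed.

Definition box (n : nat) (A : nat -> set T) : set (seqspace T) :=
  [set x | forall j, (j < n)%N -> A j (x j)].

Definition boxes : set_system (seqspace T) :=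
  [set B | exists n, exists2 A : nat -> set T,
     (forall j, measurable (A j)) & B = box n A].

Lemma measurable_box n A : (forall j, measurable (A j)) -> measurable (box n A).
Proof.
move=> mA; rewrite (_ : box n A =
    \bigcap_(j < n) ((fun x : seqspace T => x j) @^-1` A j)).
  apply: bigcap_measurableType => j _; rewrite -[X in measurable X]setTI.
  exact: (measurable_coord j).
by apply/seteqP; split=> x /= h j; exact: h.
Qed.

Lemma boxesI : setI_closed boxes.
Proof.
move=> _ _ [n [A mA ->]] [m [B mB ->]].
exists (maxn n m), (fun j => (if (j < n)%N then A j else setT) `&`
                             (if (j < m)%N then B j else setT)).
  by move=> j; apply: measurableI; case: ifP.
apply/seteqP; split=> [x [hA hB] j _|x h].
  by split; case: ifP => // jn; [exact: hA|exact: hB].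
split=> j jn.
  by have [] := h j (leq_trans jn (leq_maxl _ _)); rewrite jn.
by have [_] := h j (leq_trans jn (leq_maxr _ _)); rewrite jn.
Qed.

Lemma boxes_generate : @measurable _ (seqspace T) `<=` <<s boxes >>.
Proof.
apply: smallest_sub; first exact: smallest_sigma_algebra.
move=> _ [j [A mA ->]]; apply: sub_sigma_algebra.
exists j.+1, (fun i => if i == j then A else setT).
  by move=> i; case: ifP.
apply/seteqP; split=> x /= h; last by have := h j (ltnSn j); rewrite eqxx.
by move=> i _; case: eqP => // ->.
Qed.

Variables (rho : probability T R) (mu : probability (seqspace T) R).
Hypothesis muE : infinite_product rho mu.

(** Both measures agree on boxes, which are stable under intersection and generate the
    sigma-algebra. *)
Lemma infinite_product_scons A : measurable A ->
  mu A = pushforward (rho \x mu)%E scons A.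
Proof.
move=> mA; apply: (@g_sigma_algebra_measure_unique _ _ _ boxes _ (fun=> setT) _ _ mu
  (pushforward (rho \x mu)%E scons)).
- by move=> _ [n [B mB ->]]; exact: measurable_box.
- by move=> _; exists 0%N, (fun=> setT) => //; apply/seteqP; split.
- by apply/seteqP; split => // x _; exists 0%N.
- exact: measurable_scons.
- exact: boxesI.
- move=> ms _ [n [B mB ->]]; transitivity (\prod_(j < n) rho (B j))%E; first exact: muE.
  suff : (rho \x mu)%E (scons @^-1` box n B) = (\prod_(j < n) rho (B j))%E by [].
  case: n => [|n].
    rewrite (_ : _ @^-1` _ = setT `*` setT); last first.
      by apply/seteqP; split => // -[].
    rewrite product_measure1E// big_ord0.
    by transitivity (rho setT * mu setT)%E => //; rewrite !probability_setT mule1.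
  rewrite (_ : _ @^-1` _ = B 0%N `*` box n (fun j => B j.+1)).
    rewrite product_measure1E//; last exact: measurable_box.
    by rewrite big_ord_recl; congr (_ * _)%E; exact: (muE n (fun j => mB j.+1)).
  apply/seteqP; split => [[a x] h|[a x] [/= h0 h] [|j]//]; last exact: h.
  by split => [|j jn]; [exact: (h 0%N)|exact: (h j.+1)].
- by move=> _; exact: (le_lt_trans (probability_le1 mu measurableT) (ltry 1)).
- exact: boxes_generate.
Qed.

Lemma integral_scons f : measurable_fun setT f ->
  (rho \x mu)%E.-integrable setT (f \o scons) ->
  mu.-integrable setT f /\
  (\int[mu]_x f x = \int[rho \x mu]_q f (scons q))%E.
Proof.
move=> mf fi.
have muP A : measurable A -> A `<=` setT ->
    mu A = (pushforward (rho \x mu)%E scons) A.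
  by move=> mA _; exact: infinite_product_scons.
split.
  apply/integrableP; split => //.
  rewrite (eq_measure_integral (pushforward (rho \x mu)%E scons)).
  - exact: measurable_scons.
  - move=> ms.
    have /integrableP[_] := @integrable_pushforward _ _ _ _ R scons
      measurable_scons (rho \x mu)%E setT f mf fi measurableT.
    exact.
  - by [].
rewrite (eq_measure_integral (pushforward (rho \x mu)%E scons)).
- exact: measurable_scons.
- by move=> ms; rewrite integral_pushforward.
- by [].
Qed.

(** Fubini peels off coordinate 0, and the induction hypothesis applies to the remaining factors
    shifted by one. Integrability is part of the induction because the next use of Fubini needs
    it. *)
Lemma prod_integrable (n : nat) (phi : nat -> T -> R) :
  (forall j, rho.-integrable setT (fun t => (phi j t)%:E)) ->
  mu.-integrable setT (fun x : seqspace T => (\prod_(j < n) phi j (x j))%:E) /\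
  (\int[mu]_x (\prod_(j < n) phi j (x j))%:E =
   \prod_(j < n) \int[rho]_t (phi j t)%:E)%E.
Proof.
elim: n phi => [|n IH] phi iphi.
  have E0 : (fun x : seqspace T => (\prod_(j < 0) phi j (x j))%:E) = EFin \o cst 1.
    by apply/funext => x; rewrite big_ord0.
  rewrite E0; split; first exact: finite_measure_integrable_cst.
  rewrite big_ord0; transitivity (\int[mu]_x (cst 1%:E x))%E => //.
  rewrite integral_cst// mul1e; exact: probability_setT.
have [i1 e1] := IH (fun j => phi j.+1) (fun j => iphi j.+1).
have mphi j : measurable_fun setT (phi j).
  by have /measurable_int /measurable_EFinP := iphi j.
pose F q := ((phi 0%N q.1)%:E * (\prod_(j < n) phi j.+1 ((q.2 : seqspace T) j))%:E)%E.
have sE x : ((EFin \o (fun x : seqspace T => \prod_(j < n.+1) phi j (x j))) \o scons) x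
    = F x.
  by rewrite /= big_ord_recl /= EFinM.
have mP : measurable_fun setT (fun x : seqspace T => \prod_(j < n.+1) phi j (x j)).
  apply: measurable_prod => j _.
  exact: (measurableT_comp (mphi j) (measurable_coord j)).
have mP' : measurable_fun setT (fun x : seqspace T => \prod_(j < n) phi j.+1 (x j)).
  apply: measurable_prod => j _.
  exact: (measurableT_comp (mphi j.+1) (measurable_coord j)).
have mF : measurable_fun setT F.
  apply: emeasurable_funM; apply/measurable_EFinP.
    exact: (measurableT_comp (mphi 0%N) measurable_fst).
  exact: (measurableT_comp mP' measurable_snd).
have iF : (rho \x mu)%E.-integrable setT F.
  apply/integrable12ltyP => //.
  rewrite (eq_integral (fun t => `|(phi 0%N t)%:E| *
      (\int[mu]_x `|(\prod_(j < n) phi j.+1 (x j))%:E|))%E); last first.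
    move=> t _; rewrite -ge0_integralZl//.
      by apply: eq_integral => x _; rewrite /F abseM.
    by apply: measurableT_comp => //; exact/measurable_EFinP.
  rewrite ge0_integralZr//.
  - apply: lte_mul_pinfty.
    + exact: integral_ge0.
    + rewrite ge0_fin_numE ?integral_ge0//.
      by have /integrableP[] := iphi 0%N.
    + by have /integrableP[] := i1.
  - by apply: measurableT_comp => //; exact/measurable_EFinP.
  - exact: integral_ge0.
have [||ii ->] := @integral_scons (EFin \o (fun x : seqspace T => \prod_(j < n.+1) phi j (x j))).
- exact/measurable_EFinP.
- by move: iF; apply: eq_integrable => // x _; rewrite sE.
split => //.
rewrite (eq_integral F)//.
rewrite -integral12_prod_meas1//= big_ord_recl -e1.
rewrite /fubini_F (eq_integral (fun t => (phi 0%N t)%:E *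
      (\int[mu]_x (\prod_(j < n) phi j.+1 (x j))%:E))%E).
  have /fineK <- := integrable_fin_num measurableT i1.
  by rewrite integralZr.
by move=> t _; rewrite -integralZl.
by move=> x _; rewrite -sE.
Qed.

Lemma prod_fset_ord (u : {fset nat}) n (F : nat -> R) :
  (forall j, j \in u -> (j < n)%N) ->
  \prod_(j <- u) F j = \prod_(j < n) (if (j : nat) \in u then F j else 1).
Proof.
move=> un; rewrite -(big_mkord xpredT (fun j => if j \in u then F j else 1)).
rewrite -[RHS]big_mkcond -[RHS]big_filter; apply: perm_big; apply: uniq_perm.
- exact: fset_uniq.
- exact/filter_uniq/iota_uniq.
- move=> j; rewrite mem_filter mem_index_iota.
  by case: (boolP (j \in _)) => // /un ->.
Qed.

Lemma fset_nat_bound (u : {fset nat}) : exists n, forall j, j \in u -> (j < n)%N.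
Proof.
exists (\max_(j <- u) j).+1 => j ju.
by rewrite ltnS (big_rem j)//= leq_maxl.
Qed.

Lemma prod_fset_integrable (u : {fset nat}) (phi : nat -> T -> R) :
  (forall j, rho.-integrable setT (fun t => (phi j t)%:E)) ->
  mu.-integrable setT (fun x : seqspace T => (\prod_(j <- u) phi j (x j))%:E) /\
  \int[mu]_x (\prod_(j <- u) phi j (x j)) = \prod_(j <- u) \int[rho]_t phi j t.
Proof.
move=> iphi; have [n un] := fset_nat_bound u.
(* Coordinates outside u receive the constant 1, whose integral is 1, so that u may be replaced by
   an initial segment. *)
pose psi j := if j \in u then phi j else cst 1.
have ipsi j : rho.-integrable setT (fun t => (psi j t)%:E).
  rewrite /psi; case: ifP => // _; exact: (finite_measure_integrable_cst rho 1).
have E (x : seqspace T) : \prod_(j <- u) phi j (x j) = \prod_(j < n) psi j (x j).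
  rewrite (prod_fset_ord (fun j => phi j (x j)) un); apply: eq_bigr => j _.
  by rewrite /psi; case: ifP.
have [ii e] := prod_integrable n ipsi; split.
  by apply: eq_integrable ii => // x _; rewrite E.
rewrite /Rintegral.
under eq_integral do rewrite E.
rewrite e (prod_fset_ord _ un).
rewrite (eq_bigr (fun j : 'I_n =>
  (if val j \in u then \int[rho]_t phi j t else 1)%:E)).
  by rewrite prodEFin.
move=> j _; rewrite /psi; case: ifP => _.
  by rewrite fineK//; exact: integrable_fin_num.
transitivity (\int[rho]_t (cst 1%:E t))%E => //.
rewrite integral_cst// mul1e; exact: probability_setT.
Qed.

Variable (K : T -> T -> R).
Hypothesis mK : measurable_fun setT (fun q : T * T => K q.1 q.2).

Lemma measurable_kernel_section (y : T) : measurable_fun setT (fun x => K x y).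
Proof.
exact: (measurableT_comp mK (measurable_pair2 y)).
Qed.

Lemma measurable_kernel_diag : measurable_fun setT (fun x => K x x).
Proof.
exact: (measurableT_comp mK
  (measurable_fun_pair (@measurable_id _ _ setT) (@measurable_id _ _ setT))).
Qed.

Lemma measurable_Kset_section u y : measurable_fun setT (fun x => Kset K u x y).
Proof.
apply: measurable_prod => j _.
exact: (measurableT_comp (measurable_kernel_section (y j)) (measurable_coord j)).
Qed.

Lemma measurable_Kset_diag u : measurable_fun setT (fun x => Kset K u x x).
Proof.
apply: measurable_prod => j _.
exact: (measurableT_comp measurable_kernel_diag (measurable_coord j)).
Qed.

Variable H : rkhs K.
Hypothesis diag_fin : (diag_mean K rho < +oo)%E.

Lemma diag_integrable : rho.-integrable setT (fun x => (K x x)%:E).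
Proof.
apply/integrableP; split; first exact/measurable_EFinP/measurable_kernel_diag.
rewrite (eq_integral (fun x => (K x x)%:E))// => x _.
by rewrite abse_EFin ger0_norm// (kernel_diag_ge0 H).
Qed.

Lemma Kset_diag_integrable u : mu.-integrable setT (fun x => (Kset K u x x)%:E).
Proof.
by have [] := @prod_fset_integrable u (fun _ t => K t t) (fun _ => diag_integrable).
Qed.

Lemma Kset_diag_integral u :
  \int[mu]_x Kset K u x x = fine (diag_mean K rho) ^+ #|` u|.
Proof.
have [_] := @prod_fset_integrable u (fun _ t => K t t) (fun _ => diag_integrable).
by move=> ->; rewrite big_const_seq count_predT iter_mulr_1.
Qed.

Lemma Kset_double_integral u :
  \int[mu]_x \int[mu]_y Kset K u y x = double_mean K rho ^+ #|` u|.
Proof.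
have isec y : rho.-integrable setT (fun x => (K x y)%:E).
  exact: (carrier_integrable (p := id) measurableT measurable_kernel_section
            diag_integrable (kernel_in H y)).
pose mm (x : T) := \int[rho]_y K y x.
(* The kernel mean is the representer of the empty quadrature, hence it belongs to H and is
   integrable. *)
have Hm : carrier H mm.
  have [Hm _] := quad_diff_representer (p := id) measurableT H measurable_kernel_section
    diag_integrable [::].
  move: Hm; congr (carrier H); apply/funext => x.
  by rewrite /quad_diff /quad big_nil subr0.
have im := carrier_integrable (p := id) measurableT measurable_kernel_section diag_integrable Hm.
transitivity (\int[mu]_x (\prod_(j <- u) mm (x j))).
  apply: eq_Rintegral => x _.
  by have [_] := @prod_fset_integrable u (fun j t => K t (x j)) (fun j => isec (x j)).
have [_ ->] := @prod_fset_integrable u (fun _ => mm) (fun _ => im).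
rewrite big_const_seq count_predT iter_mulr_1 /double_mean; congr (_ ^+ _).
apply: eq_Rintegral => x _; apply: eq_Rintegral => y _; exact: (kernel_sym H).
Qed.

End SequenceSpace.

(** * Sums over all finite coordinate sets as limits of partial sums *)

Section CountableSums.
Context {R : realType}.

(** A fixed enumeration turns families indexed by finite sets into sequences, the form that
    dominated convergence needs. *)
Lemma fset_nat_enum : exists e : nat -> {fset nat}, bijective e.
Proof.
have : ([set: {fset nat}] #= [set: nat])%card.
  apply: eq_card_nat; first exact: countableP.
  move=> ffin; apply: infinite_nat.
  have : finite_set ((fun n : nat => [fset n]%fset) @^-1` [set: {fset nat}]).
    by apply: finite_preimage => // i j _ _ /fset1_inj.
  by rewrite preimage_setT.
move=> /card_set_bijP [f]; rewrite setTT_bijective => -[g fg gf].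
by exists g, f.
Qed.

Variable e : nat -> {fset nat}.
Hypothesis be : bijective e.

Lemma esum_enum (a : {fset nat} -> \bar R) : (forall u, 0 <= a u)%E ->
  (\esum_(u in setT) a u = \sum_(i <oo) a (e i))%E.
Proof.
move=> a0; rewrite (@reindex_esum _ _ _ setT setT e) ?setTT_bijective//.
by rewrite nneseries_esumT.
Qed.

Lemma nneseries_cvg (a : nat -> R) : (forall i, 0 <= a i) ->
  (\sum_(i <oo) (a i)%:E < +oo)%E ->
  \sum_(i < n) a i @[n --> \oo] --> fine (\sum_(i <oo) (a i)%:E)%E.
Proof.
move=> a0 afin.
have afn : (\sum_(i <oo) (a i)%:E)%E \is a fin_num.
  by rewrite ge0_fin_numE// nneseries_ge0// => i _ _; rewrite lee_fin.
rewrite (_ : (fun n => _) = fine \o (fun n => \sum_(0 <= i < n) (a i)%:E)%E).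
  apply: fine_cvg; rewrite fineK//.
  by apply: is_cvg_nneseries => i _ _; rewrite lee_fin.
by apply/funext => n /=; rewrite sumEFin big_mkord.
Qed.

Lemma esum_cvg (a : {fset nat} -> R) : (forall u, 0 <= a u) ->
  (\esum_(u in setT) (a u)%:E < +oo)%E ->
  \sum_(i < n) a (e i) @[n --> \oo] --> fine (\esum_(u in setT) (a u)%:E)%E.
Proof.
move=> a0; rewrite esum_enum => [afin|u]; last by rewrite lee_fin.
exact: (@nneseries_cvg (fun i => a (e i))).
Qed.

(** [Kweighted] is defined through the positive and negative parts of an unordered sum over the
    active sets. Under absolute summability it is the limit of the partial sums along [e], inactive
    sets contributing 0. *)
Lemma esumB_cvg (a : {fset nat} -> R) (A : set {fset nat}) :
  (forall u, ~ A u -> a u = 0) ->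
  (\esum_(u in setT) `|a u|%:E < +oo)%E ->
  let b u := (a u)%:E in
  \sum_(i < n) a (e i) @[n --> \oo] -->
     fine (\esum_(u in A) (b^\+ u) - \esum_(u in A) (b^\- u))%E.
Proof.
move=> aA afin b.
pose ap u := Num.max (a u) 0; pose an u := Num.max (- a u) 0.
have apE u : (b^\+ u = (ap u)%:E)%E by rewrite funeposE /b /ap EFin_max.
have anE u : (b^\- u = (an u)%:E)%E by rewrite funenegE /b /an EFin_max.
have fin f : (forall u, 0 <= f u <= `|a u|) ->
    (\esum_(u in setT) (f u)%:E < +oo)%E.
  move=> fP; apply: le_lt_trans afin; apply: le_esum => u _.
  by rewrite lee_fin; case/andP: (fP u).
have ap0 u : 0 <= ap u <= `|a u|.
  by rewrite /ap le_max lexx orbT ge_max normr_ge0 ler_norm.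
have an0 u : 0 <= an u <= `|a u|.
  by rewrite /an le_max lexx orbT ge_max normr_ge0 -normrN ler_norm.
have EA f : (forall u, 0 <= f u <= `|a u|) ->
    (\esum_(u in A) (f u)%:E = \esum_(u in setT) (f u)%:E)%E.
  move=> fP; rewrite esum_mkcond; apply: eq_esum => u _.
  case: ifPn => // /negP; rewrite inE => /aA au.
  by have := fP u; rewrite au normr0 -eq_le => /eqP <-.
under eq_esum do rewrite apE.
under [X in (_ - X)%E]eq_esum do rewrite anE.
rewrite !EA// fineB; last 2 first.
- by rewrite ge0_fin_numE ?fin// esum_ge0// => u _; rewrite lee_fin; case/andP: (ap0 u).
- by rewrite ge0_fin_numE ?fin// esum_ge0// => u _; rewrite lee_fin; case/andP: (an0 u).
rewrite (_ : (fun n => _) =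
   (fun n => \sum_(i < n) ap (e i) - \sum_(i < n) an (e i))).
  apply: cvgB; apply: esum_cvg; try exact: fin.
    by move=> u; case/andP: (ap0 u).
  by move=> u; case/andP: (an0 u).
apply/funext => n; rewrite -sumrB; apply: eq_bigr => i _.
rewrite /ap /an; case: (leP 0 (a (e i))) => ai.
  by rewrite max_r ?oppr_le0// subr0.
by rewrite max_l ?oppr_ge0 ?(ltW ai)// sub0r opprK.
Qed.

Lemma esum_fin_support (a : {fset nat} -> R) (F : {fset {fset nat}})
    (A : set {fset nat}) :
  (forall u, 0 <= a u) -> (forall u, u \notin F -> a u = 0) ->
  (\esum_(u in A) (a u)%:E < +oo)%E.
Proof.
move=> a0 aF.
rewrite esum_mkcond (_ : \esum_(u in _) _ =
    \esum_(u in [set` F]) if u \in A then (a u)%:E else 0)%E.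
  have af i : (0 <= if i \in A then (a i)%:E else 0)%E.
    by case: ifP => // _; rewrite lee_fin.
  rewrite esum_fset; [|exact: finite_fset|by move=> i _; exact: af].
  rewrite fsbig_finite/=; last exact: finite_fset.
  rewrite (eq_bigr (fun i => (if i \in A then a i else 0)%:E)).
    by rewrite sumEFin ltry.
  by move=> i _; case: ifP.
rewrite [RHS]esum_mkcond; apply: eq_esum => u _.
case: (boolP (u \in [set` F])) => // /negP; rewrite inE/= => /negP uF.
by rewrite aF// ; case: ifP.
Qed.

End CountableSums.

(** * The weighted kernel: its domain, and the splitting of its squared error over coordinate
    sets *)

Section WeightedKernel.
Context {R : realType} {d : measure_display} {T : measurableType d}.
Variables (rho : probability T R) (mu : probability (seqspace T) R).
Hypothesis muE : infinite_product rho mu.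
Variable K : T -> T -> R.
Hypothesis mK : measurable_fun setT (fun q : T * T => K q.1 q.2).
Variable H : rkhs K.
Hypothesis diag_fin : (diag_mean K rho < +oo)%E.
Variable Hu : forall u, rkhs (Kset K u).
Variable w : {fset nat} -> R.
Hypothesis w0 : forall u, 0 <= w u.
Hypothesis w_fin : (\esum_(u in [set: {fset nat}])
     (w u * fine (diag_mean K rho) ^+ #|` u|)%:E < +oo)%E.
Variable e : nat -> {fset nat}.
Hypothesis be : bijective e.

Let KD u (x : seqspace T) := w u * Kset K u x x.

Lemma weighted_diag_ge0 u x : 0 <= KD u x.
Proof. by rewrite mulr_ge0// (kernel_diag_ge0 (Hu u)). Qed.

Lemma XdomE x : Xdom K w x <-> (\esum_(u in setT) (KD u x)%:E < +oo)%E.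
Proof.
rewrite /Xdom /= (_ : \esum_(u in _) _ = \esum_(u in setT) (KD u x)%:E)%E//.
rewrite esum_mkcond; apply: eq_esum => u _; case: ifPn => // /negP.
rewrite inE /active_sets /= => /negP wu; rewrite /KD.
by rewrite (_ : w u = 0) ?mul0r//; apply/eqP; rewrite eq_le w0 andbT leNgt.
Qed.

Let G (x : seqspace T) := (\sum_(i <oo) (KD (e i) x)%:E)%E.

Let GE x : G x = (\esum_(u in setT) (KD u x)%:E)%E.
Proof.
by rewrite /G -(esum_enum be (a := fun u => (KD u x)%:E))// => u; rewrite lee_fin weighted_diag_ge0.
Qed.

Let mKD u : measurable_fun setT (EFin \o KD u).
Proof.
by apply/measurable_EFinP; apply: measurable_funM => //; exact: measurable_Kset_diag.
Qed.

Let mG : measurable_fun setT G.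
Proof.
apply: (@ge0_emeasurable_sum _ _ _ _ (fun i x => (KD (e i) x)%:E) xpredT) => //.
- by move=> i x _ _; rewrite lee_fin weighted_diag_ge0.
- by move=> i _; exact: mKD.
Qed.

(** Integrating term by term gives the sum of the w u M^|u|, finite by assumption. Hence G is finite
    almost everywhere, which is to say that [Xdom] has full measure. *)
Let iG : mu.-integrable setT G.
Proof.
apply/integrableP; split => //.
rewrite (eq_integral G); last first.
  by move=> x _; rewrite gee0_abs// nneseries_ge0// => i _ _; rewrite lee_fin weighted_diag_ge0.
rewrite integral_nneseries//; last 2 first.
- by move=> i; exact: mKD.
- by move=> i x _; rewrite lee_fin weighted_diag_ge0.
apply: le_lt_trans w_fin; rewrite (esum_enum be); last first.
  move=> u; rewrite lee_fin mulr_ge0// exprn_ge0// fine_ge0//.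
  by apply: integral_ge0 => x _; rewrite lee_fin (kernel_diag_ge0 H).
rewrite le_eqVlt; apply/orP; left; apply/eqP; apply: eq_eseriesr => i _.
rewrite /KD; under eq_integral do rewrite EFinM.
have ii := Kset_diag_integrable muE mK H diag_fin (e i).
rewrite integralZl// -(Kset_diag_integral muE mK H diag_fin) EFinM /Rintegral.
by rewrite fineK//; exact: integrable_fin_num.
Qed.

Lemma XdomG : Xdom K w = [set x | G x \is a fin_num].
Proof.
apply/seteqP; split => x /=.
  move=> /XdomE; rewrite -GE => Gx; rewrite ge0_fin_numE//.
  by rewrite nneseries_ge0// => i _ _; rewrite lee_fin weighted_diag_ge0.
by move=> Gx; apply/XdomE; rewrite -GE ltey_eq Gx.
Qed.

Lemma measurable_Xdom : measurable (Xdom K w).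
Proof. by rewrite XdomG -[X in measurable X]setTI; exact: emeasurable_fin_num. Qed.

Lemma measurable_XdomC : measurable (~` Xdom K w).
Proof. by apply: measurableC; have := measurable_Xdom. Qed.

Lemma Xdom_null : mu (~` Xdom K w) = 0.
Proof.
have [N [mN N0 subN]] := integrable_ae measurableT iG.
apply/eqP; rewrite eq_le measure_ge0 andbT -N0.
have mX := measurable_XdomC.
apply: le_measure; rewrite ?inE//.
by rewrite XdomG => x /= h; apply: subN => /= /(_ I).
Qed.

Lemma integral_Xdom (f : seqspace T -> R) :
  mu.-integrable setT (EFin \o f) ->
  \int[mu]_(x in Xdom K w) f x = \int[mu]_x f x.
Proof.
move=> fi; rewrite /Rintegral; congr fine.
rewrite [RHS](@negligible_integral _ _ _ _ setT (~` Xdom K w))//.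
- by rewrite setTD setCK.
- exact: measurable_XdomC.
- exact: Xdom_null.
Qed.

Local Notation X := (set_type (Xdom K w)).
Local Notation Kg := (@Kweighted _ _ _ K w).

Lemma Kset_le u x y : `|Kset K u x y| <= (Kset K u x x + Kset K u y y) / 2.
Proof. exact: (kernel_le (Hu u)). Qed.

Lemma Kweighted_summable (x y : X) :
  (\esum_(u in setT) `|w u * Kset K u (set_val x) (set_val y)|%:E < +oo)%E.
Proof.
have fx (z : X) : (\esum_(u in setT) (KD u (set_val z))%:E < +oo)%E.
  by apply/XdomE/set_valP.
apply: le_lt_trans (lte_add_pinfty (fx x) (fx y)).
rewrite -esumD; last 2 first.
- by move=> u _; rewrite lee_fin weighted_diag_ge0.
- by move=> u _; rewrite lee_fin weighted_diag_ge0.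
apply: le_esum => u _; rewrite -EFinD lee_fin normrM ger0_norm// -mulrDr.
rewrite ler_wpM2l//; apply: (le_trans (Kset_le _ _ _)).
have := kernel_diag_ge0 (Hu u) (set_val x).
have := kernel_diag_ge0 (Hu u) (set_val y); lra.
Qed.

Definition Kpart n (x y : seqspace T) : R :=
  \sum_(i < n) w (e i) * Kset K (e i) x y.

Lemma Kpart_cvg (x y : X) :
  Kpart n (set_val x) (set_val y) @[n --> \oo] --> Kg x y.
Proof.
apply: (esumB_cvg be (a := fun u => w u * Kset K u (set_val x) (set_val y))).
  move=> u /= /negP wu; rewrite (_ : w u = 0) ?mul0r//.
  by apply/eqP; rewrite eq_le w0 andbT leNgt.
exact: Kweighted_summable.
Qed.

Lemma Kpart_diag_le n (x : X) : Kpart n (set_val x) (set_val x) <= Kg x x.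
Proof.
rewrite -(cvg_lim (@Rhausdorff R) (@Kpart_cvg x x)).
apply: (nondecreasing_cvgn_le (u_ := fun n => Kpart n (set_val x) (set_val x))).
  apply/nondecreasing_seqP => m; rewrite /Kpart big_ord_recr/= lerDl.
  exact: weighted_diag_ge0.
by apply/cvg_ex; exists (Kg x x); exact: Kpart_cvg.
Qed.

(** The bound does not depend on n, since the partial sums on the diagonal increase to the diagonal
    of the weighted kernel. *)
Lemma Kpart_le n (x y : X) :
  `|Kpart n (set_val x) (set_val y)| <= (Kg x x + Kg y y) / 2.
Proof.
apply: (@le_trans _ _ ((Kpart n (set_val x) (set_val x) +
                        Kpart n (set_val y) (set_val y)) / 2)).
  rewrite /Kpart -big_split/= mulr_suml; apply: (le_trans (ler_norm_sum _ _ _)).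
  apply: ler_sum => i _; rewrite normrM ger0_norm// -mulrDr -mulrA.
  by rewrite ler_wpM2l// Kset_le.
by rewrite ler_pM2r// lerD// Kpart_diag_le.
Qed.

Variable x0 : X.
(** The domain of H_gamma is a subtype without a measure; integrals are pulled back along this
    retraction. Points outside [Xdom] go to [x0], a choice that integrals over [Xdom] do not see. *)
Definition Xproj (x : seqspace T) : X := insubd x0 x.

Lemma XprojK x : Xdom K w x -> set_val (Xproj x) = x.
Proof.
by move=> xX; rewrite -[LHS]/(val (insubd x0 x)) val_insubd mem_set.
Qed.

Lemma Kweighted_diag_int : mu.-integrable (Xdom K w) (fun x => (Kg (Xproj x) (Xproj x))%:E).
Proof.
have mX := measurable_Xdom.
have iGX : mu.-integrable (Xdom K w) G by exact: integrableS iG.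
apply: eq_integrable iGX => //.
move=> x; rewrite inE => xX.
have Gx : (G x < +oo)%E by rewrite GE; apply/XdomE.
rewrite -[G x]fineK; last first.
  by rewrite ge0_fin_numE// nneseries_ge0// => i _ _; rewrite lee_fin weighted_diag_ge0.
congr EFin.
have c1 : Kpart n x x @[n --> \oo] --> fine (G x).
  by apply: (@nneseries_cvg _ (fun i => KD (e i) x)) => // i; exact: weighted_diag_ge0.
have := @Kpart_cvg (Xproj x) (Xproj x); rewrite XprojK// => c2.
by rewrite -(cvg_lim (@Rhausdorff R) c1) (cvg_lim (@Rhausdorff R) c2).
Qed.

Lemma measurable_Kweighted_section y :
  measurable_fun (Xdom K w) (fun x => Kg (Xproj x) y).
Proof.
apply: (@measurable_fun_cvg _ _ _ _ (fun n x => Kpart n x (set_val y))).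
  move=> n; apply: measurable_sum => i; apply: measurable_funM => //.
  by apply: measurable_funTS; have := measurable_Kset_section mK (e i) (set_val y).
by move=> x xX; have := @Kpart_cvg (Xproj x) y; rewrite XprojK.
Qed.

Variable s : seq (R * X).
Let s' : seq (R * seqspace T) := [seq (q.1, set_val q.2) | q <- s].
Local Notation LX := (quad_diff mu (Xdom K w) Xproj s).
Local Notation LS := (quad_diff mu setT id s').

Lemma quad_diff_Xdom g : mu.-integrable setT (EFin \o g) -> LX (g \o set_val) = LS g.
Proof.
move=> gi; rewrite /quad_diff; congr (_ - _).
  rewrite -integral_Xdom//; apply: eq_Rintegral => x; rewrite inE => xX /=.
  by rewrite XprojK.
by rewrite /quad big_map.
Qed.

Lemma quad_diff_cvg (f_ : nat -> X -> R) (f F : X -> R) :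
  (forall n, measurable_fun (Xdom K w) (f_ n \o Xproj)) ->
  (forall x, f_ n x @[n --> \oo] --> f x) ->
  mu.-integrable (Xdom K w) (fun x => (F (Xproj x))%:E) ->
  (forall n x, `|f_ n x| <= F x) ->
  LX (f_ n) @[n --> \oo] --> LX f.
Proof.
move=> mf ff iF fF; have mX := measurable_Xdom.
apply: cvgB; last first.
  rewrite /quad; apply: cvg_big => [|q _]; first exact: add_continuous.
  by apply: cvgM => //; exact: cvg_cst.
have mfl : measurable_fun (Xdom K w) (f \o Xproj).
  apply: (@measurable_fun_cvg _ _ _ _ (fun n => f_ n \o Xproj)) => // x _.
  exact: ff.
have ffE x : (f_ n (Xproj x))%:E @[n --> \oo] --> (f (Xproj x))%:E.
  by apply: cvg_EFin; [exact: nearW|exact: ff].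
have [||||| ifl _ cv] := @dominated_convergence _ _ _ mu _ mX
  (fun n x => (f_ n (Xproj x))%:E) (fun x => (f (Xproj x))%:E)
  (fun x => (F (Xproj x))%:E).
- by move=> n; apply/measurable_EFinP; exact: mf.
- exact/measurable_EFinP.
- exact: aeW.
- by [].
- by apply: aeW => x n _; rewrite abse_EFin lee_fin.
rewrite /Rintegral; apply: fine_cvg; rewrite fineK//.
exact: integrable_fin_num.
Qed.

Lemma quad_diff_sum n (a : nat -> R) (g : nat -> seqspace T -> R) :
  (forall i, mu.-integrable setT (EFin \o g i)) ->
  mu.-integrable setT (EFin \o (fun x => \sum_(i < n) a i * g i x)) /\
  LS (fun x => \sum_(i < n) a i * g i x) = \sum_(i < n) a i * LS (g i).
Proof.
move=> ig.
have iag i : mu.-integrable setT (EFin \o (fun x => a i * g i x)).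
  exact: (integrableZl measurableT (a i) (ig i)).
elim: n => [|n [IHi IHe]].
  have -> : (fun x : seqspace T => \sum_(i < 0) a i * g i x) = (fun=> 0).
    by apply/funext => x; rewrite big_ord0.
  split; first exact: (finite_measure_integrable_cst mu 0).
  rewrite big_ord0 /quad_diff /quad big1 => [|q _]; last by rewrite mulr0.
  by rewrite Rintegral_cst// mul0r subr0.
have E : (fun x => \sum_(i < n.+1) a i * g i x) =
         (fun x => (\sum_(i < n) a i * g i x) + a n * g n x).
  by apply/funext => x; rewrite big_ord_recr.
rewrite E; split; first exact: (integrableD measurableT IHi (iag n)).
rewrite big_ord_recr/= -IHe /quad_diff RintegralD; [|by []|exact: IHi|exact: (iag n)].
rewrite RintegralZl; [|by []|exact: (ig n)].
rewrite mulrBr addrACA; congr (_ + _); rewrite -opprD; congr (- _).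
rewrite /quad mulr_sumr -big_split/=; apply: eq_bigr => q _; ring.
Qed.

Let hu u x := LS ((Kset K u)^~ x).

Let mKu u x := measurable_Kset_section mK u x.
Let iKu u := Kset_diag_integrable muE mK H diag_fin u.

Lemma Kset_section_integrable u x : mu.-integrable setT (EFin \o (Kset K u)^~ x).
Proof.
exact: (carrier_integrable (p := id) measurableT (mKu u) (iKu u) (kernel_in (Hu u) x)).
Qed.

Let hu_integrable u : mu.-integrable setT (EFin \o hu u).
Proof.
have [Hh _] := quad_diff_representer (p := id) measurableT (Hu u) (mKu u) (iKu u) s'.
exact: (carrier_integrable (p := id) measurableT (mKu u) (iKu u) Hh).
Qed.

Lemma quad_diff_Kpart n (x : X) :
  LX (fun y => Kpart n (set_val y) (set_val x)) =
  \sum_(i < n) w (e i) * hu (e i) (set_val x).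
Proof.
have [ii ee] := @quad_diff_sum n (fun i => w (e i))
  (fun i => (Kset K (e i))^~ (set_val x))
  (fun i => Kset_section_integrable (e i) (set_val x)).
by rewrite -ee -quad_diff_Xdom.
Qed.

Let iKg := Kweighted_diag_int.

Let integrable_affine a b :
  mu.-integrable (Xdom K w) (fun x => (a + b * Kg (Xproj x) (Xproj x))%:E).
Proof.
have mX := measurable_Xdom.
exact: (integrableD mX (finite_measure_integrable_cst mu a mX) (integrableZl mX b iKg)).
Qed.

Let h_cvg (x : X) :
  \sum_(i < n) w (e i) * hu (e i) (set_val x) @[n --> \oo] --> LX (Kg^~ x).
Proof.
under eq_fun do rewrite -quad_diff_Kpart.
apply: (@quad_diff_cvg (fun n y => Kpart n (set_val y) (set_val x)) _
  (fun y => Kg x x / 2 + 2^-1 * Kg y y)).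
- move=> n; apply: (eq_measurable_fun (fun y => Kpart n y (set_val x))).
    by move=> y; rewrite inE => yX /=; rewrite XprojK.
  apply: measurable_sum => i; apply: measurable_funM => //.
  by apply: measurable_funTS; have := mKu (e i) (set_val x).
- by move=> y; exact: Kpart_cvg.
- exact: integrable_affine.
- by move=> n y; apply: (le_trans (Kpart_le n y x)); lra.
Qed.

(** The bound is uniform in n and affine in the diagonal [Kg x x], hence an integrable dominator
    when the functional is applied in the second variable. *)
Let h_le n (x : X) : `|\sum_(i < n) w (e i) * hu (e i) (set_val x)| <=
  (\int[mu]_(y in Xdom K w) Kg (Xproj y) (Xproj y) +
    \sum_(q <- s) `|q.1| * Kg q.2 q.2) / 2 +
  ((fine (mu (Xdom K w)) + \sum_(q <- s) `|q.1|) / 2) * Kg x x.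
Proof.
have mX := measurable_Xdom.
rewrite -quad_diff_Kpart; apply: (le_trans (ler_normB _ _)).
have mf : measurable_fun (Xdom K w) (fun y => Kpart n (set_val (Xproj y)) (set_val x)).
  apply: (eq_measurable_fun (fun y => Kpart n y (set_val x))).
    by move=> y; rewrite inE => yX /=; rewrite XprojK.
  apply: measurable_sum => i; apply: measurable_funM => //.
  by apply: measurable_funTS; have := mKu (e i) (set_val x).
have fle y : `|Kpart n (set_val (Xproj y)) (set_val x)| <=
    Kg x x / 2 + 2^-1 * Kg (Xproj y) (Xproj y).
  by apply: (le_trans (Kpart_le n _ x)); lra.
have fi : mu.-integrable (Xdom K w)
    (EFin \o (fun y => Kpart n (set_val (Xproj y)) (set_val x))).
  apply: (le_integrable mX _ _ (integrable_affine (Kg x x / 2) 2^-1)).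
    exact/measurable_EFinP.
  by move=> y _; rewrite !abse_EFin lee_fin; apply: (le_trans (fle y)); exact: ler_norm.
have I1 : `|\int[mu]_(y in Xdom K w) Kpart n (set_val (Xproj y)) (set_val x)| <=
  (\int[mu]_(y in Xdom K w) Kg (Xproj y) (Xproj y)) / 2 +
  fine (mu (Xdom K w)) / 2 * Kg x x.
  apply: (le_trans (le_normr_Rintegral mX fi)).
  apply: (@le_trans _ _ (\int[mu]_(y in Xdom K w)
     (Kg x x / 2 + 2^-1 * Kg (Xproj y) (Xproj y)))).
    apply: le_Rintegral => //; first exact: integrable_norm.
    exact: integrable_affine.
  rewrite RintegralD//; last 2 first.
  - exact: (finite_measure_integrable_cst mu _ mX).
  - exact: (integrableZl mX 2^-1 iKg).
  rewrite Rintegral_cst// RintegralZl//; lra.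
have I2 : `|quad s (fun y => Kpart n (set_val y) (set_val x))| <=
   (\sum_(q <- s) `|q.1| * Kg q.2 q.2) / 2 + (\sum_(q <- s) `|q.1|) / 2 * Kg x x.
  apply: (le_trans (ler_norm_sum _ _ _)).
  rewrite !mulr_suml -big_split/=; apply: ler_sum => q _.
  rewrite normrM; apply: (le_trans (ler_wpM2l (normr_ge0 _) (Kpart_le n q.2 x))).
  lra.
apply: (le_trans (lerD I1 I2)); lra.
Qed.

(** Dominated convergence is used once for each argument of the kernel: [h_cvg] is the passage to
    the limit in the first, and here the functional is applied to that limit in the second. *)
Lemma quad_diff2_Kweighted_cvg :
  \sum_(i < n) w (e i) * quad_diff2 (k := Kset K (e i)) mu setT id s' @[n --> \oo] -->
  quad_diff2 (k := Kg) mu (Xdom K w) Xproj s.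
Proof.
have -> : (fun n => \sum_(i < n) w (e i) * quad_diff2 (k := Kset K (e i)) mu setT id s') =
   (fun n => LX (fun x => \sum_(i < n) w (e i) * hu (e i) (set_val x))).
  apply/funext => n.
  have [ii ee] := @quad_diff_sum n (fun i => w (e i)) (fun i => hu (e i))
    (fun i => hu_integrable (e i)).
  by rewrite /quad_diff2 -ee -quad_diff_Xdom.
apply: (quad_diff_cvg _ h_cvg (integrable_affine _ _) h_le).
move=> n; apply: (eq_measurable_fun (fun x => \sum_(i < n) w (e i) * hu (e i) x)).
  by move=> y; rewrite inE => yX /=; rewrite XprojK.
apply: measurable_sum => i; apply: measurable_funM => //.
by apply: measurable_funTS; have /measurable_int/measurable_EFinP := hu_integrable (e i).
Qed.

Lemma quad_diff2_Kweighted_le B :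
  (forall n, \sum_(i < n) w (e i) * quad_diff2 (k := Kset K (e i)) mu setT id s' <= B) ->
  quad_diff2 (k := Kg) mu (Xdom K w) Xproj s <= B.
Proof.
move=> le_B; rewrite -(cvg_lim (@Rhausdorff R) quad_diff2_Kweighted_cvg).
apply: limr_le; first by apply/cvg_ex; eexists; exact: quad_diff2_Kweighted_cvg.
by apply: nearW.
Qed.

Lemma quad_diff2_Kweighted_ge n :
  \sum_(i < n) w (e i) * quad_diff2 (k := Kset K (e i)) mu setT id s' <=
  quad_diff2 (k := Kg) mu (Xdom K w) Xproj s.
Proof.
have cv := quad_diff2_Kweighted_cvg.
rewrite -(cvg_lim (@Rhausdorff R) cv).
apply: (nondecreasing_cvgn_le
  (u_ := fun n => \sum_(i < n) w (e i) * quad_diff2 (k := Kset K (e i)) mu setT id s')).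
  apply/nondecreasing_seqP => m; rewrite big_ord_recr/= lerDl mulr_ge0//.
  exact: (quad_diff2_ge0 (p := id) measurableT (Hu (e m)) (mKu (e m)) (iKu (e m))).
by apply/cvg_ex; eexists; exact: cv.
Qed.

End WeightedKernel.

Lemma ler_sum_uniq_subset (R : realDomainType) (I : eqType) (s t : seq I) (f : I -> R) :
  uniq s -> uniq t -> {subset s <= t} -> (forall i, 0 <= f i) ->
  \sum_(i <- s) f i <= \sum_(i <- t) f i.
Proof.
move=> us ut st f0; rewrite [leRHS](bigID (mem s))/= -[leLHS]addr0.
apply: lerD; last exact: sumr_ge0.
rewrite -[leRHS]big_filter le_eqVlt; apply/orP; left; apply/eqP; apply: perm_big.
apply: uniq_perm => //; first exact: filter_uniq.
move=> i; rewrite mem_filter; apply/idP/andP => [si|[]//].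
by split => //; exact: st.
Qed.

(** * Moebius inversion, and functions that vanish at the anchor *)

Section Anchored.
Context {R : realType}.

(** If u is a proper subset of v, fix j in v outside u. Adding j is a bijection from the subsets z
    without j to those with j; it does not affect whether z contains u, and it flips the sign. *)
Lemma fpowerset_sign_sum (u v : {fset nat}) :
  \sum_(z <- fpowerset v) (-1) ^+ #|` (v `\` z)%fset| * (u `<=` z)%fset%:R =
  (u == v)%:R :> R.
Proof.
have [<-|uv] := eqVneq u v.
  rewrite (bigD1_seq u) ?fset_uniq ?fpowersetE//= fsetDv cardfs0 fsubset_refl mul1r.
  rewrite big_seq_cond big1 ?addr0// => z; rewrite fpowersetE => /andP[zu nz].
  rewrite (_ : (u `<=` z)%fset = false) ?mulr0//; apply/negbTE.
  by apply: contra nz => uz; rewrite eqEfsubset zu uz.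
have [uSv|uNv] := boolP (u `<=` v)%fset; last first.
  rewrite big_seq big1// => z; rewrite fpowersetE => zv.
  rewrite (_ : (u `<=` z)%fset = false) ?mulr0//; apply/negbTE.
  by apply: contra uNv => /fsubset_trans; exact.
have /fsubsetPn [j jv ju] : ~~ (v `<=` u)%fset.
  by apply: contra uv => vu; rewrite eqEfsubset uSv vu.
rewrite (bigID (fun z : {fset nat} => j \in z))/=.
rewrite -big_filter -[X in _ + X]big_filter.
have := fset_uniq (fpowerset v); set P := enum_fset _ => uP.
have inP z : (z \in P) = (z `<=` v)%fset by rewrite /P fpowersetE.
have /(perm_big _) -> : perm_eq [seq z : {fset nat} <- P | j \in z]
    [seq (j |` z)%fset | z : {fset nat} <- P & j \notin z].
  apply: uniq_perm; first exact: filter_uniq.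
    rewrite map_inj_in_uniq ?filter_uniq// => y z.
    rewrite !mem_filter => /andP[jy _] /andP[jz _] E.
    by rewrite -(fsetU1K jy) -(fsetU1K jz) E.
  move=> z; rewrite mem_filter inP; apply/andP/mapP => [[jz zv]|[y]].
    exists (z `\ j)%fset; last by rewrite fsetD1K.
    by rewrite mem_filter !inE eqxx/= inP; apply: fsubset_trans zv; exact: fsubD1set.
  rewrite mem_filter inP => /andP[jy yv] ->; split; first by rewrite !inE eqxx.
  by rewrite fsubUset fsub1set jv yv.
rewrite big_map -big_split/= big_seq big1// => z.
rewrite mem_filter inP => /andP[jz zv].
have -> : (u `<=` j |` z)%fset = (u `<=` z)%fset.
  apply/idP/idP => [|/fsubset_trans]; last by apply; exact: fsubsetU1.
  move=> /fsubsetP us; apply/fsubsetP => i iu; have := us _ iu.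
  by rewrite !inE => /orP[/eqP ij|//]; move: ju; rewrite -ij iu.
have -> : (v `\` z = j |` (v `\` (j |` z)))%fset.
  apply/fsetP => i; rewrite !inE.
  by have [->|] := eqVneq i j; rewrite ?jv ?(negbTE jz).
rewrite cardfsU1 !inE eqxx/= add1n exprS; ring.
Qed.

Context {d : measure_display} {T : measurableType d}.
Variable c : T.

(** One identity encodes both properties of functions in H_u: for v = u, dependence on the
    coordinates in u only; for v not containing u, vanishing once some coordinate in u is set to
    c. *)
Definition anchored_on (u : {fset nat}) (g : seqspace T -> R) :=
  forall v x, g (anch c v x) = (u `<=` v)%fset%:R * g x.

Lemma anchored_partE u v g x : anchored_on u g ->
  anchored_part c v g x = (u == v)%:R * g x.
Proof.
move=> ag; rewrite /anchored_part -fpowerset_sign_sum mulr_suml.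
by apply: eq_bigr => z _; rewrite ag mulrA.
Qed.

Lemma anchored_on_anchor u g : anchored_on u g -> u != fset0 -> g (fun=> c) = 0.
Proof.
move=> ag u0; have := ag fset0 (fun=> c); rewrite fsubset0 (negbTE u0) mul0r.
by move=> <-; congr g; apply/funext => j; rewrite /anch; case: ifP.
Qed.

Lemma apply_cd_alg_anchored w lam0 tau c1 C (Qb : bb_family) eps u g :
  finite_set (cd_sets w lam0 tau c1 C eps) ->
  anchored_on u g -> u != fset0 ->
  apply_alg c (cd_alg w c lam0 tau c1 C Qb eps) g =
  if u \in cd_sets w lam0 tau c1 C eps then
    quad (Qb (cd_n w lam0 tau c1 C eps u) u) g else 0.
Proof.
move=> fin ag u0; rewrite apply_cd_alg (anchored_on_anchor ag u0) add0r.
set A := cd_sets _ _ _ _ _ _ in fin *.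
have qE v : quad (Qb (cd_n w lam0 tau c1 C eps v) v) (anchored_part c v g) =
    (u == v)%:R * quad (Qb (cd_n w lam0 tau c1 C eps v) v) g.
  rewrite /quad mulr_sumr; apply: eq_bigr => p _.
  by rewrite (anchored_partE _ _ ag) mulrCA.
under eq_bigr do rewrite qE.
have inA v : (v \in enum_fset (fset_set A)) = (v \in A) by exact: in_fset_set.
case: ifPn => uA.
  rewrite (bigD1_seq u) ?fset_uniq ?inA//= eqxx mul1r big1 ?addr0// => v vu.
  by rewrite eq_sym (negbTE vu) mul0r.
rewrite big_seq big1// => v; rewrite inA => vA.
by rewrite (_ : (u == v) = false) ?mul0r//; apply/eqP => uv; rewrite uv vA in uA.
Qed.

Variable K : T -> T -> R.
Variable H : rkhs K.
Hypothesis Kcc : K c c = 0.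

(** Evaluation at c has norm sqrt(K c c) = 0, so all functions in H vanish there. *)
Lemma kernel_anchor y : K c y = 0.
Proof.
have := eval_le c (kernel_in H y); rewrite Kcc sqrtr0 mulr0.
by rewrite normr_le0 => /eqP.
Qed.

Lemma Kset_anchored u y : anchored_on u (fun x => Kset K u x y).
Proof.
move=> v x; rewrite /Kset; have [uv|uNv] := boolP (u `<=` v)%fset.
  rewrite mul1r; apply: eq_big_seq => j ju; rewrite /anch.
  by rewrite (fsubsetP uv).
have /fsubsetPn [j ju jv] := uNv.
rewrite mul0r (bigD1_seq j) ?fset_uniq//= {1}/anch (negbTE jv).
by rewrite kernel_anchor mul0r.
Qed.

(** Only the subsets of v contribute to the sum, which is therefore finite. *)
Lemma anch_Xdom (w : {fset nat} -> R) v x : (forall u, 0 <= w u) ->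
  Xdom K w (anch c v x).
Proof.
move=> w0; rewrite /Xdom /=.
apply: (@esum_fin_support _ (fun u => w u * Kset K u (anch c v x) (anch c v x))
  (fpowerset v)).
  move=> u; rewrite mulr_ge0//; apply: prodr_ge0 => j _.
  exact: kernel_diag_ge0 H _.
move=> u; rewrite fpowersetE => uv.
have := Kset_anchored u (anch c v x) v x.
by rewrite (negbTE uv) mul0r => ->; rewrite mulr0.
Qed.

End Anchored.

(** * Exact error formulas for algorithms with anchored sample points *)

Section ErrorFormula.
Context {R : realType} {d : measure_display} {T : measurableType d}.
Variables (rho : probability T R) (mu : probability (seqspace T) R).
Hypothesis muE : infinite_product rho mu.
Variable K : T -> T -> R.
Hypothesis mK : measurable_fun setT (fun q : T * T => K q.1 q.2).
Variable H : rkhs K.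
Hypothesis diag_fin : (diag_mean K rho < +oo)%E.
Variable Hu : forall u, rkhs (Kset K u).
Variable c : T.
Hypothesis Kcc : K c c = 0.

Definition nodes (Q : algorithm) : seq (R * seqspace T) :=
  [seq (coef t, anch c (active t) (node t)) | t <- Q].

Definition err2 u (s : seq (R * seqspace T)) : R :=
  quad_diff2 (k := Kset K u) mu setT id s.

Let mKu u x := measurable_Kset_section mK u x.
Let iKu u := Kset_diag_integrable muE mK H diag_fin u.

Lemma err2_ge0 u s : 0 <= err2 u s.
Proof.
exact: (quad_diff2_ge0 (p := id) measurableT (Hu u) (mKu u) (iKu u) s).
Qed.

Lemma err_setE u s : err_set mu (Hu u) s = (Num.sqrt (err2 u s))%:E.
Proof.
by apply: (wceE (p := id) measurableT (mKu u) (iKu u)).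
Qed.

Lemma err2_le u s B : 0 <= B -> (err_set mu (Hu u) s ^+ 2 <= B%:E)%E -> err2 u s <= B.
Proof.
by move=> B0; rewrite err_setE -EFin_expe lee_fin sqr_sqrtr// err2_ge0.
Qed.

Lemma err2_nil u : err2 u [::] = double_mean K rho ^+ #|` u|.
Proof.
rewrite -(Kset_double_integral muE mK H diag_fin) /err2 /quad_diff2 /quad_diff.
rewrite /quad big_nil subr0; apply: eq_Rintegral => x _.
by rewrite big_nil subr0.
Qed.

(** The error sees a quadrature only through anchored functions: the sections of the kernel are
    anchored, and by symmetry of the kernel so is the function obtained by applying I - Q to one
    argument. *)
Lemma eq_err2 u s s' :
  (forall g, anchored_on c u g -> quad s g = quad s' g) ->
  err2 u s = err2 u s'.
Proof.
move=> ss'.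
have E x : quad_diff mu setT id s ((Kset K u)^~ x) =
           quad_diff mu setT id s' ((Kset K u)^~ x).
  by rewrite /quad_diff ss'//; exact: (Kset_anchored H Kcc).
rewrite /err2 /quad_diff2.
rewrite (_ : (fun x => _) = (fun x => quad_diff mu setT id s' ((Kset K u)^~ x))).
  rewrite /quad_diff ss'// => v x /=.
  have -> : (Kset K u)^~ (anch c v x) = (fun y => (u `<=` v)%fset%:R * Kset K u y x).
    apply/funext => y; rewrite (kernel_sym (Hu u)) (Kset_anchored H Kcc).
    by rewrite (kernel_sym (Hu u)).
  rewrite -/(quad_diff mu setT id s' _) /quad_diff mulrBr; congr (_ - _).
    rewrite RintegralZl//.
    exact: (carrier_integrable (p := id) measurableT (mKu u) (iKu u) (kernel_in (Hu u) x)).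
  by rewrite /quad mulr_sumr; apply: eq_bigr => q _; rewrite mulrCA.
by apply/funext.
Qed.

Lemma quad_nodes Q g : quad (nodes Q) g = apply_alg c Q g.
Proof. by []. Qed.

Lemma err2_cd_alg w lam0 tau c1 C (Qb : bb_family) eps u :
  finite_set (cd_sets w lam0 tau c1 C eps) -> u != fset0 ->
  err2 u (nodes (cd_alg w c lam0 tau c1 C Qb eps)) =
  if u \in cd_sets w lam0 tau c1 C eps then
    err2 u (Qb (cd_n w lam0 tau c1 C eps u) u)
  else double_mean K rho ^+ #|` u|.
Proof.
move=> fin u0; case: ifPn => uA.
  apply: eq_err2 => g ag.
  by rewrite quad_nodes (apply_cd_alg_anchored _ fin ag u0) uA.
rewrite -err2_nil; apply: eq_err2 => g ag.
rewrite quad_nodes (apply_cd_alg_anchored _ fin ag u0) (negbTE uA).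
by rewrite /quad big_nil.
Qed.

(** On constants the sample at the anchor is exact, and the alternating sums that define f_u vanish
    for non-empty u. *)
Lemma err2_cd_alg0 w lam0 tau c1 C (Qb : bb_family) eps :
  finite_set (cd_sets w lam0 tau c1 C eps) ->
  err2 fset0 (nodes (cd_alg w c lam0 tau c1 C Qb eps)) = 0.
Proof.
move=> fin; set s := nodes _.
have q1 : quad s (fun=> 1) = 1 :> R.
  rewrite /s quad_nodes apply_cd_alg -[RHS]addr0; congr (_ + _).
  rewrite big_seq big1// => v; rewrite in_fset_set// inE => -[v0 _].
  rewrite /quad big1// => q _.
  rewrite (anchored_partE (u := fset0)); last first.
    by move=> z x; rewrite fsub0set mulr1.
  by rewrite eq_sym (negbTE v0) mul0r mulr0.
have K1 x : (Kset K fset0)^~ x = fun=> 1.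
  by apply/funext => y; rewrite /Kset big_seq_fset0.
have int_cst (r : R) : \int[mu]_x (fun=> r) (id x : seqspace T) = r.
  rewrite Rintegral_cst//; transitivity (r * fine 1%E); last by rewrite mulr1.
  by congr (_ * fine _); exact: probability_setT.
rewrite /err2 /quad_diff2 (_ : (fun x => _) = fun=> 0).
  by rewrite /quad_diff int_cst /quad big1 ?subr0// => q _; rewrite mulr0.
by apply/funext => x; rewrite K1 /quad_diff int_cst q1 subrr.
Qed.

(** Anchored functions vanish at every node, so Q acts on H_u as the empty quadrature and the
    initial squared error remains. *)
Lemma err2_inactive u Q :
  (forall t, t \in [seq active t | t <- Q] -> ~~ (u `<=` t)%fset) ->
  err2 u (nodes Q) = double_mean K rho ^+ #|` u|.
Proof.
move=> uQ; rewrite -err2_nil; apply: eq_err2 => g ag.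
rewrite /quad big_nil big_map; elim: Q uQ => [|t Q IH] uQ; first by rewrite big_nil.
rewrite big_cons/= ag (negbTE (uQ _ (mem_head _ _))) mul0r mulr0 add0r.
by apply: IH => v vQ; apply: uQ; rewrite inE vQ orbT.
Qed.

Variables (w : {fset nat} -> R).
Hypothesis w0 : forall u, 0 <= w u.
Hypothesis w_fin : (\esum_(u in [set: {fset nat}])
     (w u * fine (diag_mean K rho) ^+ #|` u|)%:E < +oo)%E.
Variable Hg : rkhs (@Kweighted _ _ _ K w).
Variable e : nat -> {fset nat}.
Hypothesis be : bijective e.

Local Notation X := (set_type (Xdom K w)).

Definition anch_pt v x : X := exist _ (anch c v x) (mem_set (anch_Xdom H Kcc v x w0)).

Definition err2_gamma (Q : algorithm) : R :=
  quad_diff2 (k := @Kweighted _ _ _ K w) mu (Xdom K w) (Xproj (anch_pt fset0 (fun=> c)))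
    [seq (coef t, anch_pt (active t) (node t)) | t <- Q].

Lemma err_gammaE Q : err_gamma mu c Hg Q = (Num.sqrt (err2_gamma Q))%:E.
Proof.
have mX := measurable_Xdom mK Hu w0 be.
apply: (wceE mX).
- exact: (measurable_Kweighted_section mK Hu w0 be).
- exact: (Kweighted_diag_int muE mK H diag_fin Hu w0 w_fin be).
- move=> f Hf; apply: eq_integral => x; rewrite inE => xX.
  congr EFin; rewrite -{1}(XprojK (anch_pt fset0 (fun=> c)) xX).
  by have /(congr1 (fun g => g (Xproj (anch_pt fset0 (fun=> c)) x))) := valLK 0 f.
- move=> f Hf; rewrite /apply_alg /quad !big_map; apply: eq_bigr => t _ /=.
  by congr (_ * _); have /(congr1 (fun g => g (anch_pt (active t) (node t)))) := valLK 0 f.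
Qed.

Let nodesE Q : [seq (q.1, set_val q.2) |
    q <- [seq (coef t, anch_pt (active t) (node t)) | t <- Q]] = nodes Q.
Proof. by rewrite -map_comp. Qed.

Lemma err2_gamma_le Q B :
  (forall n, \sum_(i < n) w (e i) * err2 (e i) (nodes Q) <= B) -> err2_gamma Q <= B.
Proof.
move=> h; apply: (quad_diff2_Kweighted_le muE mK H diag_fin Hu w0 w_fin be) => n.
by rewrite nodesE; exact: h.
Qed.

Lemma err2_gamma_ge Q n :
  \sum_(i < n) w (e i) * err2 (e i) (nodes Q) <= err2_gamma Q.
Proof.
rewrite -nodesE.
exact: (quad_diff2_Kweighted_ge muE mK H diag_fin Hu w0 w_fin be).
Qed.

Lemma err2_gamma_ge0 Q : 0 <= err2_gamma Q.
Proof.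
apply: le_trans (err2_gamma_ge Q 0); by rewrite big_ord0.
Qed.

(** The summands are non-negative, and a finite family sits inside a long enough initial segment of
    the enumeration. *)
Lemma err2_gamma_fset_ge Q (F : {fset {fset nat}}) :
  \sum_(u <- F) w u * err2 u (nodes Q) <= err2_gamma Q.
Proof.
have [g eg ge] := be.
pose n := (\max_(u <- F) g u).+1.
have Fn u : u \in F -> (g u < n)%N by move=> uF; rewrite ltnS (big_rem u)//= leq_maxl.
apply: le_trans (err2_gamma_ge Q n).
rewrite -(big_mkord xpredT (fun i => w (e i) * err2 (e i) (nodes Q))).
rewrite -(big_map e xpredT (fun u => w u * err2 u (nodes Q))).
apply: ler_sum_uniq_subset; first exact: fset_uniq.
- by rewrite map_inj_uniq ?iota_uniq//; exact: bij_inj.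
- move=> u uF; apply/mapP; exists (g u); last by rewrite ge.
  by rewrite mem_index_iota Fn.
- by move=> u; rewrite mulr_ge0// err2_ge0.
Qed.

End ErrorFormula.

(** * Bounds for sums over subsets, p-series and powers of factorials *)

Lemma geometric_sum (F : numFieldType) (r : F) n : r != 1 ->
  \sum_(i < n) r ^+ i = (1 - r ^+ n) / (1 - r).
Proof.
move=> r1; have := geometric_seriesE 1 r1 => /(congr1 (fun h => h n)).
rewrite /series/= mul1r => <-; rewrite big_mkord.
by apply: eq_bigr => i _; rewrite mul1r.
Qed.

Section SubsetSums.
Context {R : realType}.

(** The subsets of {0, ..., N-1}, generated by deciding on the largest element; this matches the
    recursion of the elementary symmetric polynomials. *)
Fixpoint subsets (N : nat) : seq {fset nat} :=
  if N is n.+1 then subsets n ++ [seq (n |` u)%fset | u <- subsets n]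
  else [:: fset0].

Lemma subsets_lt N u j : u \in subsets N -> j \in u -> (j < N)%N.
Proof.
elim: N u => [|N IH] u /=; first by rewrite inE => /eqP ->.
rewrite mem_cat => /orP[/IH h /h /ltnW//|/mapP[v vN ->]].
by rewrite !inE => /orP[/eqP ->//|jv]; apply: ltnW; apply: IH jv.
Qed.

Lemma mem_subsets N (u : {fset nat}) :
  (forall j, j \in u -> (j < N)%N) -> u \in subsets N.
Proof.
elim: N u => [|N IH] u uN /=.
  by rewrite inE; apply/eqP/fsetP => j; rewrite inE; apply/negP => /uN.
rewrite mem_cat; have [Nu|Nu] := boolP (N \in u); last first.
  rewrite IH// => j ju; have := uN _ ju; rewrite ltnS leq_eqVlt => /orP[/eqP jN|//].
  by rewrite -jN ju in Nu.
apply/orP; right; apply/mapP; exists (u `\ N)%fset; last by rewrite fsetD1K.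
apply: IH => j; rewrite !inE => /andP[jN ju].
by have := uN _ ju; rewrite ltnS leq_eqVlt (negbTE jN).
Qed.

(** The first two terms of the binomial expansion; with y = a N this is the induction step of the
    bound on symmetric polynomials. *)
Lemma expr_add_ge (x y : R) k : 0 <= x -> 0 <= y ->
  x ^+ k.+1 + k.+1%:R * y * x ^+ k <= (x + y) ^+ k.+1.
Proof.
move=> x0 y0; elim: k => [|k IH]; first by rewrite !expr1 expr0; lra.
rewrite [leRHS]exprS; apply: le_trans (ler_wpM2l (addr_ge0 x0 y0) IH).
rewrite -subr_ge0 (_ : _ - _ = k.+1%:R * y ^+ 2 * x ^+ k); last first.
  by rewrite !exprS -[k.+2%:R]natr1; ring.
by rewrite !mulr_ge0 ?exprn_ge0.
Qed.

(* The elementary symmetric polynomials satisfy e_k(a) <= (sum a)^k / k!. *)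
Lemma subsets_sum_le (a : nat -> R) N (g : nat -> R) :
  (forall j, 0 <= a j) -> (forall k, 0 <= g k) ->
  \sum_(u <- subsets N) g #|` u| * \prod_(j <- u) a j <=
  \sum_(k < N.+1) g k * ((\sum_(j < N) a j) ^+ k / k`!%:R).
Proof.
move=> a0; elim: N g => [|N IH] g g0.
  by rewrite big_seq1 cardfs0 big_seq_fset0 big_ord1 expr0 divr1.
have g0' k : 0 <= g k.+1 by [].
rewrite big_cat big_map/=.
have -> : \sum_(u <- subsets N) g #|` (N |` u)%fset| * \prod_(j <- (N |` u)%fset) a j =
    a N * \sum_(u <- subsets N) g #|` u|.+1 * \prod_(j <- u) a j.
  rewrite mulr_sumr big_seq [RHS]big_seq; apply: eq_bigr => u uN.
  have Nu : N \notin u by apply/negP => /(subsets_lt uN); rewrite ltnn.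
  by rewrite cardfsU1 Nu add1n big_fsetU1//=; ring.
apply: (le_trans (lerD (IH _ g0) (ler_wpM2l (a0 N) (IH _ g0')))).
set S := \sum_(j < N) a j; have S0 : 0 <= S by apply: sumr_ge0.
rewrite [leRHS]big_ord_recl [in leLHS]big_ord_recl/= !expr0 -addrA lerD2l.
apply: (@le_trans _ _ (\sum_(k < N.+1) g k.+1 * (S ^+ k.+1 / k.+1`!%:R) +
   a N * \sum_(k < N.+1) g k.+1 * (S ^+ k / k`!%:R))).
  rewrite lerD2r [leRHS]big_ord_recr/= lerDl.
  by rewrite mulr_ge0// divr_ge0// exprn_ge0.
rewrite mulr_sumr -big_split/=; apply: ler_sum => k _.
have kf : 0 < k`!%:R :> R by rewrite ltr0n fact_gt0.
rewrite (_ : _ + _ = g k.+1 *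
  ((S ^+ k.+1 + k.+1%:R * a N * S ^+ k) / k.+1`!%:R)).
  rewrite ler_wpM2l// ler_wpM2r ?invr_ge0// big_ord_recr/=.
  exact: expr_add_ge.
rewrite factS natrM; field; rewrite gt_eqF//=.
Qed.

Lemma esum_subsets_le (f : {fset nat} -> R) B : (forall u, 0 <= f u) ->
  (forall N, \sum_(u <- subsets N) f u <= B) ->
  (\esum_(u in setT) (f u)%:E <= B%:E)%E.
Proof.
move=> f0 fB; apply: ge_ereal_sup => _ [X [finX _] <-].
rewrite fsbig_finite//= sumEFin lee_fin.
set F := fset_set X.
have [N FN] : exists N, {subset enum_fset F <= subsets N}.
  elim: (enum_fset F) => [|u s [N FN]]; first by exists 0%N.
  have [M uM] := fset_nat_bound u.
  have mono v n m : (n <= m)%N -> v \in subsets n -> v \in subsets m.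
    move=> nm vn; apply: mem_subsets => j /(subsets_lt vn) jn.
    exact: leq_trans jn nm.
  exists (maxn N M) => v; rewrite inE => /orP[/eqP ->|/FN vN].
    by apply: mem_subsets => j /uM jM; rewrite leq_max jM orbT.
  by apply: mono vN; exact: leq_maxl.
apply: le_trans (fB N).
(* Discarding duplicates is harmless, since repeated entries only enlarge a sum of non-negative
   terms. *)
apply: (@le_trans _ _ (\sum_(u <- undup (subsets N)) f u)).
  apply: ler_sum_uniq_subset; rewrite ?undup_uniq ?fset_uniq//.
  by move=> u uF; rewrite mem_undup FN.
elim: (subsets N) => //= u s IH.
case: ifP => us; rewrite ?big_cons ?lerD2l//.
by apply: (le_trans IH); rewrite lerDr.
Qed.

(** Cauchy condensation: each of the 2^m terms of a dyadic block is at most (2^m)^(-t), so the block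
    contributes at most r^m with r = 2^(1-t) < 1. *)
Lemma pseries_bounded (t : R) : 1 < t ->
  exists B, forall N, \sum_(j < N) j.+1%:R `^ (- t) <= B.
Proof.
move=> t1; pose r : R := 2 `^ (1 - t).
have r0 : 0 < r by rewrite powR_gt0.
have r1 : r < 1.
  by rewrite /r /powR pnatr_eq0/= expR_lt1 pmulr_llt0 ?subr_lt0// ln_gt0// ltr1n.
have dyadic m : \sum_(0 <= j < 2 ^ m - 1) j.+1%:R `^ (- t) <= \sum_(i < m) r ^+ i.
  elim: m => [|m IH]; first by rewrite big_geq ?big_ord0.
  have m2 : (0 < 2 ^ m)%N by rewrite expn_gt0.
  rewrite (@big_cat_nat _ _ _ (2 ^ m - 1))/=; [|lia|rewrite expnS; lia].
  rewrite big_ord_recr/=; apply: lerD => //.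
  apply: (@le_trans _ _ (\sum_(2 ^ m - 1 <= j < 2 ^ m.+1 - 1) (2 ^ m)%:R `^ (- t))).
    rewrite !big_nat; apply: ler_sum => j /andP[jm _].
    rewrite !powRN lef_pV2 ?posrE ?powR_gt0 ?ltr0n//.
    rewrite ge0_ler_powR ?nnegrE//; [lra|rewrite ler_nat; lia].
  rewrite sumr_const_nat -[leLHS]mulr_natl (_ : (2 ^ m.+1 - 1 - (2 ^ m - 1) = 2 ^ m)%N); last by rewrite expnS; lia.
  have bP : (0 : R) < (2 ^ m)%:R by rewrite ltr0n.
  rewrite -{1}(powRr1 (ltW bP)) -powRD; last by rewrite (gt_eqF bP) implybT.
  by rewrite natrX -(powR_mulrn m (ler0n R 2)) powRAC powR_mulrn// ltW.
exists (1 - r)^-1 => N.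
have NP : (N <= 2 ^ N - 1)%N by have := ltn_expl N (isT : (1 < 2)%N); lia.
apply: (@le_trans _ _ (\sum_(0 <= j < 2 ^ N - 1) j.+1%:R `^ (- t))).
  rewrite -(big_mkord xpredT (fun j => j.+1%:R `^ (- t))).
  rewrite [leRHS](@big_cat_nat _ _ _ N)//= lerDl.
  by apply: sumr_ge0 => j _; exact: powR_ge0.
apply: (le_trans (dyadic N)).
rewrite geometric_sum ?lt_eqF// ler_pdivrMr ?subr_gt0// mulVf ?gt_eqF ?subr_gt0//.
by rewrite gerDl oppr_le0 exprn_ge0// ltW.
Qed.

Lemma expr_fact_le (Y : R) k : 0 <= Y -> Y ^+ k / k`!%:R <= expR Y.
Proof.
case: k => [|k] Y0; first by rewrite expr0 divr1 -expR0 ler_expR.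
by apply: le_trans (expR_ge1Dxn k Y0); rewrite lerDr.
Qed.

Lemma expr_fact_powR_le (x delta : R) : 0 <= x -> 0 < delta ->
  exists B, forall n, \sum_(k < n) x ^+ k / k`!%:R `^ delta <= B.
Proof.
(* Since Y^delta = 2 x, each term equals (Y^k / k!)^delta 2^(-k), and Y^k / k! <= exp(Y). *)
move=> x0 d0; pose Y := (2 * x) `^ delta^-1; have Y0 : 0 <= Y by exact: powR_ge0.
pose E := expR Y `^ delta; have E0 : 0 <= E by exact: powR_ge0.
have term k : x ^+ k / k`!%:R `^ delta <= E * 2^-1 ^+ k.
  have YE : Y `^ delta = 2 * x by rewrite -powRrM mulVf ?gt_eqF// powRr1// mulr_ge0.
  have -> : x ^+ k / k`!%:R `^ delta = (Y ^+ k / k`!%:R) `^ delta * 2^-1 ^+ k.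
    rewrite powRM ?invr_ge0 ?exprn_ge0// -(powR_mulrn k Y0) powRAC YE.
    rewrite powR_mulrn ?mulr_ge0// -(powR_inv1 (ler0n R k`!)) powRAC.
    rewrite powR_inv1 ?powR_ge0// mulrAC -exprMn mulrAC mulfV ?mul1r//.
  rewrite ler_wpM2r ?exprn_ge0// ge0_ler_powR ?nnegrE ?expR_ge0 ?(ltW d0)//.
    by rewrite divr_ge0// exprn_ge0.
  exact: expr_fact_le.
exists (E * 2) => n.
apply: (@le_trans _ _ (\sum_(k < n) E * 2^-1 ^+ k)).
  by apply: ler_sum => k _; exact: term.
rewrite -mulr_sumr ler_wpM2l//.
rewrite geometric_sum ?lt_eqF//; last lra.
rewrite ler_pdivrMr; last lra.
have : 0 <= 2^-1 ^+ n :> R by exact: exprn_ge0.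
lra.
Qed.

End SubsetSums.

(** * Decreasing enumeration of a family with finite level sets *)

Section Greedy.
Context {R : realType} {I : choiceType}.
Variables (S : set I) (h : I -> R).
Hypothesis Sinf : infinite_set S.
Hypothesis level_fin : forall t, 0 < t -> finite_set [set u | S u /\ t <= h u].
Hypothesis h_gt0 : forall u, S u -> 0 < h u.

Let top (s : seq I) u := [/\ S u, u \notin s &
  forall v, S v -> v \notin s -> h v <= h u].

Let ex_top s : exists u, top s u.
Proof.
have [u0 [Su0 u0s]] : exists u, S u /\ u \notin s.
  apply: contrapT => nex; apply: Sinf.
  apply: (sub_finite_set (B := [set` s])); last exact: finite_seq.
  move=> u Su /=; apply: contrapT => us; apply: nex; exists u; split => //.
  exact/negP.
set L := [set u | S u /\ h u0 <= h u].
have Lfin : finite_set L by apply: level_fin; exact: h_gt0.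
have [m ml mmax] : exists2 m, m \in u0 :: [seq u <- enum_fset (fset_set L) | u \notin s] &
    forall v, v \in u0 :: [seq u <- enum_fset (fset_set L) | u \notin s] -> h v <= h m.
  elim: [seq _ <- _ | _] => [|a r [m mr mP]].
    by exists u0; rewrite ?mem_head// => v; rewrite inE => /eqP ->.
  have [am|ma] := leP (h a) (h m).
    exists m; first by move: mr; rewrite !inE => /orP[->//|->]; rewrite !orbT.
    move=> v; rewrite !inE => /or3P[vu|/eqP -> //|vr]; apply: mP; rewrite inE ?vu ?vr ?orbT//.
  exists a; first by rewrite !inE eqxx orbT.
  move=> v; rewrite !inE => /or3P[vu|/eqP -> //|vr]; apply/(le_trans _ (ltW ma))/mP; rewrite inE ?vu ?vr ?orbT//.
have u0m : h u0 <= h m by apply: mmax; rewrite mem_head.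
have inL v : (v \in enum_fset (fset_set L)) = (v \in L) by exact: in_fset_set.
exists m; split.
- move: ml; rewrite inE => /orP[/eqP ->//|]; rewrite mem_filter inL.
  by move=> /andP[_]; rewrite inE => -[].
- by move: ml; rewrite inE => /orP[/eqP ->//|]; rewrite mem_filter => /andP[].
- move=> v Sv vs; have [vu|/ltW uv] := leP (h v) (h u0); first exact: le_trans u0m.
  by apply: mmax; rewrite inE mem_filter vs inL orbC mem_set.
Qed.

Let pick s := sval (cid (ex_top s)).
Let pickP s : top s (pick s). Proof. exact: svalP (cid (ex_top s)). Qed.

Let build := fix build n := if n is m.+1 then rcons (build m) (pick (build m)) else [::].

(** The definition of decay asks for an actual decreasing ordering. Picking a largest remaining
    element again and again produces one; a largest element exists because the level sets are
    finite. *)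
Lemma decreasing_enumeration : exists e : nat -> I,
  [/\ injective e, range e = S & forall i j, (i <= j)%N -> h (e j) <= h (e i)].
Proof.
pose e n := pick (build n).
have memb n i : (i < n)%N -> e i \in build n.
  elim: n => // n IH; rewrite ltnS leq_eqVlt => /orP[/eqP ->|/IH ein] /=.
    by rewrite mem_rcons mem_head.
  by rewrite mem_rcons inE ein orbT.
have memb' n u : u \in build n -> exists i, u = e i.
  elim: n => // n IH /=; rewrite mem_rcons inE => /orP[/eqP ->|/IH//].
  by exists n.
have einj_lt i j : (i < j)%N -> e i != e j.
  move=> ij; have [_ nj _] := pickP (build j).
  by apply: contra nj => /eqP eij; rewrite -/(e j) -eij memb.
have Se n : S (e n) by have [] := pickP (build n).
have emono i j : (i <= j)%N -> h (e j) <= h (e i).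
  move=> ij; have [_ _ mx] := pickP (build i); apply: mx => //.
  apply/negP => /[dup] /memb' _.
  have sub : {subset build i <= build j}.
    move: ij; elim: j => [|j IH]; first by rewrite leqn0 => /eqP ->.
    rewrite leq_eqVlt => /orP[/eqP ->//|/IH h' u ub] /=.
    by rewrite mem_rcons inE h' ?orbT.
  by move/sub; have [_ /negP] := pickP (build j).
have einj : injective e.
  move=> i j eij; apply/eqP; apply: contraT; rewrite neq_ltn => /orP[] /einj_lt.
    by rewrite eij eqxx.
  by rewrite eij eqxx.
exists e; split => //; apply/seteqP; split => [_ [n _ <-]//|u Su].
apply: contrapT => une.
have unb n : u \notin build n.
  by apply/negP => /memb'[i ui]; apply: une; exists i.
have ule n : h u <= h (e n) by have [_ _] := pickP (build n); exact.
(* An element never picked stays below all picked values, so its level set would contain the whole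
   infinite range. *)
apply: (@infinite_nat).
rewrite (_ : setT = e @^-1` [set v | S v /\ h u <= h v]).
  apply: finite_preimage; last exact/level_fin/h_gt0.
  by move=> i j _ _ /einj.
by apply/seteqP; split.
Qed.

End Greedy.

(** * Summable non-negative families *)

Section SummableFamilies.
Context {R : realType} {I : choiceType}.
Variable f : I -> R.
Hypothesis f0 : forall u, 0 <= f u.
Hypothesis f_fin : (\esum_(u in setT) (f u)%:E < +oo)%E.

Lemma sum_le_esum (s : seq I) : uniq s ->
  \sum_(u <- s) f u <= fine (\esum_(u in setT) (f u)%:E)%E.
Proof.
move=> us.
have fn : (\esum_(u in setT) (f u)%:E)%E \is a fin_num.
  by rewrite ge0_fin_numE// esum_ge0// => u _; rewrite lee_fin.
rewrite -lee_fin fineK// -sumEFin.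
apply: esum_ge; exists [set` s]; first by split => //; exact: finite_seq.
by rewrite fsbig_seq.
Qed.

Lemma term_le_esum u : f u <= fine (\esum_(u in setT) (f u)%:E)%E.
Proof. by have := @sum_le_esum [:: u] isT; rewrite big_seq1. Qed.

(** More than S / t members of size at least t would exceed the total sum S. *)
Lemma summable_level_finite t : 0 < t -> finite_set [set u | t <= f u].
Proof.
move=> t0; apply: contrapT => inf.
set S := fine (\esum_(u in setT) (f u)%:E)%E.
have [B BS Bn] := infinite_set_fset (Num.truncn (S / t)).+1 inf.
have := sum_le_esum (fset_uniq B).
apply/negP; rewrite -ltNge -/S.
apply: (@lt_le_trans _ _ (\sum_(u <- B) t)); last first.
  rewrite big_seq [leRHS]big_seq; apply: ler_sum => u uB; exact: BS.
rewrite big_const_seq count_predT iter_addr_0 -mulr_natl -ltr_pdivrMr//.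
apply: (lt_le_trans (truncnS_gt _)); rewrite ler_nat.
exact: Bn.
Qed.

Lemma esum_scale_fin (g : I -> R) (b : R) : 0 <= b -> (forall u, g u <= b * f u) ->
  (\esum_(u in setT) (g u)%:E < +oo)%E.
Proof.
move=> b0 gf; apply: (@le_lt_trans _ _ (b * fine (\esum_(u in setT) (f u)%:E))%:E);
  last exact: ltry.
apply: ge_ereal_sup => _ [X [finX _] <-].
rewrite fsbig_finite//= sumEFin lee_fin.
apply: (@le_trans _ _ (\sum_(u <- fset_set X) b * f u)); first exact: ler_sum.
by rewrite -mulr_sumr ler_wpM2l// sum_le_esum.
Qed.

End SummableFamilies.

(** * Summability of powers of POD weights *)

Section PodWeights.
Context {R : realType}.
Variables Gam gam : nat -> R.
Hypothesis gam_ge0 : forall j, 0 <= gam j.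
Hypothesis gam_noninc : forall i j, (i <= j)%N -> gam j <= gam i.
Hypothesis Gam0 : Gam 0%N = 1.
Hypothesis Gam1 : Gam 1%N = 1.
Hypothesis Gam_ge0 : forall k, 0 <= Gam k.
Local Notation w := (pod Gam gam).

Lemma pod_ge0 u : 0 <= w u.
Proof. by rewrite /pod mulr_ge0// prodr_ge0. Qed.

Lemma pod1 j : w [fset j]%fset = gam j.
Proof. by rewrite /pod cardfs1 Gam1 mul1r big_seq_fset1. Qed.

Lemma prod_powR (s : R) (u : {fset nat}) (f : nat -> R) : (forall j, 0 <= f j) ->
  (\prod_(j <- u) f j) `^ s = \prod_(j <- u) f j `^ s.
Proof.
move=> f0; elim: (enum_fset u) => [|j r IH]; first by rewrite !big_nil powR1.
by rewrite !big_cons powRM ?IH// prodr_ge0.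
Qed.

Section Decaying.
Variables (A p q Cq s : R).
Hypothesis gamA : forall j, gam j <= A * j.+1%:R `^ (- p).
Hypothesis Cq_gt0 : 0 < Cq.
Hypothesis GamC : forall k, (0 < k)%N -> Gam k <= Cq * k`!%:R `^ q.

Lemma A_ge0 : 0 <= A.
Proof. by have := le_trans (gam_ge0 0) (gamA 0); rewrite powR1 mulr1. Qed.

Lemma pod_summable B : 0 < s -> 1 < p * s -> q * s < 1 -> 0 <= B ->
  (\esum_(u in setT) (w u `^ s * B ^+ #|` u|)%:E < +oo)%E.
Proof.
move=> s0 ps qs B0; have A0 := A_ge0.
have [P PP] := pseries_bounded ps.
(* X bounds the sum over j of B (gam j)^s. In (Gam k)^s / k! the growth condition leaves the power 1
   - q s > 0 of 1 / k!, which becomes the delta of [expr_fact_powR_le]. *)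
pose X := B * A `^ s * P.
have P0 : 0 <= P by have := PP 0%N; rewrite big_ord0.
have X0 : 0 <= X by rewrite !mulr_ge0// powR_ge0.
have [Z ZP] := @expr_fact_powR_le R X (1 - q * s) X0 ltac:(lra).
(* The growth condition starts at k = 1; the maximum with 1 covers Gam 0 = 1. *)
pose D := Num.max 1 (Cq `^ s).
have D0 : 0 <= D by rewrite /D le_max ler01.
pose a j := B * gam j `^ s.
have a0 j : 0 <= a j by rewrite mulr_ge0// powR_ge0.
have aS N : \sum_(j < N) a j <= X.
  rewrite /X -mulrA -mulr_sumr ler_wpM2l//.
  apply: (@le_trans _ _ (\sum_(j < N) A `^ s * j.+1%:R `^ (- (p * s)))).
    apply: ler_sum => j _; rewrite -mulNr powRrM -powRM ?powR_ge0//.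
    by rewrite ge0_ler_powR ?nnegrE ?(ltW s0)// mulr_ge0// powR_ge0.
  by rewrite -mulr_sumr ler_wpM2l// powR_ge0.
have GP k : Gam k `^ s <= D * k`!%:R `^ (q * s).
  case: k => [|k]; first by rewrite Gam0 fact0 !powR1 mulr1 /D le_max lexx.
  rewrite powRrM; apply: (@le_trans _ _ ((Cq * k.+1`!%:R `^ q) `^ s)).
    by rewrite ge0_ler_powR ?nnegrE ?(ltW s0) ?mulr_ge0 ?powR_ge0 ?(ltW Cq_gt0)// GamC.
  rewrite powRM ?powR_ge0 ?(ltW Cq_gt0)// ler_wpM2r ?powR_ge0//.
  by rewrite /D le_max lexx orbT.
apply: (@le_lt_trans _ _ (D * Z)%:E); last exact: ltry.
apply: esum_subsets_le => [u|N].
  by rewrite mulr_ge0 ?powR_ge0// exprn_ge0.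
rewrite (eq_bigr (fun u : {fset nat} => Gam #|` u| `^ s * \prod_(j <- u) a j)); last first.
  move=> u _; rewrite /pod powRM ?prodr_ge0// prod_powR// -mulrA; congr (_ * _).
  by rewrite /a big_split/= mulrC big_const_seq count_predT iter_mulr_1.
apply: (le_trans (subsets_sum_le N a0 (g := fun k => Gam k `^ s) _)).
  by move=> k; exact: powR_ge0.
apply: le_trans (ler_wpM2l D0 (ZP N.+1)).
rewrite mulr_sumr; apply: ler_sum => k _.
have kf : 0 < k`!%:R :> R by rewrite ltr0n fact_gt0.
apply: (@le_trans _ _ (D * k`!%:R `^ (q * s) * (X ^+ k / k`!%:R))).
  apply: ler_pM => //; first exact: powR_ge0.
    by rewrite divr_ge0// exprn_ge0// sumr_ge0.
  by rewrite ler_wpM2r ?invr_ge0 ?(ltW kf)// lerXn2r ?nnegrE// sumr_ge0.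
rewrite powRB ?(gt_eqF kf) ?implybT// powRr1 ?(ltW kf)//.
rewrite invf_div le_eqVlt; apply/orP; left; apply/eqP.
by field; rewrite gt_eqF.
Qed.

End Decaying.

(** A summable family f is bounded by its sum S, so f^r <= S^(r-1) f for r = t / s >= 1. With
    B^(s/t) in the role of B, f^r is the family wanted. This gives access to the large exponents
    that the condition q s < 1 of [pod_summable] excludes. *)
Lemma pod_summable_ge (s t : R) : 0 < s -> s <= t ->
  (forall B, 0 <= B -> (\esum_(u in setT) (w u `^ s * B ^+ #|` u|)%:E < +oo)%E) ->
  forall B, 0 <= B -> (\esum_(u in setT) (w u `^ t * B ^+ #|` u|)%:E < +oo)%E.
Proof.
move=> s0 st h B B0; pose r := t / s.
have r1 : 1 <= r by rewrite /r ler_pdivlMr// mul1r.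
have BE : (B `^ (s / t)) `^ r = B.
  rewrite -powRrM /r mulrA divfK ?gt_eqF ?(lt_le_trans s0)//.
  by rewrite divff ?gt_eqF// powRr1.
pose f u := w u `^ s * (B `^ (s / t)) ^+ #|` u|.
have f0 u : 0 <= f u by rewrite mulr_ge0 ?exprn_ge0 ?powR_ge0.
have fF : (\esum_(u in setT) (f u)%:E < +oo)%E by apply: h; exact: powR_ge0.
set S := fine (\esum_(u in setT) (f u)%:E)%E.
have fS u : f u <= S by exact: (term_le_esum f0 fF).
have sr : s * r = t by rewrite /r mulrC divfK// gt_eqF.
have fr u : w u `^ t * B ^+ #|` u| = f u `^ r.
  rewrite /f powRM ?powR_ge0 ?exprn_ge0 ?powR_ge0// -powRrM sr.
  by rewrite -(powR_mulrn _ (powR_ge0 B _)) powRAC BE powR_mulrn.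
apply: (esum_scale_fin f0 fF (powR_ge0 S (r - 1))) => u; rewrite fr.
have [f00|fn0] := eqVneq (f u) 0.
  by rewrite f00 powR0 ?mulr0// gt_eqF// (lt_le_trans ltr01).
have fgt : 0 < f u by rewrite lt_neqAle eq_sym fn0 f0.
rewrite -{1}(subrK 1 r) powRD ?(gt_eqF fgt) ?implybT// powRr1//.
by rewrite ler_wpM2r// ge0_ler_powR ?nnegrE ?subr_ge0// (le_trans (f0 u)).
Qed.

End PodWeights.

(** * The decay of POD weights equals that of the single coordinates *)

Section Decay.
Context {R : realType} {d : measure_display} {T : measurableType d}.
Variables (K : T -> T -> R) (rho : probability T R).
Hypothesis C0_gt0 : 0 < double_mean K rho.
Variables Gam gam : nat -> R.
Hypothesis gam_ge0 : forall j, 0 <= gam j.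
Hypothesis gam_noninc : forall i j, (i <= j)%N -> gam j <= gam i.
Hypothesis Gam0 : Gam 0%N = 1.
Hypothesis Gam1 : Gam 1%N = 1.
Hypothesis Gam_ge0 : forall k, 0 <= Gam k.
Local Notation w := (pod Gam gam).
Local Notation C0 := (double_mean K rho).
Local Notation hatw := (hat K rho w).
Local Notation dec1 := (decay K rho w (Some 1%N)).
Local Notation dec := (decay K rho w None).

Lemma hat_single j : hatw [fset j]%fset = gam j * C0.
Proof. by rewrite /hat pod1// cardfs1 expr1. Qed.

Lemma hat_ge0 u : 0 <= hatw u.
Proof. by rewrite mulr_ge0 ?exprn_ge0 ?(ltW C0_gt0)//; exact: pod_ge0. Qed.

Lemma sets_upto_single sigma j :
  (if sigma is Some s then (1 <= s)%N else true) -> 0 < gam j ->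
  sets_upto w sigma [fset j]%fset.
Proof.
move=> s1 gj; split; last by case: sigma s1 => // s; rewrite cardfs1.
  by rewrite -cardfs_gt0 cardfs1.
by rewrite pod1.
Qed.

Lemma sets_upto1P u : sets_upto w (Some 1%N) u ->
  exists2 j, u = [fset j]%fset & 0 < gam j.
Proof.
move=> [u0 wu u1]; have /cardfs1P [j uj] : #|` u| == 1%N.
  by rewrite eqn_leq u1 cardfs_gt0.
by exists j => //; rewrite -(pod1 gam Gam1) -uj.
Qed.

Lemma exists_index_ge (j : nat) (k : nat -> nat) :
  (forall a b, (a <= j)%N -> (b <= j)%N -> k a = k b -> a = b) ->
  exists2 i, (i <= j)%N & (j <= k i)%N.
Proof.
move=> kinj; apply: contrapT => nex.
have kj i : (i <= j)%N -> (k i < j)%N.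
  by move=> ij; rewrite ltnNge; apply/negP => jk; apply: nex; exists i.
pose g (i : 'I_j.+1) : 'I_j := Ordinal (kj i (ltn_ord i : (i <= j)%N)).
have ginj : injective g.
  by move=> a b [] /kinj ab; apply/val_inj/ab; rewrite -ltnS ltn_ord.
by have := leq_card g ginj; rewrite !card_ord ltnn.
Qed.

(** The j + 1 singletons with index at most j occupy distinct positions, so one of them sits at
    position j or later; values decrease along the ordering. *)
Lemma decay_order_single_le sigma e j :
  (if sigma is Some s then (1 <= s)%N else true) ->
  decay_order K rho w sigma e -> 0 < gam j -> gam j * C0 <= hatw (e j).
Proof.
move=> s1 [einj erng emono] gj.
have gi i : (i <= j)%N -> 0 < gam i by move=> ij; exact: lt_le_trans (gam_noninc ij).
have /choice [k kP] : forall i, exists n, (i <= j)%N -> e n = [fset i]%fset.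
  move=> i; have [ij|_] := leqP i j; last by exists 0%N.
  have : sets_upto w sigma [fset i]%fset by apply: sets_upto_single => //; exact: gi.
  by rewrite -erng => -[n _ <-]; exists n.
have [|i ij jk] := @exists_index_ge j k.
  by move=> a b aj bj kab; apply/fset1_inj; rewrite -(kP a aj) -(kP b bj) kab.
apply: le_trans (emono _ _ jk); rewrite (kP i ij) hat_single.
by rewrite ler_wpM2r ?(ltW C0_gt0)// gam_noninc.
Qed.

Lemma eventually_powR_bound (a : nat -> R) (p : R) N : 0 <= p ->
  (forall j, a j <= a 0%N) -> 0 <= a 0%N ->
  (forall j, (N <= j)%N -> a j <= j.+1%:R `^ (- p)) ->
  exists2 A, 0 <= A & forall j, a j <= A * j.+1%:R `^ (- p).
Proof.
move=> p0 a0 a00 aN; exists (Num.max 1 (a 0%N * N.+1%:R `^ p)).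
  by rewrite le_max ler01.
move=> j; have [Nj|jN] := leqP N j.
  apply: (le_trans (aN _ Nj)); rewrite ler_peMl ?powR_ge0//.
  by rewrite le_max lexx.
apply: (@le_trans _ _ (a 0%N * N.+1%:R `^ p * j.+1%:R `^ (- p))).
  rewrite -mulrA; apply: (le_trans (a0 j)); rewrite ler_peMr//.
  rewrite powRN ler_pdivlMr ?powR_gt0// mul1r.
  by rewrite ge0_ler_powR ?nnegrE// ler_nat ltnS ltnW.
by rewrite ler_wpM2r ?powR_ge0// le_max lexx orbT.
Qed.

Lemma gam_eventually0 : finite_set (sets_upto w (Some 1%N)) ->
  exists N, forall j, (N <= j)%N -> gam j = 0.
Proof.
move=> fin; apply: contrapT => nex.
have gpos j : 0 < gam j.
  rewrite lt_neqAle eq_sym gam_ge0 andbT; apply/eqP => gj0; apply: nex.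
  by exists j => i ji; apply/eqP; rewrite eq_le gam_ge0 -gj0 gam_noninc.
apply: infinite_nat.
rewrite (_ : setT = (fun j : nat => [fset j]%fset) @^-1` sets_upto w (Some 1%N)).
  by apply: finite_preimage => // i j _ _ /fset1_inj.
by apply/seteqP; split => // j _; apply: sets_upto_single.
Qed.

Lemma decay1_bound p : 0 <= p -> (p%:E < dec1)%E ->
  exists2 A, 0 <= A & forall j, gam j <= A * j.+1%:R `^ (- p).
Proof.
move=> p0; rewrite /decay; case: pselect => [fin _|inf].
  have [N NP] := gam_eventually0 fin.
  apply: (@eventually_powR_bound _ _ N) => //.
    by move=> j; exact: gam_noninc.
  by move=> j /NP ->; exact: powR_ge0.
move=> /ereal_sup_gt [_ [p1 [e eo ecv] <-]]; rewrite lte_fin => pp1.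
have /cvgrPdist_le /(_ 1 ltr01) [N _ NP] := ecv.
have [//||||A A0 AP] := @eventually_powR_bound (fun j => hatw (e j)) p N.
- by move=> j; case: eo => _ _; apply.
- exact: hat_ge0.
- move=> j Nj; have /= := NP _ Nj.
  rewrite sub0r normrN (ger0_norm (mulr_ge0 (hat_ge0 _) (powR_ge0 _ _))) => h1.
  apply: (@le_trans _ _ (j.+1%:R `^ (- p1))).
    by rewrite powRN -[leRHS]mul1r ler_pdivlMr ?powR_gt0.
  by rewrite ler_powR ?ler1n// lerN2 ltW.
exists (A / C0); first by rewrite divr_ge0// ltW.
move=> j; have [gj|gj] := leP (gam j) 0.
  by rewrite (le_trans gj)// mulr_ge0 ?powR_ge0// divr_ge0// ltW.
rewrite mulrAC ler_pdivlMr//; apply: le_trans (AP j).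
exact: (@decay_order_single_le (Some 1%N)).
Qed.

Lemma decay1_pinfty j : gam j = 0 -> dec1 = +oo%E.
Proof.
move=> gj0; rewrite /decay; case: pselect => // inf; exfalso; apply: inf.
apply: (sub_finite_set (B := [set [fset i]%fset | i in `I_j])); last first.
  exact/finite_image/finite_II.
move=> u /sets_upto1P [i -> gi]; exists i => //=.
by rewrite ltnNge; apply/negP => /gam_noninc; rewrite gj0 leNgt gi.
Qed.

Lemma decay1_ge p : (forall j, 0 < gam j) ->
  gam j * j.+1%:R `^ p @[j --> \oo] --> 0 -> (p%:E <= dec1)%E.
Proof.
move=> gpos cv; rewrite /decay; case: pselect => [fin|inf]; first exact: leey.
apply: ereal_sup_ubound; exists p => //; exists (fun j => [fset j]%fset).
  split.
  - by move=> i j /fset1_inj.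
  - apply/seteqP; split => [_ [j _ <-]|u su]; last first.
      by have [j -> _] := sets_upto1P su; exists j.
    exact: sets_upto_single.
  - by move=> i j ij; rewrite !hat_single ler_wpM2r ?(ltW C0_gt0)// gam_noninc.
under eq_fun do rewrite hat_single mulrAC.
have : gam j * j.+1%:R `^ p * C0 @[j --> \oo] --> 0 * C0.
  by apply: cvgM => //; exact: cvg_cst.
by rewrite mul0r.
Qed.

(** By [decay_order_single_le] an ordering of all sets stays above the singletons position by
    position, so each of its rates is a rate for the singletons. *)
Lemma decay_le_decay1 : (0 < dec1)%E -> (dec <= dec1)%E.
Proof.
move=> dpos; have [[j gj]|gpos] := pselect (exists j, gam j = 0).
  by rewrite (decay1_pinfty gj) leey.
have {}gpos j : 0 < gam j.
  by rewrite lt_neqAle eq_sym gam_ge0 andbT; apply/eqP => gj; apply: gpos; exists j.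
rewrite {1}/decay; case: pselect => [fin|inf].
  rewrite /decay; case: pselect => // inf1; exfalso; apply: inf1.
  by apply: sub_finite_set fin => u [u0 wu _]; split.
apply: ge_ereal_sup => _ [p [e eo ecv] <-].
apply: decay1_ge => //.
apply: (@squeeze_cvgr _ _ _ _ (fun=> 0) (fun j => C0^-1 * (hatw (e j) * j.+1%:R `^ p))).
- apply: nearW => j; rewrite (mulr_ge0 (gam_ge0 j) (powR_ge0 _ _))/= mulrA ler_wpM2r ?powR_ge0//.
  by rewrite mulrC ler_pdivlMr// (@decay_order_single_le None).
- exact: cvg_cst.
- have : C0^-1 * (hatw (e j) * j.+1%:R `^ p) @[j --> \oo] --> C0^-1 * 0.
    by apply: cvgM => //; exact: cvg_cst.
  by rewrite mulr0.
Qed.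

Lemma ereal_real_between (x : R) (D : \bar R) : (x%:E < D)%E ->
  exists2 p, x < p & (p%:E < D)%E.
Proof.
case: D => [r||//]; first by rewrite lte_fin => xr; exists ((x + r) / 2); rewrite ?lte_fin; lra.
by move=> _; exists (x + 1); [lra|exact: ltry].
Qed.

(** Comparison through real exponents; since D exceeds 1, those above 1 suffice, and this keeps them
    positive. *)
Lemma ereal_le_of_lt (D D' : \bar R) : (1 < D)%E ->
  (forall p, 1 < p -> (p%:E < D)%E -> (p%:E <= D')%E) -> (D <= D')%E.
Proof.
move=> D1 h; rewrite leNgt; apply/negP => D'D.
have [p [p1 pD D'p]] : exists p : R, [/\ 1 < p, (p%:E < D)%E & (D' < p%:E)%E].
  case: D' D'D {h} => [r rD||_].
  - have [p rp pD] : exists2 p, Num.max r 1 < p & (p%:E < D)%E.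
      apply: ereal_real_between; rewrite EFin_max.
      by rewrite /maxe; case: ifP.
    by exists p; move: rp; rewrite gt_max => /andP[? ?]; split; rewrite ?lte_fin.
  - by rewrite ltNge leey.
  - have [p p1 pD] := ereal_real_between D1; exists p; split => //; exact: ltNyr.
by have := h p p1 pD; rewrite leNgt D'p.
Qed.

Lemma cvg_powRN (t : R) : 0 < t -> n.+1%:R `^ (- t) @[n --> \oo] --> 0.
Proof.
move=> t0; apply/cvgrPdist_le => e e0; exists (Num.truncn (e `^ (- t^-1))) => // n /= nN.
rewrite sub0r normrN ger0_norm ?powR_ge0//.
have Nn : e `^ (- t^-1) <= n.+1%:R.
  by apply/ltW/(lt_le_trans (truncnS_gt _)); rewrite ler_nat ltnS.
rewrite powRN -[leRHS]invrK lef_pV2 ?posrE ?invr_gt0 ?powR_gt0//.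
have -> : e^-1 = (e `^ (- t^-1)) `^ t.
  by rewrite -powRrM mulNr mulVf ?gt_eqF// powR_inv1// ltW.
by rewrite ge0_ler_powR ?nnegrE ?powR_ge0// ltW.
Qed.

Hypothesis dec1_gt1 : (1 < dec1)%E.
Hypothesis growth : exists q, (q%:E < dec1)%E /\
     exists2 Cq, 0 < Cq & forall k, (0 < k)%N -> Gam k <= Cq * (k`!)%:R `^ q.

(** Some p fits strictly between max(q, 1/s) and the decay. At the exponent 1/p both conditions of
    [pod_summable] hold, gam decaying at a rate p2 > p; [pod_summable_ge] then passes from 1/p to
    s. *)
Lemma decay_summable s B : 0 < s -> (s^-1%:E < dec1)%E -> 0 <= B ->
  (\esum_(u in setT) (w u `^ s * B ^+ #|` u|)%:E < +oo)%E.
Proof.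
move=> s0 sdec.
have [q [qdec [Cq Cq0 GC]]] := growth.
have [p xp pdec] : exists2 p, Num.max q s^-1 < p & (p%:E < dec1)%E.
  by apply: ereal_real_between; rewrite EFin_max /maxe; case: ifP.
have [p2 pp2 p2dec] := ereal_real_between pdec.
move: xp; rewrite gt_max => /andP[qp sp].
have p0 : 0 < p by apply: lt_trans sp; rewrite invr_gt0.
have [A A0 gA] := decay1_bound (ltW (lt_trans p0 pp2)) p2dec.
apply: (@pod_summable_ge _ _ _ p^-1).
- by rewrite invr_gt0.
- by rewrite -[leRHS]invrK lef_pV2 ?posrE ?invr_gt0// ltW.
move=> {}B B0; apply: (pod_summable gam_ge0 Gam0 Gam_ge0 gA Cq0 GC) => //.
- by rewrite invr_gt0.
- by rewrite ltr_pdivlMr// mul1r.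
- by rewrite ltr_pdivrMr// mul1r.
Qed.

(** Summability of the s-th powers with s = 1/p2 makes the j-th largest value O(j^(-p2)), and p2 > p
    leaves a factor tending to 0. *)
Lemma decay1_le_decay : (dec1 <= dec)%E.
Proof.
apply: ereal_le_of_lt => // p p1 pdec.
rewrite {1}/decay; case: pselect => [fin|inf]; first exact: leey.
have [p2 pp2 p2dec] := ereal_real_between pdec.
have p20 : 0 < p2 by lra.
pose s := p2^-1; have s0 : 0 < s by rewrite invr_gt0.
have sm : (\esum_(u in setT) (w u `^ s * (C0 `^ s) ^+ #|` u|)%:E < +oo)%E.
  by apply: decay_summable => //; [rewrite invrK|exact: powR_ge0].
pose f u := hatw u `^ s.
have f0 u : 0 <= f u by exact: powR_ge0.
have fF : (\esum_(u in setT) (f u)%:E < +oo)%E.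
  apply: le_lt_trans sm; apply: le_esum => u _; rewrite lee_fin /f /hat.
  rewrite powRM ?pod_ge0 ?exprn_ge0 ?(ltW C0_gt0)//.
  by rewrite -(powR_mulrn _ (ltW C0_gt0)) powRAC powR_mulrn ?powR_ge0.
set S := fine (\esum_(u in setT) (f u)%:E)%E.
have hpos u : sets_upto w None u -> 0 < hatw u.
  by move=> [_ wu _]; rewrite mulr_gt0 ?exprn_gt0.
have lev t : 0 < t -> finite_set [set u | sets_upto w None u /\ t <= hatw u].
  move=> t0; have := summable_level_finite f0 fF (powR_gt0 s t0).
  apply: sub_finite_set => u [_ tu] /=.
  by rewrite ge0_ler_powR ?nnegrE ?(ltW s0) ?(ltW t0) ?hat_ge0.
have [e [einj erng emono]] := decreasing_enumeration inf lev hpos.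
apply: ereal_sup_ubound; exists p => //; exists e; first by split.
(* The first j + 1 terms are at least as large as the last of them, and together they are at most
   the total sum. *)
have fle j : f (e j) <= S / j.+1%:R.
  rewrite ler_pdivlMr//; have us : uniq [seq e i | i <- iota 0 j.+1].
    by rewrite map_inj_uniq ?iota_uniq.
  apply: le_trans (sum_le_esum f0 fF us); rewrite big_map.
  apply: (@le_trans _ _ (\sum_(i <- iota 0 j.+1) f (e j))).
    rewrite big_const_seq count_predT size_iota iter_addr_0.
    by rewrite mulr_natr.
  rewrite big_seq [leRHS]big_seq; apply: ler_sum => i.
  rewrite mem_iota add0n ltnS => ij.
  by rewrite /f ge0_ler_powR ?nnegrE ?(ltW s0) ?hat_ge0// emono.
have S0 : 0 <= S by rewrite fine_ge0// esum_ge0// => u _; rewrite lee_fin.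
have hle j : hatw (e j) <= S `^ p2 * j.+1%:R `^ (- p2).
  have -> : hatw (e j) = f (e j) `^ p2.
    by rewrite /f -powRrM mulVf ?gt_eqF// powRr1// hat_ge0.
  rewrite powRN -(powR_inv1 (powR_ge0 _ _)) powRAC powR_inv1// -powRM ?invr_ge0//.
  by rewrite ge0_ler_powR ?nnegrE ?(ltW p20)// divr_ge0.
apply: (@squeeze_cvgr _ _ _ _ (fun=> 0) (fun j => S `^ p2 * j.+1%:R `^ (- (p2 - p)))).
- apply: nearW => j; rewrite (mulr_ge0 (hat_ge0 _) (powR_ge0 _ _))/=.
  rewrite opprB addrC powRD; last by rewrite pnatr_eq0 implybT.
  by rewrite mulrA ler_wpM2r ?powR_ge0.
- exact: cvg_cst.
- have : S `^ p2 * j.+1%:R `^ (- (p2 - p)) @[j --> \oo] --> S `^ p2 * 0.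
    by apply: cvgM; [exact: cvg_cst|apply: cvg_powRN; lra].
  by rewrite mulr0.
Qed.

Lemma decayE : dec = dec1.
Proof.
apply/eqP; rewrite eq_le decay1_le_decay andbT decay_le_decay1//.
exact: lt_trans dec1_gt1.
Qed.

End Decay.

(** * Solving l ln l = O(E) for l *)

Section Dimension.
Context {R : realType}.

(** A single term of the exponential series at l gives l^l / l! <= exp(l). *)
Lemma ln_fact_ge (l : nat) : (0 < l)%N -> l%:R * ln l%:R - l%:R <= ln l`!%:R :> R.
Proof.
move=> l0; have lR : 0 < l%:R :> R by rewrite ltr0n.
have fR : 0 < l`!%:R :> R by rewrite ltr0n fact_gt0.
have := @expr_fact_le R l%:R l (ltW lR).
rewrite -ler_ln ?posrE ?divr_gt0 ?exprn_gt0 ?expR_gt0// expRK.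
rewrite ln_div ?posrE ?exprn_gt0// lnXn// -[ln _ *+ _]mulr_natl; lra.
Qed.

Lemma ln_le_sqrt (x : R) : 0 < x -> ln x <= 2 * Num.sqrt x.
Proof.
move=> x0; have s0 : 0 < Num.sqrt x by rewrite sqrtr_gt0.
rewrite -{1}(sqr_sqrtr (ltW x0)) lnXn// -[leLHS]mulr_natl ler_wpM2l//.
by apply/ltW/ln_sublinear.
Qed.

(** If l <= sqrt E, then ln E <= 2 sqrt E gives l ln E <= 2 E. Otherwise ln l >= (ln E) / 2, and the
    hypothesis gives l (delta / 4) ln E <= 3 E. These two cases are the two summands of the constant
    2 + 12 / delta. *)
Lemma dimension_bound (delta b c : R) : 0 < delta ->
  exists2 M, 0 <= M & exists E0, forall E, E0 <= E -> forall l : nat, (0 < l)%N ->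
    l%:R * (delta * ln l%:R - b) <= 2 * E + c -> l%:R <= M * (E / ln E).
Proof.
move=> d0; exists (2 + 12 / delta); first by rewrite addr_ge0// divr_ge0// ltW.
(* This threshold makes b at most (delta / 4) ln E; the maximum with c in the next line makes 2 E +
   c at most 3 E. *)
pose t := Num.max 1 (4 * b / delta).
exists (Num.max (expR t) c) => E; rewrite ge_max => /andP[Et Ec] l l0 h.
have t1 : 1 <= t by rewrite /t le_max lexx.
have Egt : 0 < E by apply: lt_le_trans Et; exact: expR_gt0.
have tE : t <= ln E by rewrite -[leLHS]expRK ler_ln ?posrE ?expR_gt0.
have lnE : 1 <= ln E by exact: le_trans tE.
have lnE0 : 0 < ln E by exact: lt_le_trans lnE.
have bE : 4 * b <= delta * ln E.
  have : 4 * b / delta <= ln E by apply: le_trans tE; rewrite /t le_max lexx orbT.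
  by rewrite ler_pdivrMr// [ln E * _]mulrC.
rewrite mulrA ler_pdivlMr//.
have [lE|El] := leP l%:R (Num.sqrt E).
  apply: (@le_trans _ _ (Num.sqrt E * (2 * Num.sqrt E))).
    by apply: ler_pM => //; [exact: ltW|exact: ln_le_sqrt].
  rewrite mulrCA -expr2 sqr_sqrtr ?(ltW Egt)// ler_wpM2r ?(ltW Egt)//.
  by rewrite lerDl divr_ge0// (ltW d0).
have lR : 0 < l%:R :> R by rewrite ltr0n.
have lnl : ln E <= 2 * ln l%:R.
  have E2 : E <= l%:R ^+ 2.
    rewrite -(sqr_sqrtr (ltW Egt)) lerXn2r ?nnegrE ?sqrtr_ge0 ?(ltW lR)//; exact: ltW.
  by rewrite (mulr_natl (ln l%:R) 2) -lnXn// ler_ln ?posrE ?exprn_gt0.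
have h2 : l%:R * (delta / 4 * ln E) <= 3 * E.
  apply: (@le_trans _ _ (l%:R * (delta * ln l%:R - b))); last lra.
  rewrite ler_wpM2l ?(ltW lR)//.
  have : delta * ln E <= delta * (2 * ln l%:R) by rewrite ler_wpM2l// ltW.
  lra.
have : l%:R * ln E <= 12 / delta * E.
  rewrite (_ : l%:R * ln E = 4 / delta * (l%:R * (delta / 4 * ln E))); last first.
    by field; rewrite gt_eqF.
  rewrite (_ : 12 / delta * E = 4 / delta * (3 * E)); last by field; rewrite gt_eqF.
  by rewrite ler_wpM2l// divr_ge0// ltW.
move=> /le_trans; apply; rewrite ler_wpM2r ?(ltW Egt)//; lra.
Qed.

Lemma near_right0_ln (E0 : R) : \forall eps \near (0 : R)^'+, E0 <= ln eps^-1.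
Proof.
near=> eps; have e0 : 0 < eps by [].
rewrite -[leLHS]expRK ler_ln ?posrE ?expR_gt0 ?invr_gt0//.
rewrite -[leLHS]invrK lef_pV2 ?posrE ?invr_gt0 ?expR_gt0// ltW//.
near: eps; apply: nbhs_right_lt; by rewrite invr_gt0 expR_gt0.
Unshelve. all: end_near.
Qed.

End Dimension.

(** * The largest active dimension for POD weights *)

Section PodDimension.
Context {R : realType}.
Variables Gam gam : nat -> R.
Hypothesis gam_ge0 : forall j, 0 <= gam j.
Hypothesis gam_noninc : forall i j, (i <= j)%N -> gam j <= gam i.
Hypothesis Gam_ge0 : forall k, 0 <= Gam k.
Local Notation w := (pod Gam gam).
Local Notation first l := [fset j in iota 0 l]%fset.

Lemma card_first l : #|` first l| = l.
Proof. by rewrite card_fseq undup_id ?iota_uniq// size_iota. Qed.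

Lemma prod_first l : \prod_(j <- first l) gam j = \prod_(j < l) gam j.
Proof.
rewrite -(big_mkord xpredT gam); apply: perm_big; apply: uniq_perm.
- exact: fset_uniq.
- exact: iota_uniq.
- by move=> j; rewrite !inE /index_iota subn0.
Qed.

(** Removing the largest index N from u leaves at most N indices, so gam N is at most the last
    factor, of index |u| - 1, in the product over the initial segment. *)
Lemma prod_le_first (u : {fset nat}) :
  \prod_(j <- u) gam j <= \prod_(j < #|` u|) gam j.
Proof.
have [N uN] := fset_nat_bound u.
elim: N u uN => [|N IH] u uN.
  have -> : u = fset0 by apply/fsetP => j; rewrite inE; apply/negP => /uN.
  by rewrite cardfs0 big_ord0 big_seq_fset0.
have [Nu|Nu] := boolP (N \in u); last first.
  apply: IH => j ju; have := uN _ ju; rewrite ltnS leq_eqVlt => /orP[/eqP jN|//].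
  by rewrite -jN ju in Nu.
pose v := (u `\ N)%fset.
have vN j : j \in v -> (j < N)%N.
  rewrite !inE => /andP[jN ju].
  by have := uN _ ju; rewrite ltnS leq_eqVlt (negbTE jN).
have cv : (#|` v| <= N)%N.
  rewrite -[leqRHS]card_first; apply: fsubset_leq_card.
  by apply/fsubsetP => j /vN jN; rewrite !inE mem_iota.
rewrite (big_fsetD1 N)//= (cardfsD1 N) Nu add1n big_ord_recr/= mulrC.
by apply: ler_pM; rewrite ?prodr_ge0//; [exact: IH|exact: gam_noninc].
Qed.

Lemma pod_le_first (u : {fset nat}) : w u <= w (first #|` u|).
Proof. by rewrite /pod card_first prod_first ler_wpM2l// prod_le_first. Qed.

Lemma prod_gam_le (A p : R) l : 0 <= A -> (forall j, gam j <= A * j.+1%:R `^ (- p)) ->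
  \prod_(j < l) gam j <= A ^+ l * l`!%:R `^ (- p).
Proof.
move=> A0 gA; elim: l => [|l IH]; first by rewrite big_ord0 fact0 powR1 expr0 mulr1.
rewrite big_ord_recr/= factS natrM mulrC powRM// exprS -mulrA mulrCA !mulrA.
rewrite -mulrA [X in _ <= X](_ : _ = A * l.+1%:R `^ (- p) * (A ^+ l * l`!%:R `^ (- p))); last by ring.
by apply: ler_pM => //; exact: prodr_ge0.
Qed.

Variables (A p q Cq : R).
Hypothesis A1 : 1 <= A.
Hypothesis gamA : forall j, gam j <= A * j.+1%:R `^ (- p).
Hypothesis Cq_gt0 : 0 < Cq.
Hypothesis GamC : forall k, (0 < k)%N -> Gam k <= Cq * k`!%:R `^ q.
Hypothesis qp : q < p.
Variables (lam0 c1 C : R).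
Hypothesis lam0_gt0 : 0 < lam0.
Hypothesis c1_gt0 : 0 < c1.
Hypothesis C_gt0 : 0 < C.
Hypothesis L_gt0 : 0 < Lsum w lam0.
Local Notation dims := (cd_dims w lam0 c1 C).

Lemma cd_dims_bound : exists2 M, 0 <= M &
  \forall eps \near (0 : R)^'+, forall l, dims eps l ->
    l%:R <= M * (ln eps^-1 / ln (ln eps^-1)).
Proof.
pose delta := (p - q) * lam0; have d0 : 0 < delta by rewrite mulr_gt0// subr_gt0.
pose B := C * A `^ lam0; have B0 : 0 < B by rewrite mulr_gt0// powR_gt0// (lt_le_trans ltr01).
pose c := c1 * Lsum w lam0 * Cq `^ lam0.
have c0 : 0 < c by rewrite !mulr_gt0// powR_gt0.
(* [ln B] collects the geometric factors; the extra [delta] is the loss of l in ln l! >= l ln l -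
   l. *)
have [M M0 [E0 MP]] := dimension_bound (ln B + delta) (ln c) d0.
exists M => //; near=> eps => l [l0 le].
have e0 : 0 < eps by [].
apply: MP => //; first by near: eps; exact: near_right0_ln.
have lf : 0 < l`!%:R :> R by rewrite ltr0n fact_gt0.
have wle : w (first l) `^ lam0 <= Cq `^ lam0 * (A `^ lam0) ^+ l * l`!%:R `^ (- delta).
  have h : w (first l) <= Cq * A ^+ l * l`!%:R `^ (- (p - q)).
    rewrite /pod card_first prod_first.
    apply: (@le_trans _ _ (Cq * l`!%:R `^ q * (A ^+ l * l`!%:R `^ (- p)))).
      apply: ler_pM => //; [exact: prodr_ge0|exact: GamC|].
      exact: (prod_gam_le _ (le_trans ler01 A1)).
    rewrite opprB powRB ?(gt_eqF lf) ?implybT// powRN.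
    by rewrite le_eqVlt; apply/orP; left; apply/eqP; ring.
  have A0 : 0 <= A by apply: le_trans A1.
  apply: (@le_trans _ _ ((Cq * A ^+ l * l`!%:R `^ (- (p - q))) `^ lam0)).
    rewrite ge0_ler_powR ?nnegrE ?(ltW lam0_gt0)//.
      by rewrite /pod mulr_ge0// prodr_ge0.
    by rewrite !mulr_ge0 ?exprn_ge0 ?powR_ge0 ?(ltW Cq_gt0).
  rewrite powRM ?mulr_ge0 ?exprn_ge0 ?powR_ge0 ?(ltW Cq_gt0)//.
  rewrite powRM ?exprn_ge0 ?(ltW Cq_gt0)// -powRrM mulNr.
  by rewrite -(powR_mulrn l A0) powRAC powR_mulrn// powR_ge0.
have key : eps ^+ 2 < c * B ^+ l * l`!%:R `^ (- delta).
  apply: (lt_le_trans le).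
  apply: (@le_trans _ _ (c1 * C ^+ l * Lsum w lam0 *
     (Cq `^ lam0 * (A `^ lam0) ^+ l * l`!%:R `^ (- delta)))).
    by rewrite ler_wpM2l// !mulr_ge0// ?exprn_ge0 ?(ltW c1_gt0) ?(ltW C_gt0) ?(ltW L_gt0).
  by rewrite /B /c exprMn le_eqVlt; apply/orP; left; apply/eqP; ring.
have : ln (eps ^+ 2) <= ln (c * B ^+ l * l`!%:R `^ (- delta)).
  by rewrite ler_ln ?posrE ?exprn_gt0// ?(ltW key)// (lt_trans _ key)// exprn_gt0.
have -> : ln (eps ^+ 2) = - (2 * ln eps^-1).
  by rewrite lnXn// lnV ?posrE// -mulr_natl; ring.
have Bl : 0 < B ^+ l by rewrite exprn_gt0.
have fd : 0 < l`!%:R `^ (- delta) :> R by rewrite powR_gt0.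
rewrite lnM ?posrE ?(mulr_gt0 c0 Bl)// lnM ?posrE// ln_powR (lnXn l B0) -mulr_natl.
have := ler_wpM2l (ltW d0) (@ln_fact_ge R l l0); lra.
Unshelve. all: end_near.
Qed.

End PodDimension.

(** * Error and cost of the changing dimension algorithm for general weights *)

Section ChangingDimensionError.
Context {R : realType} {d : measure_display} {T : measurableType d}.
Variables (rho : probability T R) (mu : probability (seqspace T) R).
Hypothesis muE : infinite_product rho mu.
Variable K : T -> T -> R.
Hypothesis mK : measurable_fun setT (fun q : T * T => K q.1 q.2).
Variable H : rkhs K.
Hypothesis diag_fin : (diag_mean K rho < +oo)%E.
Hypothesis C0_gt0 : 0 < double_mean K rho.
Variable Hu : forall u, rkhs (Kset K u).
Variable c : T.
Hypothesis Kcc : K c c = 0.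
Variable w : {fset nat} -> R.
Hypothesis w0 : forall u, 0 <= w u.
Hypothesis w_fin : (\esum_(u in [set: {fset nat}])
     (w u * fine (diag_mean K rho) ^+ #|` u|)%:E < +oo)%E.
Variables (lam0 tau c1 C : R) (Qb : @bb_family R d T).
Hypothesis lam0_gt0 : 0 < lam0.
Hypothesis lam0_lt1 : lam0 < 1.
Hypothesis tau_gt0 : 0 < tau.
Hypothesis c1_ge1 : 1 <= c1.
Hypothesis C_ge : double_mean K rho <= C.
Hypothesis L_fin : (\esum_(u in [set u : {fset nat} | u != fset0])
          (w u `^ (1 - lam0))%:E < +oo)%E.
Hypothesis L_gt0 : 0 < Lsum w lam0.
Hypothesis S_fin : forall B, 0 <= B -> (\esum_(u in setT)
   (w u `^ (lam0 / (2 * tau)) * B ^+ #|` u|)%:E < +oo)%E.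

Local Notation thr := (cd_thr w lam0 c1 C).
Local Notation cdn := (cd_n w lam0 tau c1 C).
Local Notation cds := (cd_sets w lam0 tau c1 C).
Local Notation L := (Lsum w lam0).
Local Notation QCD := (cd_alg w c lam0 tau c1 C Qb).
Local Notation C0 := (double_mean K rho).

Let c1_gt0 : 0 < c1. Proof. exact: lt_le_trans c1_ge1. Qed.
Let C_gt0 : 0 < C. Proof. exact: lt_le_trans C_ge. Qed.
Let tau2_gt0 : 0 < (2 * tau)^-1. Proof. by rewrite invr_gt0 mulr_gt0. Qed.

(** Up to a constant and eps^(-1/tau), n_u is bounded by W with B = C^(1/(2 tau)); a larger B leaves
    room for further factors exponential in |u|. *)
Let W B u := w u `^ (lam0 / (2 * tau)) * B ^+ #|` u|.

Let W_ge0 B u : 0 <= B -> 0 <= W B u.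
Proof. by move=> B0; rewrite mulr_ge0 ?powR_ge0 ?exprn_ge0. Qed.

Lemma cd_thr_ge0 u : 0 <= thr u.
Proof. by rewrite !mulr_ge0 ?powR_ge0 ?exprn_ge0// ltW. Qed.

Lemma cd_thr_powR u : thr u `^ (2 * tau)^-1 =
  (L * c1) `^ (2 * tau)^-1 * W (C `^ (2 * tau)^-1) u.
Proof.
rewrite (_ : thr u = L * c1 * (w u `^ lam0 * C ^+ #|` u|)); last by rewrite /cd_thr; ring.
rewrite powRM ?(mulr_ge0 (ltW L_gt0) (ltW c1_gt0))//; last first.
  by rewrite mulr_ge0 ?powR_ge0// exprn_ge0// ltW.
rewrite (@powRM _ (w u `^ lam0)) ?powR_ge0 ?exprn_ge0 ?(ltW C_gt0)// /W -powRrM.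
by rewrite -(powR_mulrn _ (ltW C_gt0)) powRAC powR_mulrn// powR_ge0.
Qed.

Lemma cd_thr_bounded : exists2 t, 0 < t & forall u, thr u <= t.
Proof.
pose B := C `^ (2 * tau)^-1; have B0 : 0 <= B by exact: powR_ge0.
set S := fine (\esum_(u in setT) (W B u)%:E)%E.
exists (1 + ((L * c1) `^ (2 * tau)^-1 * S) `^ (2 * tau)).
  by rewrite ltr_pwDl// powR_ge0.
move=> u.
have := term_le_esum (f := W B) (fun u => W_ge0 u B0) (S_fin B0) u; rewrite -/S => WS.
have -> : thr u = (thr u `^ (2 * tau)^-1) `^ (2 * tau).
  by rewrite -powRrM mulVf ?gt_eqF ?mulr_gt0// powRr1// cd_thr_ge0.
apply: (@le_trans _ _ (((L * c1) `^ (2 * tau)^-1 * S) `^ (2 * tau))); last by rewrite lerDr.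
have S0 : 0 <= S by apply: le_trans WS; exact: W_ge0.
rewrite ge0_ler_powR ?nnegrE ?powR_ge0 ?mulr_ge0 ?powR_ge0 ?(ltW tau_gt0)//.
by rewrite cd_thr_powR ler_wpM2l// powR_ge0.
Qed.

(** Above the threshold the quotient exceeds 1, so its floor is positive: n_u = 0 happens only in
    the first case of [cd_n]. *)
Lemma cd_setsP eps u : 0 < eps -> u != fset0 ->
  (u \in cds eps) = (eps ^+ 2 < thr u).
Proof.
move=> e0 u0; have e2 : 0 < eps ^+ 2 by rewrite exprn_gt0.
apply/idP/idP => [|lt].
  by rewrite inE => -[_]; rewrite /cd_n ltNge; case: ifP.
rewrite inE; split => //; rewrite /cd_n leNgt lt /= truncn_gt0.
apply: (@le_trans _ _ (1 `^ (2 * tau)^-1)); first by rewrite powR1.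
rewrite ge0_ler_powR ?nnegrE ?(ltW tau2_gt0)//.
  by rewrite mulr_ge0 ?cd_thr_ge0// invr_ge0 ltW.
by rewrite ler_pdivlMr// mul1r ltW.
Qed.

Lemma cd_n_bounds eps u : 0 < eps -> u \in cds eps ->
  (cdn eps u)%:R <= (thr u * eps ^- 2) `^ (2 * tau)^-1 < (cdn eps u).+1%:R.
Proof.
move=> e0 ucd; have u0 : u != fset0 by move: ucd; rewrite inE => -[].
move: ucd; rewrite cd_setsP// => lt; rewrite /cd_n [_ <= eps ^+ 2]leNgt lt /=.
by apply: truncn_itv; exact: powR_ge0.
Qed.

Lemma cd_sets_finite eps : 0 < eps -> finite_set (cds eps).
Proof.
move=> e0; have e2 : 0 < eps ^+ 2 by rewrite exprn_gt0.
pose B := C `^ (2 * tau)^-1; have B0 : 0 <= B by exact: powR_ge0.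
have Lc : 0 < (L * c1) `^ (2 * tau)^-1 by rewrite powR_gt0// mulr_gt0.
have t0 : 0 < (eps ^+ 2) `^ (2 * tau)^-1 / (L * c1) `^ (2 * tau)^-1.
  by rewrite divr_gt0// powR_gt0.
apply: sub_finite_set (summable_level_finite (f := W B) (fun u => W_ge0 u B0) (S_fin B0) t0).
move=> u /[dup] -[u0 _] /mem_set; rewrite cd_setsP// => lt /=.
rewrite ler_pdivrMr// [leRHS]mulrC -cd_thr_powR.
by rewrite ge0_ler_powR ?nnegrE ?cd_thr_ge0 ?(ltW tau2_gt0) ?(ltW e2) ?(ltW lt).
Qed.

Lemma cd_cost (cst : nat -> R) : (forall k, 0 <= cst k) ->
  (forall k l, (k <= l)%N -> cst k <= cst l) ->
  exists2 M, 0 <= M & forall eps D, 0 < eps ->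
    (forall u, u \in cds eps -> (#|` u| <= D)%N) ->
    cost_unr cst (QCD eps) <= cst 0%N + M * cst D * eps `^ (- tau^-1).
Proof.
move=> cst0 cst_mono.
(* The factor 2 accounts for the 2^|u| samples of f that one value of f_u requires. *)
pose B := 2 * C `^ (2 * tau)^-1; have B0 : 0 <= B by rewrite mulr_ge0// powR_ge0.
set S := fine (\esum_(u in setT) (W B u)%:E)%E.
have S0 : 0 <= S.
  rewrite /S fine_ge0// esum_ge0// => u _; rewrite lee_fin; exact: W_ge0.
exists ((L * c1) `^ (2 * tau)^-1 * S); first by rewrite mulr_ge0// powR_ge0.
move=> eps D e0 uD; have fin := cd_sets_finite e0.
have epsE : (eps ^- 2) `^ (2 * tau)^-1 = eps `^ (- tau^-1).
  have ei : 0 <= eps^-1 by rewrite invr_ge0 ltW.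
  rewrite -exprVn -(powR_mulrn 2 ei).
  rewrite -powRrM -(powR_inv1 (ltW e0)) -powRrM; congr (_ `^ _).
  by field; rewrite gt_eqF.
have inA u : (u \in enum_fset (fset_set (cds eps))) = (u \in cds eps) by exact: in_fset_set.
rewrite /cost_unr /cd_alg big_cons [active _]/= cardfs0 lerD2l big_flatten big_map.
apply: (@le_trans _ _ (\sum_(u <- fset_set (cds eps))
   (L * c1) `^ (2 * tau)^-1 * cst D * eps `^ (- tau^-1) * W B u)); last first.
  rewrite -mulr_sumr.
  rewrite [leRHS](_ : _ = (L * c1) `^ (2 * tau)^-1 * cst D * eps `^ (- tau^-1) * S); last by ring.
  rewrite ler_wpM2l ?mulr_ge0 ?powR_ge0//.
  by apply: (sum_le_esum (fun u => W_ge0 u B0) (S_fin B0)); exact: fset_uniq.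
rewrite big_seq [leRHS]big_seq; apply: ler_sum => u; rewrite inA => ucd.
rewrite /cd_block big_allpairs_dep /=.
have /andP[nle _] := cd_n_bounds e0 ucd.
apply: (@le_trans _ _ ((cdn eps u)%:R * (2 ^+ #|` u| * cst D))).
  rewrite -[in leRHS](size_tuple (Qb (cdn eps u) u)).
  elim: (tval _) => [|p s IH]; first by rewrite big_nil mul0r.
  rewrite big_cons/= -natr1 mulrDl mul1r addrC; apply: lerD => //.
  apply: (@le_trans _ _ (\sum_(v <- fpowerset u) cst D)).
    rewrite big_seq [leRHS]big_seq; apply: ler_sum => v; rewrite fpowersetE => vu.
    apply: cst_mono; apply: leq_trans (uD _ ucd).
    apply: fsubset_leq_card; apply: fsubset_trans vu.
    by apply/fsubsetP => j; rewrite !inE => /andP[].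
  rewrite big_const_seq count_predT iter_addr_0 -/(#|` fpowerset u|) card_fpowerset.
  by rewrite -[leLHS]mulr_natl natrX.
apply: (le_trans (ler_wpM2r _ nle)); first by rewrite mulr_ge0// exprn_ge0.
rewrite powRM ?cd_thr_ge0 ?invr_ge0 ?exprn_ge0 ?(ltW e0)// epsE cd_thr_powR.
rewrite /W /B exprMn le_eqVlt; apply/orP; left; apply/eqP; ring.
Qed.

Variables (lam1 lam2 : R).
Hypothesis bb : forall u n, u != fset0 -> (0 < n)%N ->
    (err_set mu (Hu u) (Qb n u) ^+ 2 <=
     (bb_bound tau c1 C lam1 lam2 n #|` u|)%:E)%E.

(** Separated from [bb_bound] because it is the factor not of power form in n; the error estimate
    asks only for a bound F on it that is uniform over the sets in use. *)
Definition log_factor (n k : nat) : R := if k == 1%N then 1 else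
    (1 + ln n.+1%:R / k.-1%:R `^ lam2) `^ (lam1 * k.-1%:R `^ lam2).

Lemma log_factor_ge0 n k : 0 <= log_factor n k.
Proof. by rewrite /log_factor; case: ifP => // _; exact: powR_ge0. Qed.

Lemma w_split u : w u = w u `^ (1 - lam0) * w u `^ lam0.
Proof.
have [->|wu] := eqVneq (w u) 0.
  by rewrite !powR0 ?mul0r// gt_eqF// subr_gt0.
by rewrite -powRD ?wu ?implybT// subrK powRr1.
Qed.

Variable Hg : rkhs (@Kweighted _ _ _ K w).
Variable e : nat -> {fset nat}.
Hypothesis be : bijective e.

(** The choice of n_u equalises the errors: n_u + 1 exceeds (cd_thr u / eps^2)^(1/(2 tau)), which
    bounds the squared block error by eps^2 F / (L w^lam0). For a skipped set, cd_thr u <= eps^2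
    bounds the initial squared error C_0^|u| <= C^|u| in the same way. Multiplied by w, these bounds
    are proportional to w^(1 - lam0), whose sum L cancels. *)
Lemma cd_term_le eps F u : 0 < eps -> 1 <= F -> u != fset0 ->
  (u \in cds eps -> log_factor (cdn eps u) #|` u| <= F) ->
  w u * err2 mu K u (nodes c (QCD eps)) <= eps ^+ 2 * F / L * w u `^ (1 - lam0).
Proof.
move=> e0 F1 u0 uF; have e2 : 0 < eps ^+ 2 by rewrite exprn_gt0.
have fin := cd_sets_finite e0.
rewrite (err2_cd_alg muE mK H diag_fin Hu Kcc Qb fin u0).
have Ck : 0 < C ^+ #|` u| by rewrite exprn_gt0.
have thrE : w u `^ lam0 = thr u / (L * c1 * C ^+ #|` u|).
  by rewrite /cd_thr; field; rewrite !gt_eqF.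
case: ifPn => ucd; last first.
  have tle : thr u <= eps ^+ 2 by rewrite leNgt -cd_setsP.
  apply: (@le_trans _ _ (w u * C ^+ #|` u|)).
    by rewrite ler_wpM2l// lerXn2r ?nnegrE// ltW.
  rewrite (_ : w u * C ^+ #|` u| = thr u / (L * c1) * w u `^ (1 - lam0)); last first.
    by rewrite {1}w_split thrE; field; rewrite !gt_eqF.
  rewrite ler_wpM2r ?powR_ge0//.
  rewrite ler_pdivrMr ?mulr_gt0// (_ : _ * (L * c1) = eps ^+ 2 * (F * c1)); last first.
    by field; rewrite gt_eqF.
  apply: (le_trans tle); rewrite ler_peMr ?(ltW e2)//.
  by rewrite -[leLHS]mulr1 ler_pM.
have n0 : (0 < cdn eps u)%N by move: ucd; rewrite inE => -[].
have := cd_n_bounds e0 ucd; move: (uF ucd) n0; set n := cdn eps u => nF n0 /andP[_ nb].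
have t0 : 0 < thr u by apply: lt_trans e2 _; rewrite -cd_setsP.
have nt : thr u * eps ^- 2 <= n.+1%:R `^ (2 * tau).
  have -> : thr u * eps ^- 2 = ((thr u * eps ^- 2) `^ (2 * tau)^-1) `^ (2 * tau).
    rewrite -powRrM mulVf ?gt_eqF ?mulr_gt0// powRr1//.
    by rewrite mulr_ge0 ?invr_ge0 ?(ltW t0) ?(ltW e2).
  by rewrite ge0_ler_powR ?nnegrE ?powR_ge0 ?mulr_ge0 ?(ltW tau_gt0) ?(ltW nb).
have n1 : 0 < n.+1%:R `^ (2 * tau) :> R by rewrite powR_gt0.
have bl : err2 mu K u (Qb n u) <= c1 * C ^+ #|` u| / n.+1%:R `^ (2 * tau) * F.
  apply: (@le_trans _ _ (bb_bound tau c1 C lam1 lam2 n #|` u|)).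
    apply: (err2_le muE mK H diag_fin); last exact: bb.
    rewrite /bb_bound -/(log_factor n #|` u|) mulr_ge0 ?log_factor_ge0//.
    by rewrite divr_ge0 ?powR_ge0// mulr_ge0 ?(ltW c1_gt0) ?(ltW Ck).
  rewrite /bb_bound -/(log_factor n #|` u|) ler_wpM2l//.
  by rewrite divr_ge0 ?powR_ge0// mulr_ge0 ?(ltW c1_gt0) ?(ltW Ck).
apply: (le_trans (ler_wpM2l (w0 u) bl)).
rewrite (_ : w u * _ = thr u / n.+1%:R `^ (2 * tau) * (F / L) * w u `^ (1 - lam0)); last first.
  by rewrite {1}w_split thrE; field; rewrite !gt_eqF.
rewrite ler_wpM2r ?powR_ge0//.
rewrite mulrA ler_wpM2r ?invr_ge0 ?(ltW L_gt0)// ler_wpM2r ?(le_trans ler01)//.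
rewrite ler_pdivrMr// -ler_pdivrMl// mulrC.
exact: nt.
Qed.

Lemma cd_error eps F : 0 < eps -> 1 <= F ->
  (forall u, u \in cds eps -> log_factor (cdn eps u) #|` u| <= F) ->
  err2_gamma mu H Kcc w0 (QCD eps) <= eps ^+ 2 * F.
Proof.
move=> e0 F1 uF; have fin := cd_sets_finite e0.
have B0 : 0 <= eps ^+ 2 * F by rewrite mulr_ge0 ?exprn_ge0 ?(ltW e0)// (le_trans ler01).
apply: (err2_gamma_le muE mK H diag_fin Hu Kcc w0 w_fin be) => n.
(* The empty set has error 0 and does not occur in the sum L, so its term is set to 0. *)
pose f u := if u == fset0 then 0 else w u `^ (1 - lam0).
have f0 u : 0 <= f u by rewrite /f; case: ifP => // _; exact: powR_ge0.
have fL : (\esum_(u in setT) (f u)%:E)%E = (\esum_(u in [set u : {fset nat} | u != fset0])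
          (w u `^ (1 - lam0))%:E)%E.
  rewrite [RHS]esum_mkcond; apply: eq_esum => u _; rewrite /f.
  case: ifPn => [/eqP ->|u0]; last by rewrite mem_set.
  by rewrite memNset//= eqxx.
have fF : (\esum_(u in setT) (f u)%:E < +oo)%E by rewrite fL.
apply: (@le_trans _ _ (\sum_(i < n) eps ^+ 2 * F / L * f (e i))).
  apply: ler_sum => i _; have [ei|ei] := eqVneq (e i) fset0.
    by rewrite ei err2_cd_alg0// /f eqxx !mulr0.
  by rewrite /f (negbTE ei); apply: cd_term_le => // ucd; exact: uF.
rewrite -mulr_sumr -[leRHS](divfK (lt0r_neq0 L_gt0)) ler_wpM2l//.
  by rewrite divr_ge0// ltW.
have us : uniq [seq e i | i <- iota 0 n] by rewrite map_inj_uniq ?iota_uniq//; exact: bij_inj.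
have := sum_le_esum f0 fF us; rewrite fL -/L big_map => /(le_trans _); apply.
by rewrite -(big_mkord xpredT (fun i => f (e i))) /index_iota subn0.
Qed.

End ChangingDimensionError.

Lemma nat_bounded_max (A : set nat) (m : nat) : A !=set0 -> (forall l, A l -> (l <= m)%N) ->
  exists n, is_max A n.
Proof.
move=> [a Aa] Am.
have exA : exists n, `[< A n >] by exists a; apply/asboolP.
have ubA n : `[< A n >] -> (n <= m)%N by move=> /asboolP; exact: Am.
case: (ex_maxnP exA ubA) => n /asboolP An nmax; exists n; split => // l Al.
by apply: nmax; apply/asboolP.
Qed.

(** From 1 + y <= (1 + sqrt y)^2. The square root is what later makes the logarithmic factors
    subpolynomial in 1 / eps. *)
Lemma ln1D_le_sqrt (R : realType) (y : R) : 0 <= y -> ln (1 + y) <= 2 * Num.sqrt y.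
Proof.
move=> y0; have s0 := sqrtr_ge0 y.
apply: (@le_trans _ _ (2 * ln (1 + Num.sqrt y))); last first.
  by rewrite ler_wpM2l// le_ln1Dx// (lt_le_trans _ s0)// oppr_lt0.
rewrite (mulr_natl (ln _) 2) -lnXn ?ltr_pwDl// ler_ln ?posrE ?exprn_gt0 ?ltr_pwDl//.
by rewrite -{1}(sqr_sqrtr y0) sqrrD expr1n mul1r; lra.
Qed.

(** * Error, cost and tractability for POD weights *)

Section PodTheorem.
Context {R : realType} {d : measure_display} {T : measurableType d}.
Variables (rho : probability T R) (mu : probability (seqspace T) R).
Hypothesis muE : infinite_product rho mu.
Variable K : T -> T -> R.
Hypothesis mK : measurable_fun setT (fun q : T * T => K q.1 q.2).
Variable H : rkhs K.
Hypothesis diag_fin : (diag_mean K rho < +oo)%E.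
Hypothesis C0_gt0 : 0 < double_mean K rho.
Variable Hu : forall u, rkhs (Kset K u).
Variable c : T.
Hypothesis Kcc : K c c = 0.
Variables Gam gam : nat -> R.
Hypothesis gam_ge0 : forall j, 0 <= gam j.
Hypothesis gam_noninc : forall i j, (i <= j)%N -> gam j <= gam i.
Hypothesis Gam0 : Gam 0%N = 1.
Hypothesis Gam1 : Gam 1%N = 1.
Hypothesis Gam_ge0 : forall k, 0 <= Gam k.
Local Notation w := (pod Gam gam).
Hypothesis w_fin : (\esum_(u in [set: {fset nat}])
     (w u * fine (diag_mean K rho) ^+ #|` u|)%:E < +oo)%E.
Hypothesis nontrivial : exists2 u, u != fset0 & active_sets w u.
Variable Hg : rkhs (@Kweighted _ _ _ K w).
Variable cst : nat -> R.
Hypothesis cst_ge1 : forall k, 1 <= cst k.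
Hypothesis cst_mono : forall k l, (k <= l)%N -> cst k <= cst l.
Local Notation dec1 := (decay K rho w (Some 1%N)).
Local Notation dec := (decay K rho w None).
Hypothesis dec1_gt1 : (1 < dec1)%E.
Hypothesis growth : exists q, (q%:E < dec1)%E /\
     exists2 Cq, 0 < Cq & forall k, (0 < k)%N -> Gam k <= Cq * (k`!)%:R `^ q.

Let w0 : forall u, 0 <= w u. Proof. exact: pod_ge0. Qed.

Lemma gam0_gt0 : 0 < gam 0%N.
Proof.
have [u u0 wu] := nontrivial; have [j ju] := fset0Pn _ u0.
rewrite lt_neqAle eq_sym gam_ge0 andbT; apply/eqP => g0.
move: wu; rewrite /active_sets /= /pod (big_fsetD1 j)//=.
have -> : gam j = 0 by apply/eqP; rewrite eq_le gam_ge0 -g0 gam_noninc.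
by rewrite mul0r mulr0 ltxx.
Qed.

Lemma comp_unr_le Q eps : admissible c Q ->
  (err_gamma mu c Hg Q <= eps%:E)%E ->
  (comp_unr mu c Hg cst eps <= (cost_unr cst Q)%:E)%E.
Proof. by move=> aQ eQ; apply: ereal_inf_lbound; exists Q. Qed.

Lemma comp_unr_noninc eps eps' : eps <= eps' ->
  (comp_unr mu c Hg cst eps' <= comp_unr mu c Hg cst eps)%E.
Proof.
move=> ee; apply: le_ereal_inf => _ [Q [aQ eQ] <-]; exists Q => //; split => //.
by apply: le_trans eQ _; rewrite lee_fin.
Qed.

(* The zero algorithm handles large eps, where C * eps ^ -p tends to 0. *)
Lemma tract_exponent_of_small p eps0 k : 0 <= p -> 0 < eps0 -> 0 <= k ->
  (forall eps, 0 < eps -> eps <= eps0 ->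
     (comp_unr mu c Hg cst eps <= (k * eps `^ (- p))%:E)%E) ->
  tract_exponents mu c Hg cst p.
Proof.
move=> p0 eps00 k0 small; split => //.
have [e be] := fset_nat_enum.
have errE := err_gammaE muE mK H diag_fin Hu Kcc w0 w_fin Hg be [::].
set ei := Num.sqrt _ in errE; have ei0 : 0 <= ei by exact: sqrtr_ge0.
(* X serves the range eps0 < eps < ei, where the complexity is at most that at eps0 and (1 + ei) /
   eps >= 1. *)
pose X := (1 + ei) / eps0; have X0 : 0 < X by rewrite divr_gt0// ltr_pwDl.
exists (k * (1 + X `^ p)) => [|eps e0]; first by rewrite mulr_ge0// addr_ge0// powR_ge0.
have [ee|ee] := leP eps eps0.
  apply: le_trans (small _ e0 ee) _; rewrite lee_fin ler_wpM2r ?powR_ge0//.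
  by rewrite ler_peMr// lerDl powR_ge0.
have [ie|ie] := leP ei eps.
  apply: (@le_trans _ _ (cost_unr cst [::])%:E).
    by apply: comp_unr_le => //; rewrite errE lee_fin.
  rewrite /cost_unr big_nil lee_fin mulr_ge0 ?powR_ge0// mulr_ge0//.
  by rewrite addr_ge0// powR_ge0.
apply: le_trans (comp_unr_noninc (ltW ee)) _.
apply: le_trans (small _ eps00 (lexx _)) _; rewrite lee_fin -mulrA ler_wpM2l//.
apply: (@le_trans _ _ (X `^ p * eps `^ (- p))); last first.
  by rewrite ler_wpM2r ?powR_ge0// lerDr.
rewrite /X powRM ?invr_ge0 ?(ltW eps00)//; last by rewrite addr_ge0.
rewrite -(powR_inv1 (ltW eps00)) -powRrM mulN1r mulrAC ler_peMl ?powR_ge0//.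
rewrite powRN ler_pdivlMr ?powR_gt0// mul1r ge0_ler_powR ?nnegrE ?(ltW e0) ?addr_ge0//.
by rewrite (le_trans (ltW ie))// lerDr.
Qed.

Section Algorithm.
Variables (lam0 tau c1 C lam1 lam2 : R) (Qb : @bb_family R d T).
Hypothesis lam0_gt0 : 0 < lam0.
Hypothesis lam0_lt : (lam0%:E < 1 - dec^-1)%E.
Hypothesis tau_gt0 : 0 < tau.
Hypothesis tau_lt : (tau%:E < lam0%:E * dec / 2%:E)%E.
Hypothesis Qb_cond : building_blocks rho mu Hu tau c1 C lam1 lam2 Qb.

Let decE : dec = dec1.
Proof. exact: decayE. Qed.

Let c1_ge1 : 1 <= c1. Proof. by case: Qb_cond => -[]. Qed.
Let C_ge : double_mean K rho <= C. Proof. by case: Qb_cond => -[]. Qed.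
Let lam1_ge0 : 0 <= lam1. Proof. by case: Qb_cond => -[]. Qed.
Let lam2_01 : 0 <= lam2 <= 1. Proof. by case: Qb_cond => -[]. Qed.
Let bb : forall u n, u != fset0 -> (0 < n)%N ->
    (err_set mu (Hu u) (Qb n u) ^+ 2 <=
     (bb_bound tau c1 C lam1 lam2 n #|` u|)%:E)%E.
Proof. by case: Qb_cond. Qed.
Let c1_gt0 : 0 < c1. Proof. exact: lt_le_trans c1_ge1. Qed.
Let C_gt0 : 0 < C. Proof. exact: lt_le_trans C_ge. Qed.

Let lam0_lt1 : lam0 < 1.
Proof.
have := dec1_gt1; move: lam0_lt; rewrite decE; case: dec1 => [r||//].
  rewrite !lte_fin inver => + r1; rewrite gt_eqF ?(lt_trans ltr01)// -EFinB lte_fin.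
  move/lt_trans; apply; rewrite ltrBlDr ltrDl invr_gt0; lra.
by rewrite invey sube0 lte_fin.
Qed.

(** This and [tau_dec] are the conditions of [decay_summable] for the exponents 1 - lam0, which
    gives [L_fin], and lam0 / (2 tau), which gives [S_fin]. *)
Let lam0_dec : ((1 - lam0)^-1%:E < dec1)%E.
Proof.
have l1 : 0 < 1 - lam0 by rewrite subr_gt0.
have := dec1_gt1; move: lam0_lt; rewrite decE; case: dec1 => [r||//]; last by move=> _ _; rewrite ltry.
rewrite !lte_fin inver => + r1; rewrite gt_eqF ?(lt_trans ltr01)// -EFinB lte_fin => h.
have r0 : 0 < r by lra.
rewrite -[ltRHS]invrK ltf_pV2 ?posrE ?invr_gt0//; lra.
Qed.

Let tau_dec : ((lam0 / (2 * tau))^-1%:E < dec1)%E.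
Proof.
have := dec1_gt1; move: tau_lt; rewrite decE; case: dec1 => [r||//]; last by move=> _ _; rewrite ltry.
rewrite inver pnatr_eq0/= -!EFinM !lte_fin => h r1.
by rewrite invf_div ltr_pdivrMr//; lra.
Qed.

Let L_fin : (\esum_(u in [set u : {fset nat} | u != fset0])
          (w u `^ (1 - lam0))%:E < +oo)%E.
Proof.
have h := @decay_summable _ _ _ K rho C0_gt0 Gam gam gam_ge0 gam_noninc Gam0 Gam1
  Gam_ge0 growth (1 - lam0) 1 _ lam0_dec ler01.
apply: le_lt_trans (h _); last by rewrite subr_gt0.
rewrite esum_mkcond; apply: le_esum => u _; rewrite expr1n mulr1.
by case: ifP => // _; rewrite lee_fin powR_ge0.
Qed.

Let L_gt0 : 0 < Lsum w lam0.
Proof.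
rewrite /Lsum -lte_fin fineK; last first.
  by rewrite ge0_fin_numE// esum_ge0// => u _; rewrite lee_fin powR_ge0.
apply: (@lt_le_trans _ _ (w [fset 0%N]%fset `^ (1 - lam0))%:E).
  by rewrite lte_fin powR_gt0// pod1// gam0_gt0.
apply: esum_ge; exists [set [fset 0%N]%fset].
  split; first exact: finite_set1.
  by move=> _ -> /=; rewrite -cardfs_gt0 cardfs1.
by rewrite fsbig_set1.
Qed.

Let S_fin : forall B, 0 <= B -> (\esum_(u in setT)
   (w u `^ (lam0 / (2 * tau)) * B ^+ #|` u|)%:E < +oo)%E.
Proof.
move=> B B0; apply: (@decay_summable _ _ _ K rho) => //.
by rewrite divr_gt0// mulr_gt0.
Qed.

Local Notation cds := (cd_sets w lam0 tau c1 C).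
Local Notation cdn := (cd_n w lam0 tau c1 C).
Local Notation dims := (cd_dims w lam0 c1 C).
Local Notation QCD := (cd_alg w c lam0 tau c1 C Qb).
Local Notation dCD := (cd_dim w lam0 c1 C).

Lemma pod_cd_sets_finite eps : 0 < eps -> finite_set (cds eps).
Proof. exact: (cd_sets_finite C0_gt0 tau_gt0 c1_ge1 C_ge L_gt0 S_fin). Qed.

Lemma pod_cd_dims_bound : exists2 M, 0 <= M &
  \forall eps \near (0 : R)^'+, forall l, dims eps l ->
    l%:R <= M * (ln eps^-1 / ln (ln eps^-1)).
Proof.
have [q [qdec [Cq Cq0 GC]]] := growth.
have [p xp pdec] : exists2 p, Num.max q 0 < p & (p%:E < dec1)%E.
  apply: ereal_real_between; rewrite EFin_max /maxe; case: ifP => // _.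
  by apply: lt_trans dec1_gt1; rewrite lte_fin.
move: xp; rewrite gt_max => /andP[qp p0].
have [A A0 gA] := decay1_bound C0_gt0 gam_ge0 gam_noninc Gam1 Gam_ge0 (ltW p0) pdec.
apply: (@cd_dims_bound _ Gam gam gam_ge0 Gam_ge0 (Num.max 1 A) p q Cq) => //.
- by rewrite le_max lexx.
- move=> j; apply: (le_trans (gA j)); rewrite ler_wpM2r ?powR_ge0//.
  by rewrite le_max lexx orbT.
Qed.

Lemma cd_dims_nonempty : \forall eps \near (0 : R)^'+, dims eps 1%N.
Proof.
set t := c1 * C ^+ 1 * Lsum w lam0 * w [fset j in iota 0 1]%fset `^ lam0.
have t0 : 0 < t.
  rewrite !mulr_gt0 ?exprn_gt0// powR_gt0//.
  by rewrite /pod card_first prod_first big_ord1 Gam1 mul1r gam0_gt0.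
near=> eps; split => //=; rewrite -/t.
have e0 : 0 < eps by [].
have e1 : eps <= 1 by near: eps; exact: nbhs_right_le.
have et : eps < t by near: eps; exact: nbhs_right_lt.
by apply: le_lt_trans et; rewrite expr2 ler_piMr// ltW.
Unshelve. all: end_near.
Qed.

Lemma cd_dims_max : \forall eps \near (0 : R)^'+, exists m, is_max (dims eps) m.
Proof.
have [M M0 MP] := pod_cd_dims_bound.
near=> eps; apply: (@nat_bounded_max _ (Num.truncn (M * (ln eps^-1 / ln (ln eps^-1))))).
  by exists 1%N; near: eps; exact: cd_dims_nonempty.
move=> l ld.
have h : l%:R <= M * (ln eps^-1 / ln (ln eps^-1)).
  by move: l ld; near: eps; exact: MP.
by rewrite truncn_ge_nat// (le_trans _ h).
Unshelve. all: end_near.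
Qed.

Lemma cd_dimP : \forall eps \near (0 : R)^'+, is_max (dims eps) (dCD eps).
Proof.
near=> eps; apply: (@xgetPex _ 0%N [set m | is_max (dims eps) m]).
by near: eps; exact: cd_dims_max.
Unshelve. all: end_near.
Qed.

(** Among sets of one size the initial segment has the largest weight, so a set u in use puts |u|
    into [cd_dims]. *)
Lemma cd_sets_card eps u : 0 < eps -> is_max (dims eps) (dCD eps) ->
  u \in cds eps -> (0 < #|` u| <= dCD eps)%N.
Proof.
move=> e0 [_ dmax] ucd.
have u0 : u != fset0 by move: ucd; rewrite inE => -[].
have k0 : (0 < #|` u|)%N by rewrite cardfs_gt0.
rewrite k0; apply: dmax; split => //=.
move: ucd; rewrite (cd_setsP C0_gt0 tau_gt0 c1_ge1 C_ge L_gt0 e0 u0) => /lt_le_trans; apply.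
rewrite /cd_thr (_ : _ * _ * _ * _ = c1 * C ^+ #|` u| * Lsum w lam0 * w u `^ lam0); last by ring.
rewrite ler_wpM2l ?mulr_ge0 ?exprn_ge0 ?(ltW c1_gt0) ?(ltW C_gt0) ?(ltW L_gt0)//.
rewrite ge0_ler_powR ?nnegrE ?(ltW lam0_gt0)//.
exact: pod_le_first.
Qed.

(** The thresholds are bounded in u, so n_u is at most a constant times a fixed power of 1 / eps,
    uniformly over u. *)
Lemma cd_n_log : exists2 A, 0 <= A & \forall eps \near (0 : R)^'+,
  forall u, u \in cds eps -> ln (cdn eps u).+1%:R <= A * ln eps^-1.
Proof.
have [t t0 tP] := cd_thr_bounded C0_gt0 tau_gt0 c1_ge1 C_ge L_gt0 S_fin.
exists (ln 2 + `|ln t| / (2 * tau) + tau^-1).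
  rewrite !addr_ge0 ?ln_ge0 ?ler1n// ?invr_ge0 ?(ltW tau_gt0)//.
  by rewrite divr_ge0// mulr_ge0// ltW.
near=> eps => u ucd; have e0 : 0 < eps by [].
have E1 : 1 <= ln eps^-1 by near: eps; exact: near_right0_ln.
have /andP[nle _] := cd_n_bounds C0_gt0 tau_gt0 c1_ge1 C_ge L_gt0 e0 ucd.
have n0 : (0 < cdn eps u)%N by move: ucd; rewrite inE => -[].
have i0 : 0 < eps^-1 by rewrite invr_gt0.
have te : 0 < t * eps ^- 2 by rewrite -exprVn mulr_gt0 ?exprn_gt0.
have nt : (cdn eps u)%:R <= (t * eps ^- 2) `^ (2 * tau)^-1.
  have em0 : 0 < eps ^- 2 by rewrite invr_gt0 exprn_gt0.
  have th0 := cd_thr_ge0 C0_gt0 c1_ge1 C_ge L_gt0 u.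
  apply: (le_trans nle); apply: ge0_ler_powR.
  - by rewrite invr_ge0 mulr_ge0// ltW.
  - by rewrite nnegrE mulr_ge0// ltW.
  - by rewrite nnegrE ltW.
  - by rewrite ler_wpM2r// ltW.
have n2 : (cdn eps u).+1%:R <= 2 * (t * eps ^- 2) `^ (2 * tau)^-1.
  apply: (@le_trans _ _ (2 * (cdn eps u)%:R)); last by rewrite ler_wpM2l.
  by rewrite -natrM ler_nat mul2n -addnn -addn1 leq_add2l.
have : ln (cdn eps u).+1%:R <= ln (2 * (t * eps ^- 2) `^ (2 * tau)^-1).
  by rewrite ler_ln ?posrE// mulr_gt0// powR_gt0.
have -> : ln (2 * (t * eps ^- 2) `^ (2 * tau)^-1) =
    ln 2 + (ln t + 2 * ln eps^-1) / (2 * tau).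
  rewrite lnM ?posrE ?powR_gt0// ln_powR lnM ?posrE// -?exprVn ?exprn_gt0//.
  by rewrite lnXn// -[ln _ *+ 2]mulr_natl; ring.
move=> /le_trans; apply.
have -> : (ln t + 2 * ln eps^-1) / (2 * tau) = ln t / (2 * tau) + tau^-1 * ln eps^-1.
  by field; rewrite gt_eqF.
rewrite [leRHS]mulrDl addrA lerD2r [leRHS]mulrDl lerD//.
  by rewrite ler_peMr// ln_ge0// ler1n.
apply: (@le_trans _ _ (`|ln t| / (2 * tau))).
  by rewrite ler_wpM2r ?ler_norm// invr_ge0 mulr_ge0// ltW.
by rewrite ler_peMr// divr_ge0// mulr_ge0// ltW.
Unshelve. all: end_near.
Qed.

(** With x = (k-1)^lam2 and a = ln(n+1), the bound ln(1 + a/x) <= 2 sqrt(a/x) makes the logarithm of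
    the factor at most 2 lam1 sqrt(x a), and x <= D because lam2 <= 1. For D = o(E) the result is
    exp(o(E)). *)
Lemma log_factor_le (n k D : nat) (E : R) : (0 < k <= D)%N -> ln n.+1%:R <= E ->
  log_factor lam1 lam2 n k <= expR (2 * lam1 * Num.sqrt (D%:R * E)).
Proof.
move=> /andP[k0 kD] nE; rewrite /log_factor.
have s0 := sqrtr_ge0 (D%:R * E); have [l20 l21] := andP lam2_01.
have e1 : 1 <= expR (2 * lam1 * Num.sqrt (D%:R * E)).
  by rewrite -expR0 ler_expR !mulr_ge0.
case: ifPn => // k1.
have kk : 1 <= k.-1%:R :> R by rewrite ler1n; case: (k) k0 k1 => [|[]].
set x := k.-1%:R `^ lam2; set a := ln n.+1%:R in nE *.
have x1 : 1 <= x.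
  rewrite /x; apply: (@le_trans _ _ (1 `^ lam2)); first by rewrite powR1.
  by rewrite ge0_ler_powR ?nnegrE// (le_trans ler01).
have x0 : 0 < x by apply: lt_le_trans x1.
have xD : x <= D%:R.
  apply: (@le_trans _ _ k.-1%:R); first exact: ler1_powR.
  by rewrite ler_nat (leq_trans (leq_pred k)).
have a0 : 0 <= a by rewrite ln_ge0// ler1n.
have ax : 0 <= a / x by rewrite divr_ge0// ltW.
have p1 : 0 < 1 + a / x by rewrite ltr_pwDl.
rewrite /powR (gt_eqF p1) ler_expR.
apply: (@le_trans _ _ (lam1 * x * (2 * Num.sqrt (a / x)))).
  by rewrite ler_wpM2l ?ln1D_le_sqrt// mulr_ge0// ltW.
rewrite (_ : lam1 * x * _ = 2 * lam1 * (x * Num.sqrt (a / x))); last by ring.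
rewrite ler_wpM2l ?mulr_ge0//.
have -> : x * Num.sqrt (a / x) = Num.sqrt (x * a).
  rewrite -{1}(ger0_norm (ltW x0)) -sqrtr_sqr -sqrtrM ?sqr_ge0//.
  by congr Num.sqrt; field; rewrite gt_eqF.
by rewrite ler_wsqrtr// ler_pM// ltW.
Qed.

Lemma near_ln_ln_ge (B : R) : \forall eps \near (0 : R)^'+, B <= ln (ln eps^-1).
Proof.
near=> eps.
have EB : expR B <= ln eps^-1 by near: eps; exact: near_right0_ln.
have E0 := lt_le_trans (expR_gt0 B) EB.
by rewrite -[leLHS]expRK ler_ln ?posrE ?expR_gt0.
Unshelve. all: end_near.
Qed.

Lemma cd_dim_ratio_small (eta : R) : 0 < eta -> \forall eps \near (0 : R)^'+,
  (dCD eps)%:R <= eta * ln eps^-1.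
Proof.
move=> eta0; have [M M0 MP] := pod_cd_dims_bound.
near=> eps.
have dM : is_max (dims eps) (dCD eps) by near: eps; exact: cd_dimP.
have h : (dCD eps)%:R <= M * (ln eps^-1 / ln (ln eps^-1)).
  by move: (dCD eps) (dM.1); near: eps; exact: MP.
have E1 : 1 <= ln eps^-1 by near: eps; exact: near_right0_ln.
have E2 : Num.max 1 (M / eta) <= ln (ln eps^-1) by near: eps; exact: near_ln_ln_ge.
move: E2; rewrite ge_max => /andP[E2 E3].
have l0 : 0 < ln (ln eps^-1) by apply: lt_le_trans E2.
apply: (le_trans h); rewrite mulrCA mulrC ler_wpM2r ?(le_trans ler01)//.
by rewrite ler_pdivrMr// mulrC -ler_pdivrMr.
Unshelve. all: end_near.
Qed.

Lemma cd_error_asymptotic : exists2 h : R -> R, h eps @[eps --> 0^'+] --> 0 &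
  \forall eps \near 0^'+,
    (err_gamma mu c Hg (QCD eps) <= (eps `^ (1 - h eps))%:E)%E.
Proof.
have [e be] := fset_nat_enum.
have [A A0 AP] := cd_n_log.
(* All logarithmic factors are at most exp(2 g), so the error is at most eps exp(g) = eps^(1 - g /
   ln(1/eps)). *)
pose g eps := lam1 * Num.sqrt ((dCD eps)%:R * (A * ln eps^-1)).
exists (fun eps => g eps / ln eps^-1).
  apply/cvgrPdist_le => eta eta0.
  (* zeta solves sqrt(zeta (A + 1)) = eta / (lam1 + 1). *)
  pose zeta := (eta / (lam1 + 1)) ^+ 2 / (A + 1).
  have l1 : 0 < lam1 + 1 by rewrite ltr_wpDl.
  have z0 : 0 < zeta by rewrite divr_gt0 ?exprn_gt0 ?divr_gt0// ltr_wpDl.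
  near=> eps.
  have E1 : 1 <= ln eps^-1 by near: eps; exact: near_right0_ln.
  have E0 : 0 < ln eps^-1 by apply: lt_le_trans E1.
  have dz : (dCD eps)%:R <= zeta * ln eps^-1 by near: eps; exact: cd_dim_ratio_small.
  rewrite sub0r normrN ger0_norm ?divr_ge0 ?mulr_ge0 ?sqrtr_ge0 ?(ltW E0)//.
  rewrite ler_pdivrMr// /g.
  have sle : Num.sqrt ((dCD eps)%:R * (A * ln eps^-1)) <= eta / (lam1 + 1) * ln eps^-1.
    have r0 : 0 <= eta / (lam1 + 1) * ln eps^-1.
      by rewrite mulr_ge0 ?divr_ge0 ?(ltW eta0) ?(ltW l1) ?(ltW E0).
    rewrite -(ger0_norm r0) -sqrtr_sqr ler_wsqrtr//.
    apply: (@le_trans _ _ (zeta * ln eps^-1 * ((A + 1) * ln eps^-1))).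
      apply: ler_pM => //; first by rewrite mulr_ge0// ltW.
      by rewrite ler_wpM2r ?(ltW E0)// lerDl.
    rewrite le_eqVlt; apply/orP; left; apply/eqP; rewrite /zeta.
    by field; rewrite !gt_eqF// ltr_wpDl.
  apply: (le_trans (ler_wpM2l lam1_ge0 sle)).
  rewrite mulrA ler_wpM2r ?(ltW E0)// mulrCA ler_piMr ?(ltW eta0)//.
  by rewrite ler_pdivrMr// mul1r lerDl.
near=> eps.
have e0 : 0 < eps by [].
have E1 : 1 <= ln eps^-1 by near: eps; exact: near_right0_ln.
have E0 : 0 < ln eps^-1 by apply: lt_le_trans E1.
have dM : is_max (dims eps) (dCD eps) by near: eps; exact: cd_dimP.
have nlog : forall u, u \in cds eps -> ln (cdn eps u).+1%:R <= A * ln eps^-1.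
  by near: eps; exact: AP.
have g0 : 0 <= g eps by rewrite mulr_ge0 ?sqrtr_ge0.
rewrite (err_gammaE muE mK H diag_fin Hu Kcc w0 w_fin Hg be) lee_fin.
have F1 : 1 <= expR (2 * g eps) by rewrite -expR0 ler_expR mulr_ge0.
have le2 := @cd_error _ _ _ rho mu muE K mK H diag_fin C0_gt0 Hu c Kcc w w0 w_fin
  lam0 tau c1 C Qb lam0_gt0 lam0_lt1 tau_gt0 c1_ge1 C_ge L_fin L_gt0 S_fin lam1 lam2
  bb e be eps (expR (2 * g eps)) e0 F1.
apply: (@le_trans _ _ (Num.sqrt (eps ^+ 2 * expR (2 * g eps)))).
  rewrite ler_wsqrtr// le2// => u ucd.
  rewrite /g mulrA; apply: log_factor_le; last exact: nlog.
  exact: cd_sets_card.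
rewrite expRM_natl -exprMn sqrtr_sqr ger0_norm; last first.
  by rewrite mulr_ge0 ?expR_ge0// ltW.
rewrite powRB ?(gt_eqF e0) ?implybT// powRr1 ?(ltW e0)// ler_wpM2l ?(ltW e0)//.
rewrite -powRN /powR (gt_eqF e0) ler_expR mulNr -mulrN -lnV ?posrE//.
by rewrite divfK// gt_eqF.
Unshelve. all: end_near.
Qed.

Lemma cd_cost_bigO : (fun eps => cost_unr cst (QCD eps))
    =O_ (0^'+) (fun eps => cst (dCD eps) * eps `^ (- tau^-1)).
Proof.
have cst0 k : 0 <= cst k by apply: le_trans (cst_ge1 k).
have [M M0 MP] := @cd_cost _ _ _ rho K C0_gt0 c w lam0 tau c1 C Qb tau_gt0 c1_ge1 C_ge
  L_gt0 S_fin cst cst0 cst_mono.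
apply/eqO_exP; exists (1 + M); first by rewrite ltr_pwDl.
near=> eps.
have e0 : 0 < eps by [].
have e1 : eps <= 1 by near: eps; exact: nbhs_right_le.
have dM : is_max (dims eps) (dCD eps) by near: eps; exact: cd_dimP.
have cost0 : 0 <= cost_unr cst (QCD eps) by apply: sumr_ge0.
rewrite !ger0_norm ?mulr_ge0 ?powR_ge0//.
apply: (le_trans (MP eps (dCD eps) e0 _)).
  by move=> u ucd; have /andP[] := cd_sets_card e0 dM ucd.
rewrite mulrDl mul1r mulrA lerD//.
(* The one sample at the anchor costs cst 0, which is absorbed because eps^(-1/tau) >= 1 for eps <=
   1. *)
rewrite -[leLHS]mulr1; apply: ler_pM => //; first exact: cst_mono.
rewrite powRN -[leLHS]invr1 lef_pV2 ?posrE ?powR_gt0//.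
rewrite (_ : 1 = 1 `^ tau^-1); last by rewrite powR1.
by rewrite ge0_ler_powR ?nnegrE ?invr_ge0// ltW.
Unshelve. all: end_near.
Qed.

Lemma cd_dim_bigO : (fun eps => (dCD eps)%:R : R)
    =O_ (0^'+) (fun eps => ln eps^-1 / ln (ln eps^-1)).
Proof.
have [M M0 MP] := pod_cd_dims_bound.
apply/eqO_exP; exists (1 + M); first by rewrite ltr_pwDl.
near=> eps.
have dM : is_max (dims eps) (dCD eps) by near: eps; exact: cd_dimP.
have h : (dCD eps)%:R <= M * (ln eps^-1 / ln (ln eps^-1)).
  by move: (dCD eps) (dM.1); near: eps; exact: MP.
have E1 : 1 <= ln eps^-1 by near: eps; exact: near_right0_ln.
have r0 : 0 <= ln eps^-1 / ln (ln eps^-1).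
  by apply: divr_ge0; [exact: le_trans E1|exact: ln_ge0].
rewrite !ger0_norm//; apply: (le_trans h); rewrite ler_wpM2r//.
by rewrite lerDr.
Unshelve. all: end_near.
Qed.

Lemma cd_dim_littleo : (fun eps => (dCD eps)%:R : R) =o_ (0^'+) (fun eps => ln eps^-1).
Proof.
apply/eqoP => eta eta0; near=> eps.
have E1 : 1 <= ln eps^-1 by near: eps; exact: near_right0_ln.
rewrite !ger0_norm//; last exact: le_trans E1.
by near: eps; exact: cd_dim_ratio_small.
Unshelve. all: end_near.
Qed.

Lemma pod_tract_exponent (l p : R) : 0 <= l ->
  cst =O_ \oo (fun k => expR (l * k%:R)) -> tau^-1 < p ->
  tract_exponents mu c Hg cst p.
Proof.
move=> l0 cstO tp.
have ti : 0 < tau^-1 by rewrite invr_gt0.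
have p0 : 0 < p by apply: lt_trans tp.
have [k' k'0 cstE] : exists2 k', 0 < k' & forall k, cst k <= k' * expR (l * k%:R).
  have /eqO_exP [k' k'0 [N _ NP]] := cstO.
  (* Monotonicity transfers the asymptotic bound at N + k to every k, at the price of the factor
     exp(l N). *)
  exists (k' * expR (l * N%:R)); first by rewrite mulr_gt0// expR_gt0.
  move=> k; apply: (@le_trans _ _ (cst (N + k)%N)); first exact/cst_mono/leq_addl.
  have := NP (N + k)%N (leq_addr _ _); rewrite /= !ger0_norm ?expR_ge0//; last first.
    exact: le_trans (cst_ge1 _).
  by rewrite natrD mulrDr expRD mulrA.
(* eta shares out the gap between 1/tau and p: the error at x is at most x^(1 - eta), the factor
   cst(d) costs another x^(-eta), and (1/tau + eta) / (1 - eta) = p. *)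
pose eta := (p - tau^-1) / (1 + p).
have eta0 : 0 < eta by rewrite divr_gt0 ?subr_gt0// ltr_pwDl// ltW.
have eta1 : eta < 1 by rewrite ltr_pdivrMr ?ltr_pwDl// ?(ltW p0)//; lra.
have etaE : (tau^-1 + eta) / (1 - eta) = p.
  have h1 : eta * (1 + p) = p - tau^-1 by rewrite divfK// gt_eqF// ltr_pwDl// ltW.
  have -> : tau^-1 + eta = p * (1 - eta) by lra.
  by rewrite mulfK// subr_eq0 eq_sym lt_eqF.
have [h hcv herr] := cd_error_asymptotic.
have /eqO_exP [kc kc0 costP] := cd_cost_bigO.
have eta2 : 0 < eta / (l + 1) by rewrite divr_gt0// ltr_wpDl.
have hsmall : \forall eps \near (0 : R)^'+, h eps <= eta.
  move/cvgrPdist_le : hcv => /(_ _ eta0); apply: filterS => eps.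
  by rewrite sub0r normrN => /ler_normlP[].
have [delta d0 dP] : exists2 delta, 0 < delta & forall x, 0 < x -> x < delta ->
    [/\ x <= 1, h x <= eta, (err_gamma mu c Hg (QCD x) <= (x `^ (1 - h x))%:E)%E,
        `|cost_unr cst (QCD x)| <= kc * `|cst (dCD x) * x `^ (- tau^-1)| &
        (dCD x)%:R <= eta / (l + 1) * ln x^-1].
  have : \forall x \near (0 : R)^'+, [/\ x <= 1, h x <= eta,
        (err_gamma mu c Hg (QCD x) <= (x `^ (1 - h x))%:E)%E,
        `|cost_unr cst (QCD x)| <= kc * `|cst (dCD x) * x `^ (- tau^-1)| &
        (dCD x)%:R <= eta / (l + 1) * ln x^-1].
    near=> x; split.
    - by near: x; exact: nbhs_right_le.
    - by near: x; exact: hsmall.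
    - by near: x; exact: herr.
    - by near: x; exact: costP.
    - by near: x; exact: cd_dim_ratio_small.
  move=> /nbhs_ballP [delta /= d0 dP]; exists delta => // x x0 xd.
  by apply: dP => //; rewrite /ball /= sub0r normrN gtr0_norm.
have e1 : 0 < 1 - eta by rewrite subr_gt0.
pose r := (1 - eta)^-1.
have r0 : 0 < r by rewrite invr_gt0.
apply: (@tract_exponent_of_small p ((delta / 2) `^ (1 - eta)) (kc * k')).
- exact: ltW.
- by rewrite powR_gt0// divr_gt0.
- by rewrite mulr_ge0 ?ltW.
(* Running the algorithm at x = eps^(1/(1 - eta)) makes its error at most x^(1 - eta) = eps. *)
move=> eps eps0 epsd; pose x := eps `^ r.
have x0 : 0 < x by rewrite powR_gt0.
have xd : x < delta.
  apply: (@le_lt_trans _ _ (delta / 2)); last lra.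
  have -> : delta / 2 = ((delta / 2) `^ (1 - eta)) `^ r.
    by rewrite -powRrM divff ?gt_eqF// powRr1// divr_ge0// ltW.
  by rewrite ge0_ler_powR ?nnegrE ?powR_ge0 ?(ltW r0) ?(ltW eps0).
have [x1 hx errx costx dx] := dP x x0 xd.
apply: le_trans (comp_unr_le (cd_alg_admissible _ _ _ _ _ _ Qb x) _) _.
  apply: (le_trans errx); rewrite lee_fin.
  have -> : eps = x `^ (1 - eta) by rewrite /x -powRrM mulVf ?gt_eqF// powRr1// ltW.
  by rewrite ger_powR ?x0//; lra.
rewrite lee_fin; apply: (le_trans (ler_norm _)); apply: (le_trans costx).
rewrite -mulrA ler_wpM2l ?(ltW kc0)//.
rewrite ger0_norm ?mulr_ge0 ?powR_ge0 ?(le_trans ler01)//.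
have lx : 0 <= ln x^-1 by rewrite ln_ge0// -[leLHS]invr1 lef_pV2 ?posrE.
have cd : cst (dCD x) <= k' * x `^ (- eta).
  apply: (le_trans (cstE _)); rewrite ler_wpM2l ?(ltW k'0)//.
  rewrite /powR (gt_eqF x0) ler_expR.
  apply: (@le_trans _ _ (l * (eta / (l + 1) * ln x^-1))); first by rewrite ler_wpM2l.
  rewrite lnV ?posrE// mulNr -mulrN -lnV ?posrE// mulrA ler_wpM2r//.
  rewrite mulrCA ler_piMr ?(ltW eta0)// ler_pdivrMr ?ltr_wpDl//; lra.
apply: (le_trans (ler_wpM2r (powR_ge0 _ _) cd)); rewrite -mulrA ler_wpM2l ?(ltW k'0)//.
rewrite -powRD; last by rewrite (gt_eqF x0) implybT.
rewrite /x -powRrM (_ : r * (- eta - tau^-1) = - p)// -etaE /r.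
by field; rewrite !gt_eqF.
Unshelve. all: end_near.
Qed.

Lemma p_unr_le : (exists2 l : R, 0 <= l & cst =O_ \oo (fun k => expR (l * k%:R))) ->
  strongly_tractable mu c Hg cst /\ (p_unr mu c Hg cst <= (tau^-1)%:E)%E.
Proof.
move=> [l l0 cstO]; split.
  by exists (tau^-1 + 1); apply: (pod_tract_exponent l0 cstO); rewrite ltrDl.
apply/lee_addgt0Pr => eps eps0; rewrite -EFinD.
apply: ereal_inf_lbound; exists (tau^-1 + eps) => //.
by apply: (pod_tract_exponent l0 cstO); rewrite ltrDl.
Qed.

End Algorithm.
End PodTheorem.

(** * Univariate integration as the summand of the first coordinate *)

Section UnivariateTransfer.
Context {R : realType} {d : measure_display} {T : measurableType d}.
Variables (rho : probability T R) (mu : probability (seqspace T) R).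
Hypothesis muE : infinite_product rho mu.
Variable K : T -> T -> R.
Hypothesis mK : measurable_fun setT (fun q : T * T => K q.1 q.2).
Variable H : rkhs K.
Hypothesis diag_fin : (diag_mean K rho < +oo)%E.
Variable Hu : forall u, rkhs (Kset K u).

Let mKs x := measurable_kernel_section mK x.
Let iK := diag_integrable mK H diag_fin.

Lemma quad_diff_coord0 (s : seq (R * seqspace T)) (g : T -> R) : carrier H g ->
  quad_diff mu setT id s (fun x => g (x 0%N)) =
  quad_diff rho setT id [seq (q.1, q.2 0%N) | q <- s] g.
Proof.
move=> Hf; rewrite /quad_diff /quad big_map; congr (_ - _).
have ig := carrier_integrable (p := id) measurableT mKs iK Hf.
have [_] := @prod_fset_integrable _ _ _ rho mu muE [fset 0%N]%fset (fun _ => g) (fun _ => ig).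
rewrite big_seq_fset1 => <-; apply: eq_Rintegral => x _; by rewrite big_seq_fset1.
Qed.

Lemma err2_coord0 (s : seq (R * seqspace T)) :
  err2 mu K [fset 0%N]%fset s =
  quad_diff2 (k := K) rho setT id [seq (q.1, q.2 0%N) | q <- s].
Proof.
have [Hh _] := quad_diff_representer (p := id) measurableT H mKs iK
  [seq (q.1, q.2 0%N) | q <- s].
rewrite /err2 /quad_diff2 -(quad_diff_coord0 _ Hh); congr (quad_diff mu setT id s _).
apply/funext => x; rewrite -quad_diff_coord0; last exact: kernel_in.
congr (quad_diff mu setT id s _); apply/funext => y.
by rewrite /Kset big_seq_fset1.
Qed.

Lemma min_err_le (s : seq (R * seqspace T)) n : (size s <= n)%N ->
  (min_err rho H n <= (Num.sqrt (err2 mu K [fset 0%N]%fset s))%:E)%E.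
Proof.
(* [min_err] ranges over exactly n nodes; nodes of weight 0 fill up a shorter quadrature. *)
move=> sn; pose s' := s ++ nseq (n - size s) (0, (point : seqspace T)).
have sz : size [seq (q.1, q.2 0%N) | q <- s'] == n.
  by rewrite size_map size_cat size_nseq subnKC.
have q0 g : quad s' g = quad s g.
  rewrite /quad big_cat/= -[RHS]addr0; congr (_ + _).
  by rewrite big_nseq; elim: (n - size s)%N => //= m ->; rewrite mul0r add0r.
have -> : err2 mu K [fset 0%N]%fset s = err2 mu K [fset 0%N]%fset s'.
  have E g : quad_diff mu setT id s g = quad_diff mu setT id s' g by rewrite /quad_diff q0.
  rewrite /err2 /quad_diff2 E; congr (quad_diff mu setT id s' _).
  by apply/funext => x; rewrite E.
apply: (@le_trans _ _ (wce H (fun g => (\int[rho]_x (g x)%:E)%E) (quad (Tuple sz)))).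
  by apply: ereal_inf_lbound; exists (Tuple sz).
by rewrite (wceE (p := id) measurableT mKs iK (s := Tuple sz))// -err2_coord0.
Qed.

End UnivariateTransfer.

Lemma powR_bounded_near0 (R : realType) (t B : R) :
  (forall eps, 0 < eps -> eps <= 1 -> eps `^ t <= B) -> 0 <= t.
Proof.
move=> h; rewrite leNgt; apply/negP => t0.
have B1 : 1 <= B by have := h 1 ltr01 (lexx _); rewrite powR1.
have B2 : 0 < B + 1 by lra.
(* For t < 0 the point whose t-th power is B + 1 lies in (0, 1] and violates the bound. *)
have := h ((B + 1) `^ t^-1); rewrite powR_gt0// => /(_ isT).
rewrite -powRrM mulVf ?lt_eqF// powRr1 ?(ltW B2)// => h'.
have : B + 1 <= B; last lra.
apply: h'; rewrite -[t^-1]opprK powRN -[leRHS]invr1 lef_pV2 ?posrE ?powR_gt0//.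
rewrite -invrN [leLHS](_ : 1 = 1 `^ (- t)^-1); last by rewrite powR1.
apply: ge0_ler_powR.
- by rewrite invr_ge0 oppr_ge0 ltW.
- by rewrite nnegrE.
- by rewrite nnegrE ltW.
- by rewrite lerDr (le_trans ler01 B1).
Qed.

Lemma half_bounds (a j : nat) : (2 * a.+1 + 3 <= j)%N ->
  (a < j./2)%N /\ (j.+1 <= 4 * j./2)%N.
Proof.
by have := odd_double_half j; rewrite -[j./2.*2]mul2n; case: (odd j) => /= jE aj; split; lia.
Qed.

Lemma powRN_ge1 (R : realType) (eps p : R) : 0 < eps -> eps <= 1 -> 0 <= p ->
  1 <= eps `^ (- p).
Proof.
move=> e0 e1 p0; rewrite powRN -[leLHS]invr1 lef_pV2 ?posrE ?powR_gt0//.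
apply: (@le_trans _ _ (1 `^ p)); last by rewrite powR1.
by rewrite ge0_ler_powR ?nnegrE// ltW.
Qed.

Lemma lee_inv_of_lt (R : realType) (x : \bar R) (m : R) : 0 < m ->
  (forall t, 0 < t -> t < m -> (x <= (t^-1)%:E)%E) -> (x <= (m^-1)%:E)%E.
Proof.
move=> m0 h; apply/lee_addgt0Pr => eps eps0; rewrite -EFinD.
have p0 : 0 < m^-1 + eps by rewrite addr_gt0// invr_gt0.
rewrite -[m^-1 + eps]invrK; apply: h; first by rewrite invr_gt0.
by rewrite -[ltRHS]invrK ltf_pV2 ?posrE ?invr_gt0// ltrDl.
Qed.

(** * Lower bounds and the exact exponent *)

Section Optimality.
Context {R : realType} {d : measure_display} {T : measurableType d}.
Variables (rho : probability T R) (mu : probability (seqspace T) R).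
Hypothesis muE : infinite_product rho mu.
Variable K : T -> T -> R.
Hypothesis mK : measurable_fun setT (fun q : T * T => K q.1 q.2).
Variable H : rkhs K.
Hypothesis diag_fin : (diag_mean K rho < +oo)%E.
Hypothesis C0_gt0 : 0 < double_mean K rho.
Variable Hu : forall u, rkhs (Kset K u).
Variable c : T.
Hypothesis Kcc : K c c = 0.
Variables Gam gam : nat -> R.
Hypothesis gam_ge0 : forall j, 0 <= gam j.
Hypothesis gam_noninc : forall i j, (i <= j)%N -> gam j <= gam i.
Hypothesis Gam0 : Gam 0%N = 1.
Hypothesis Gam1 : Gam 1%N = 1.
Hypothesis Gam_ge0 : forall k, 0 <= Gam k.
Local Notation w := (pod Gam gam).
Hypothesis w_fin : (\esum_(u in [set: {fset nat}])
     (w u * fine (diag_mean K rho) ^+ #|` u|)%:E < +oo)%E.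
Hypothesis nontrivial : exists2 u, u != fset0 & active_sets w u.
Variable Hg : rkhs (@Kweighted _ _ _ K w).
Variable cst : nat -> R.
Hypothesis cst_ge1 : forall k, 1 <= cst k.
Hypothesis cst_mono : forall k l, (k <= l)%N -> cst k <= cst l.
Local Notation dec1 := (decay K rho w (Some 1%N)).
Local Notation dec := (decay K rho w None).
Hypothesis dec1_gt1 : (1 < dec1)%E.
Hypothesis growth : exists q, (q%:E < dec1)%E /\
     exists2 Cq, 0 < Cq & forall k, (0 < k)%N -> Gam k <= Cq * (k`!)%:R `^ q.

Let w0 : forall u, 0 <= w u. Proof. exact: pod_ge0. Qed.
Let g0 : 0 < gam 0%N. Proof. exact: (@gam0_gt0 _ Gam). Qed.

(** Blocks for a rate close to alpha serve for all smaller rates, which can then be matched to the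
    decay. *)
Lemma building_blocks_le tau tau' c1 C lam1 lam2 Qb : tau <= tau' ->
  building_blocks rho mu Hu tau' c1 C lam1 lam2 Qb ->
  building_blocks rho mu Hu tau c1 C lam1 lam2 Qb.
Proof.
move=> tt [[c11 C0C l1 l2] bb]; split; first by split.
move=> u n u0 n0; apply: le_trans (bb u n u0 n0) _; rewrite lee_fin /bb_bound.
have C0 : 0 <= C by apply: le_trans C0C; exact: ltW.
apply: ler_wpM2r; first exact: (log_factor_ge0 lam1 lam2 n).
apply: ler_wpM2l; first by rewrite mulr_ge0 ?exprn_ge0 ?(le_trans ler01 c11).
by rewrite lef_pV2 ?posrE ?powR_gt0// ler_powR ?ler1n// ler_wpM2l.
Qed.

(** The infimum in the complexity need not be attained; the additional eps^(-p) leaves room for an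
    actual algorithm. *)
Lemma admissible_witness p B eps : 0 < eps -> eps <= 1 -> 0 <= p -> 0 <= B ->
  (comp_unr mu c Hg cst eps <= (B * eps `^ (- p))%:E)%E ->
  exists Q, [/\ admissible c Q, err2_gamma mu H Kcc w0 Q <= eps ^+ 2 &
    cost_unr cst Q <= (B + 1) * eps `^ (- p)].
Proof.
move=> e0 e1 p0 B0 cB.
have [e be] := fset_nat_enum.
have e_p := powRN_ge1 e0 e1 p0.
have lt : (comp_unr mu c Hg cst eps < ((B + 1) * eps `^ (- p))%:E)%E.
  apply: le_lt_trans cB _; rewrite lte_fin mulrDl ltrDl mul1r.
  exact: lt_le_trans e_p.
have [_ [Q [aQ eQ] <-] cQ] := ereal_inf_lt lt.
exists Q; split => //; last by rewrite -lee_fin ltW.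
move: eQ; rewrite (err_gammaE muE mK H diag_fin Hu Kcc w0 w_fin Hg be) lee_fin => eQ.
have e2 := err2_gamma_ge0 muE mK H diag_fin Hu Kcc w0 w_fin be Q.
rewrite -(sqr_sqrtr e2) lerXn2r ?nnegrE ?sqrtr_ge0 ?(ltW e0)//.
Qed.

Lemma size_le_cost (Q : @algorithm R d T) : (size Q)%:R <= cost_unr cst Q.
Proof.
rewrite /cost_unr; elim: Q => [|t Q IH]; first by rewrite big_nil.
by rewrite big_cons /= -natr1 addrC lerD.
Qed.

Section LowerBound.
Variables (alpha b : R).
Hypothesis alpha_gt0 : 0 < alpha.
Hypothesis b_gt0 : 0 < b.
Hypothesis min_errP : \forall n \near \oo,
        ((b * n%:R `^ (- alpha))%:E <= min_err rho H n)%E.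

(** Cost O(eps^(-p)) means n = O(eps^(-p)) nodes. The summand of the first coordinate alone gives
    sqrt(gam 0) b n^(-alpha) <= eps, so eps^(p alpha - 1) stays bounded as eps tends to 0. *)
Lemma exponent_ge_inv p : tract_exponents mu c Hg cst p -> alpha^-1 <= p.
Proof.
move=> [p0 [B B0 BP]]; have [N _ NP] := min_errP.
have [e be] := fset_nat_enum.
pose M := (B + 1) + N.+1%:R; have M0 : 0 < M by rewrite ltr_wpDl ?addr_ge0.
suff h : 0 <= p * alpha - 1.
  by rewrite -[leLHS]mul1r ler_pdivrMr//; lra.
apply: (@powR_bounded_near0 _ _ ((Num.sqrt (gam 0%N) * b * M `^ (- alpha))^-1)).
move=> eps e0 e1.
have [Q [aQ eQ cQ]] := admissible_witness e0 e1 p0 B0 (BP eps e0).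
have e_p := powRN_ge1 e0 e1 p0.
(* Adding N + 1 makes n positive and large enough for the lower bound on the minimal error. *)
pose n := (size Q + N.+1)%N.
have nM : n%:R <= M * eps `^ (- p).
  rewrite /n natrD /M mulrDl lerD//; first exact: le_trans (size_le_cost Q) cQ.
  by rewrite ler_peMr.
have n0 : 0 < n%:R :> R by rewrite ltr0n /n addnS.
have e2 : gam 0%N * err2 mu K [fset 0%N]%fset (nodes c Q) <= eps ^+ 2.
  apply: le_trans eQ.
  have := err2_gamma_fset_ge muE mK H diag_fin Hu Kcc w0 w_fin be Q [fset [fset 0%N]%fset]%fset.
  by rewrite big_seq_fset1 pod1.
have se : (b * n%:R `^ (- alpha)) * Num.sqrt (gam 0%N) <= eps.
  have : ((b * n%:R `^ (- alpha))%:E <= (Num.sqrt (err2 mu K [fset 0%N]%fset (nodes c Q)))%:E)%E.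
    apply: le_trans (NP n _) _; first by rewrite /= /n addnS ltnW// ltnS leq_addl.
    apply: (min_err_le muE mK H diag_fin).
    by rewrite size_map leq_addr.
  rewrite lee_fin => /(ler_wpM2r (sqrtr_ge0 (gam 0%N)))/le_trans; apply.
  rewrite -sqrtrM; last exact: (err2_ge0 muE mK H diag_fin Hu).
  rewrite mulrC -[leRHS](ger0_norm (ltW e0)) -sqrtr_sqr; exact: ler_wsqrtr.
have s0 : 0 < Num.sqrt (gam 0%N) by rewrite sqrtr_gt0.
have bM0 : 0 < Num.sqrt (gam 0%N) * b * M `^ (- alpha) by rewrite !mulr_gt0// powR_gt0.
rewrite -[leRHS]mul1r ler_pdivlMr//.
have : eps `^ (p * alpha) * (Num.sqrt (gam 0%N) * b * M `^ (- alpha)) <= eps.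
  apply: le_trans se.
  rewrite (_ : _ * (_ * _) = Num.sqrt (gam 0%N) * b * (M `^ (- alpha) * eps `^ (p * alpha))); last by ring.
  rewrite [leRHS](_ : _ = Num.sqrt (gam 0%N) * b * n%:R `^ (- alpha)); last by ring.
  rewrite ler_wpM2l ?mulr_ge0 ?(ltW s0) ?(ltW b_gt0)//.
  rewrite (_ : eps `^ (p * alpha) = (eps `^ (- p)) `^ (- alpha)); last first.
    by rewrite -powRrM mulrNN.
  have Me : 0 < M * eps `^ (- p) by rewrite mulr_gt0// powR_gt0.
  rewrite -powRM ?powR_ge0 ?(ltW M0)//.
  set Z := M * _ in Me nM *; rewrite !powRN lef_pV2 ?posrE ?powR_gt0//.
  by rewrite ge0_ler_powR ?nnegrE ?(ltW alpha_gt0) ?(ltW n0) ?(ltW Me).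
move=> h; rewrite powRB ?(gt_eqF e0) ?implybT// powRr1 ?(ltW e0)//.
by rewrite mulrAC ler_pdivrMr// mul1r.
Qed.

End LowerBound.

(** Below the threshold N the bound cst >= 1 replaces the asymptotic one. *)
Lemma cst_linear : cst =Omega_ \oo (fun k => k%:R : R) ->
  exists2 kappa, 0 < kappa & forall k : nat, kappa * k%:R <= cst k.
Proof.
rewrite eqOmegaE eqOmegaO => /eqO_exP [k0 k00 [N _ NP]].
have q0 : 0 < k0 + N.+1%:R by rewrite addr_gt0.
exists (k0 + N.+1%:R)^-1; first by rewrite invr_gt0.
move=> k; rewrite mulrC ler_pdivrMr// mulrDr.
have [Nk|kN] := leqP N k.
  have := NP k Nk; rewrite /= !ger0_norm//; last exact: le_trans (cst_ge1 k).
  rewrite mulrC => /le_trans; apply; rewrite lerDl mulr_ge0//.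
  exact: le_trans (cst_ge1 k).
apply: (@le_trans _ _ (1 * N.+1%:R)); first by rewrite mul1r ler_nat ltnW// ltnS ltnW.
apply: (@le_trans _ _ (cst k * N.+1%:R)); first by rewrite ler_wpM2r.
by rewrite lerDr mulr_ge0 ?(ltW k00)// (le_trans ler01).
Qed.

Lemma active_subset (Q : @algorithm R d T) (v : {fset nat}) :
  v \in [seq active t | t <- Q] ->
  {subset v <= flatten [seq enum_fset (active t) | t <- Q]}.
Proof.
elim: Q => //= t Q IH; rewrite inE => /orP[/eqP -> j jt|/IH vQ j /vQ jQ].
  by rewrite mem_cat jt.
by rewrite mem_cat jQ orbT.
Qed.

(* Only the single-coordinate terms of the weight family are used: at least n of
   the first 2n coordinates are inactive in Q. *)
Lemma inactive_lower_bound (Q : @algorithm R d T) n :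
  (size (flatten [seq enum_fset (active t) | t <- Q]) <= n)%N ->
  n%:R * gam (n.*2) * double_mean K rho <= err2_gamma mu H Kcc w0 Q.
Proof.
set V := flatten _ => Vn.
have [e be] := fset_nat_enum.
pose Ls := [seq j <- iota 0 n.*2 | j \notin V].
have uL : uniq Ls by rewrite filter_uniq ?iota_uniq.
have sL : (n <= size Ls)%N.
  have : (size [seq j <- iota 0 n.*2 | j \in V] <= size V)%N.
    apply: uniq_leq_size; first by rewrite filter_uniq ?iota_uniq.
    by move=> j; rewrite mem_filter => /andP[].
  move=> sV; have := count_predC (fun j => j \in V) (iota 0 n.*2).
  rewrite size_iota -!size_filter => cE.
  have : (n.*2 - size V <= size Ls)%N.
    by rewrite leq_subLR -cE leq_add2r.
  by apply: leq_trans; rewrite -addnn -addnBA// leq_addr.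
pose F := [fset u in [seq [fset j]%fset | j <- Ls]]%fset.
apply: le_trans (err2_gamma_fset_ge muE mK H diag_fin Hu Kcc w0 w_fin be Q F).
apply: (@le_trans _ _ (\sum_(j <- Ls) gam n.*2 * double_mean K rho)).
  rewrite big_const_seq count_predT iter_addr_0 -[leRHS]mulr_natl -mulrA.
  by rewrite ler_wpM2r ?ler_nat// mulr_ge0// ltW.
have -> : \sum_(u <- F) w u * err2 mu K u (nodes c Q) =
    \sum_(j <- Ls) w [fset j]%fset * err2 mu K [fset j]%fset (nodes c Q).
  rewrite -(big_map (fun j => [fset j]%fset) xpredT (fun u => w u * err2 mu K u (nodes c Q))).
  apply: perm_big; apply: uniq_perm; first exact: fset_uniq.
    by rewrite map_inj_uniq// => i j /fset1_inj.
  by move=> u; rewrite !inE.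
rewrite big_seq [leRHS]big_seq; apply: ler_sum => j.
rewrite mem_filter mem_iota add0n => /andP[jV /andP[_ jn]].
rewrite pod1// (err2_inactive muE mK H diag_fin Hu Kcc) ?cardfs1 ?expr1.
  by rewrite ler_wpM2r ?(ltW C0_gt0)// gam_noninc// ltnW.
by move=> v vQ; rewrite fsub1set; apply: contra jV; exact: active_subset.
Qed.

Lemma active_le_cost kappa (Q : @algorithm R d T) : 0 < kappa ->
  (forall k : nat, kappa * k%:R <= cst k) ->
  kappa * (size (flatten [seq enum_fset (active t) | t <- Q]))%:R <= cost_unr cst Q.
Proof.
move=> k0 kP; rewrite /cost_unr; elim: Q => [|t Q IH]; first by rewrite big_nil mulr0.
by rewrite big_cons /= size_cat natrD mulrDr lerD.
Qed.

(** For eps^(-p) proportional to n, linear cost allows at most n active coordinates in total, so n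
    gam(2n) C_0 <= eps^2 = O(n^(-2/p)). Hence gam decays at rate q = 1 + 2/p, and q <= decay means 2
    / (decay - 1) <= p. *)
Lemma exponent_ge_decay p : tract_exponents mu c Hg cst p -> 0 < p ->
  cst =Omega_ \oo (fun k => k%:R : R) -> (2%:E / (dec1 - 1) <= p%:E)%E.
Proof.
move=> [_ [B B0 BP]] p0 /cst_linear [kappa k0 kP].
(* If some gam j vanishes, the decay is infinite and the bound to be proved is 2 / oo = 0. *)
have [[j gj]|gpos] := pselect (exists j, gam j = 0).
  have -> : dec1 = +oo%E by apply: decay1_pinfty gj.
  by rewrite addye// invey mule0 lee_fin ltW.
have {}gpos j : 0 < gam j.
  by rewrite lt_neqAle eq_sym gam_ge0 andbT; apply/eqP => gj; apply: gpos; exists j.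
pose Z := (B + 1) / kappa; have Z0 : 0 < Z by rewrite divr_gt0// ltr_wpDl.
pose q := 1 + 2 / p; have q1 : 1 < q by rewrite ltrDl divr_gt0.
have main n : Z <= n%:R -> (0 < n)%N ->
    gam n.*2 <= Z `^ (2 / p) / double_mean K rho * n%:R `^ (- q).
  move=> Zn n0; have nR : 0 < n%:R :> R by rewrite ltr0n.
  (* This eps satisfies eps^(-p) = n / Z, and Z = (B + 1) / kappa turns the cost bound into a count
     of at most n active coordinates. *)
  pose eps := (Z / n%:R) `^ p^-1.
  have zn0 : 0 < Z / n%:R by rewrite divr_gt0.
  have e0 : 0 < eps by rewrite powR_gt0.
  have e1 : eps <= 1.
    apply: (@le_trans _ _ (1 `^ p^-1)); last by rewrite powR1.
    by rewrite ge0_ler_powR ?nnegrE ?invr_ge0 ?(ltW p0) ?(ltW zn0)// ler_pdivrMr// mul1r.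
  have [Q [aQ eQ cQ]] := admissible_witness e0 e1 (ltW p0) B0 (BP eps e0).
  have eE : eps `^ (- p) = n%:R / Z.
    by rewrite powRN /eps -powRrM mulVf ?gt_eqF// powRr1 ?(ltW zn0)// invf_div.
  have Vn : (size (flatten [seq enum_fset (active t) | t <- Q]) <= n)%N.
    rewrite -(ler_nat R) -(ler_pM2l k0).
    apply: (le_trans (active_le_cost _ k0 kP)); apply: (le_trans cQ); rewrite eE /Z.
    rewrite le_eqVlt; apply/orP; left; apply/eqP; field.
    by rewrite !gt_eqF// ltr_wpDl.
  have := le_trans (inactive_lower_bound Vn) eQ.
  have -> : eps ^+ 2 = Z `^ (2 / p) * n%:R `^ (- (2 / p)).
    rewrite /eps -powR_mulrn ?powR_ge0// -powRrM [p^-1 * _]mulrC.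
    by rewrite powRM ?invr_ge0 ?(ltW Z0)// -(powR_inv1 (ltW nR)) -powRrM mulN1r.
  have -> : n%:R `^ (- q) = n%:R `^ (- (2 / p)) / n%:R.
    rewrite /q opprD addrC powRD; last by rewrite (gt_eqF nR) implybT.
    by rewrite powR_inv1// ltW.
  set X := n%:R `^ (- (2 / p)) => h.
  rewrite (_ : _ / _ * _ = Z `^ (2 / p) * X / (double_mean K rho * n%:R)); last first.
    by field; rewrite !gt_eqF.
  rewrite ler_pdivlMr ?mulr_gt0//; apply: le_trans h.
  by rewrite le_eqVlt; apply/orP; left; apply/eqP; ring.
have qdec : (q%:E <= dec1)%E.
  have A0 : 0 <= Z `^ (2 / p) / double_mean K rho by rewrite divr_ge0 ?powR_ge0// ltW.
  pose A := Z `^ (2 / p) / double_mean K rho * 4 `^ q.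
  (* [main] speaks of even indices 2n; a general j is treated with n = j./2, and j + 1 <= 4 n
     produces the factor 4^q. *)
  have gA : \forall j \near \oo, gam j <= A * j.+1%:R `^ (- q).
    exists (2 * (Num.truncn Z).+1 + 3)%N => // j /= jN.
    have nj : (j./2.*2 <= j)%N by rewrite -{2}(odd_double_half j) leq_addl.
    have [Nj jn] := half_bounds jN.
    have n0 : (0 < j./2)%N by case: (j./2) jn.
    have Zj : Z <= j./2%:R by apply/ltW/(lt_le_trans (truncnS_gt _)); rewrite ler_nat.
    apply: (le_trans (gam_noninc nj)); apply: (le_trans (main _ Zj n0)).
    rewrite /A -[leRHS]mulrA ler_wpM2l// !powRN.
    have j2 : 0 < j./2%:R :> R by rewrite ltr0n.
    rewrite ler_pdivlMr ?powR_gt0// mulrC ler_pdivrMr ?powR_gt0//.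
    rewrite -powRM// ge0_ler_powR ?nnegrE ?mulr_ge0//; first lra.
    by rewrite -natrM ler_nat.
  have qle p' : p' < q -> (p'%:E <= dec1)%E.
    move=> pq; apply: decay1_ge => //.
    have cv : A * j.+1%:R `^ (- (q - p')) @[j --> \oo] --> A * 0.
      by apply: cvgM; [exact: cvg_cst|apply: cvg_powRN; lra].
    rewrite mulr0 in cv.
    apply: (@squeeze_cvgr _ _ _ _ (fun=> 0) (fun j => A * j.+1%:R `^ (- (q - p')))) => //.
      near=> j; rewrite mulr_ge0 ?powR_ge0//=.
      rewrite opprB addrC powRD; last by rewrite pnatr_eq0 implybT.
      by rewrite mulrA ler_wpM2r ?powR_ge0//; near: j.
    exact: cvg_cst.
  apply: (@ereal_le_of_lt _ q%:E) => //.
  by move=> p' _; rewrite lte_fin => /qle.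
move: qdec; case: dec1 dec1_gt1 => [r||//].
  rewrite !lte_fin lee_fin => r1 qr; rewrite -EFinB inver subr_eq0 (gt_eqF r1).
  rewrite -EFinM lee_fin ler_pdivrMr ?subr_gt0//.
  by move: qr; rewrite /q -lerBrDl ler_pdivrMr// [p * _]mulrC.
by move=> _ _; rewrite addye// invey mule0 lee_fin ltW.
Unshelve. all: end_near.
Qed.

(** For alpha <= 0 the minimal errors would stay above b, while the building blocks for the first
    coordinate have errors tending to 0. *)
Lemma alpha_positive (alpha b tau c1 C lam1 lam2 : R) Qb : 0 < b ->
  (\forall n \near \oo, ((b * n%:R `^ (- alpha))%:E <= min_err rho H n)%E) ->
  0 < tau -> building_blocks rho mu Hu tau c1 C lam1 lam2 Qb -> 0 < alpha.
Proof.
move=> b0 [N _ NP] tau0 [[c11 C0C _ _] bb]; rewrite ltNge; apply/negP => a0.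
have C0 : 0 <= C by apply: le_trans C0C; exact: ltW.
have cC : 0 <= c1 * C by rewrite mulr_ge0 ?(le_trans ler01 c11).
have t2 : 0 < 2 * tau by rewrite mulr_gt0.
have d0 : 0 < b ^+ 2 / (c1 * C + 1) / 2 by rewrite !divr_gt0 ?exprn_gt0// ltr_wpDl.
have /cvgrPdist_le /(_ _ d0) [N' _ N'P] := cvg_powRN t2.
pose n := (maxn N N').+1.
have := N'P n; rewrite /= /n ltnW ?ltnS ?leq_maxr// => /(_ isT).
rewrite sub0r normrN ger0_norm ?powR_ge0// -/n => small.
have e2 : err2 mu K [fset 0%N]%fset (Qb n [fset 0%N]%fset) <= c1 * C * n.+1%:R `^ (- (2 * tau)).
  have f0 : [fset 0%N]%fset != fset0 :> {fset nat} by rewrite -cardfs_gt0 cardfs1.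
  apply: (err2_le muE mK H diag_fin); first by rewrite mulr_ge0 ?powR_ge0.
  apply: le_trans (bb _ n f0 isT) _.
  by rewrite lee_fin /bb_bound cardfs1 eqxx mulr1 expr1 powRN.
have : (b%:E <= (Num.sqrt (err2 mu K [fset 0%N]%fset (Qb n [fset 0%N]%fset)))%:E)%E.
  apply: le_trans (min_err_le muE mK H diag_fin (n := n) _); last by rewrite size_tuple.
  apply: le_trans (NP n _); last by rewrite /= /n ltnW// ltnS leq_maxl.
  rewrite lee_fin ler_peMr ?(ltW b0)//.
  apply: (@le_trans _ _ (1 `^ (- alpha))); first by rewrite powR1.
  by rewrite ge0_ler_powR ?nnegrE ?oppr_ge0// ler1n.
rewrite lee_fin => bs.
have e0 := err2_ge0 muE mK H diag_fin Hu [fset 0%N]%fset (Qb n [fset 0%N]%fset).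
have : b ^+ 2 <= c1 * C * n.+1%:R `^ (- (2 * tau)).
  apply: le_trans e2; rewrite -[leRHS](sqr_sqrtr e0).
  by rewrite lerXn2r ?nnegrE ?sqrtr_ge0 ?(ltW b0).
apply/negP; rewrite -ltNge.
apply: (@le_lt_trans _ _ ((c1 * C + 1) * (b ^+ 2 / (c1 * C + 1) / 2))).
  by apply: ler_pM => //; rewrite ?powR_ge0// lerDl.
have c0 : 0 < c1 * C + 1 by rewrite ltr_wpDl.
rewrite (_ : _ * _ = b ^+ 2 / 2); last by field; rewrite gt_eqF.
have : 0 < b ^+ 2 by rewrite exprn_gt0.
lra.
Qed.

Hypothesis cst_exp : exists2 l : R, 0 <= l & cst =O_ \oo (fun k => expR (l * k%:R)).

Lemma p_unr_le_inv (t c1 C lam1 lam2 : R) Qb : 0 < t -> ((2 * t)%:E < dec1 - 1)%E ->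
  building_blocks rho mu Hu t c1 C lam1 lam2 Qb ->
  (p_unr mu c Hg cst <= (t^-1)%:E)%E.
Proof.
move=> t0 td bb.
have decE1 : dec = dec1 by apply: decayE.
have [lam0 [l0 l1 l2]] : exists lam0, [/\ 0 < lam0, (lam0%:E < 1 - dec^-1)%E &
    (t%:E < lam0%:E * dec / 2%:E)%E].
  rewrite decE1; move: td dec1_gt1; case: dec1 => [r||//]; last first.
    move=> _ _; exists 2^-1; split; first by rewrite invr_gt0.
      by rewrite invey sube0 lte_fin invf_lt1// ltr1n.
    by rewrite inver pnatr_eq0/= gt0_muley ?lte_fin// gt0_mulye ?lte_fin// ltry.
  rewrite -EFinB !lte_fin => tr r1.
  have r0 : 0 < r by lra.
  (* The midpoint between 2 t / r and 1 - 1/r; there is room between them because 2 t < r - 1. *)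
  exists ((2 * t / r + (1 - r^-1)) / 2).
  have h : 2 * t / r < 1 - r^-1.
    rewrite ltr_pdivrMr// mulrBl mul1r mulVf ?gt_eqF//.
  have h0 : 0 < 2 * t / r by rewrite divr_gt0// mulr_gt0.
  rewrite inver (gt_eqF r0) inver pnatr_eq0/= -EFinB -!EFinM !lte_fin; split; [lra|lra|].
  have : 2 * t / r * r < (2 * t / r + (1 - r^-1)) / 2 * r by rewrite ltr_pM2r//; lra.
  by rewrite divfK ?gt_eqF//; lra.
by have [] := p_unr_le muE mK H diag_fin C0_gt0 Kcc gam_ge0 gam_noninc Gam0 Gam1 Gam_ge0
  w_fin nontrivial Hg cst_ge1 cst_mono dec1_gt1 growth l0 l1 t0 l2 bb cst_exp.
Qed.

(** Every t below both alpha and (decay - 1) / 2 is a possible rate, so the exponent is at most 1 /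
    t; letting t tend to the smaller of the two gives the larger of the reciprocals. Conversely each
    tractability exponent is bounded below by both. *)
Lemma p_unrE (alpha b : R) : 0 < alpha -> 0 < b ->
  (\forall n \near \oo, ((b * n%:R `^ (- alpha))%:E <= min_err rho H n)%E) ->
  cst =Omega_ \oo (fun k => k%:R : R) ->
  (forall delta, 0 < delta -> exists2 tau' : R, 0 < tau' /\ `|tau' - alpha| < delta &
     exists c1' C' lam1' lam2' Qb', building_blocks rho mu Hu tau' c1' C' lam1' lam2' Qb') ->
  p_unr mu c Hg cst = maxe (alpha^-1)%:E (2%:E / (dec - 1))%E.
Proof.
move=> a0 b0 eP cO bbs; apply/eqP; rewrite eq_le; apply/andP; split; last first.
  apply: le_ereal_inf_tmp => _ [p tp <-].
  have ap := exponent_ge_inv a0 b0 eP tp.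
  rewrite ge_max lee_fin ap (decayE C0_gt0 gam_ge0 gam_noninc Gam0 Gam1 Gam_ge0 dec1_gt1 growth).
  apply: exponent_ge_decay => //.
  by apply: lt_le_trans ap; rewrite invr_gt0.
have small t : 0 < t -> t < alpha -> ((2 * t)%:E < dec1 - 1)%E ->
    (p_unr mu c Hg cst <= (t^-1)%:E)%E.
  move=> t0 ta td; have [|tau' [tau0 tt] [c1 [C [lam1 [lam2 [Qb bb]]]]]] := bbs (alpha - t).
    by rewrite subr_gt0.
  apply: (@p_unr_le_inv t c1 C lam1 lam2 Qb) => //.
  apply: building_blocks_le bb; move: tt; rewrite ltr_norml => /andP[]; lra.
rewrite (decayE C0_gt0 gam_ge0 gam_noninc Gam0 Gam1 Gam_ge0 dec1_gt1 growth).
move: small dec1_gt1; case: dec1 => [r||//] small; last first.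
  move=> _; rewrite le_max; apply/orP; left; apply: lee_inv_of_lt => // t t0 ta.
  by apply: small => //; rewrite addye// ltry.
rewrite lte_fin => r1; rewrite -EFinB inver subr_eq0 (gt_eqF r1) -EFinM.
have [ar|ra] := leP alpha ((r - 1) / 2).
  rewrite le_max; apply/orP; left; apply: lee_inv_of_lt => // t t0 ta.
  by apply: small => //; rewrite -EFinB lte_fin; lra.
rewrite le_max; apply/orP; right; rewrite -invf_div; apply: lee_inv_of_lt; first lra.
by move=> t t0 tr; apply: small => //; [lra|rewrite -EFinB lte_fin; lra].
Qed.

End Optimality.

Theorem theorem7 (R : realType)
  (* the domain, the anchored kernel and the measures *)
  (D : set R) (mD : measurable (D : set (measurableTypeR R)))
  (c : R) (Dc : D c) (K : dom Dc -> dom Dc -> R)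
  (Kmeas : measurable_fun [set: dom Dc * dom Dc] (fun p => K p.1 p.2))
  (Kneq0 : exists x y, K x y != 0)
  (Ksym : forall x y, K x y = K y x) (Kpsd : pos_semidef K)
  (Kanchor : K (anchor Dc) (anchor Dc) = 0)
  (rho : probability (dom Dc) R)
  (mean_fin : (diag_mean K rho < +oo)%E) (mean_gt0 : 0 < double_mean K rho)
  (mu : probability (seqspace (dom Dc)) R) (muE : infinite_product rho mu)
  (* POD weights *)
  (Gam gam : nat -> R)
  (gam_ge0 : forall j, 0 <= gam j)
  (gam_noninc : forall i j, (i <= j)%N -> gam j <= gam i)
  (Gam0 : Gam 0%N = 1) (Gam1 : Gam 1%N = 1) (Gam_ge0 : forall k, 0 <= Gam k)
  (weights_summable : (\esum_(u in [set: {fset nat}])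
     (pod Gam gam u * fine (diag_mean K rho) ^+ #|` u|)%:E < +oo)%E)
  (weights_nontrivial : exists2 u, u != fset0 & active_sets (pod Gam gam) u)
  (* the reproducing kernel Hilbert spaces H(K), H_u and H_gamma *)
  (H : rkhs K) (Hu : forall u, rkhs (Kset K u))
  (Hgam : rkhs (@Kweighted _ _ _ K (pod Gam gam)))
  (* the cost function *)
  (cst : nat -> R) (cst_ge1 : forall k, 1 <= cst k)
  (cst_mono : forall k l, (k <= l)%N -> cst k <= cst l)
  (* the hypotheses on the weights *)
  (decay1_gt1 : (1 < decay K rho (pod Gam gam) (Some 1%N))%E)
  (Gam_growth : exists q, (q%:E < decay K rho (pod Gam gam) (Some 1%N))%E /\
     exists2 Cq, 0 < Cq &
       forall k, (0 < k)%N -> Gam k <= Cq * (k`!)%:R `^ q)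
  (* the building blocks *)
  (lam0 tau c1 C lam1 lam2 : R)
  (lam0_gt0 : 0 < lam0)
  (lam0_lt : (lam0%:E < 1 - (decay K rho (pod Gam gam) None)^-1)%E)
  (tau_gt0 : 0 < tau)
  (tau_lt : (tau%:E < lam0%:E * decay K rho (pod Gam gam) None / 2%:E)%E)
  (Qb : bb_family)
  (Qb_cond : building_blocks rho mu Hu tau c1 C lam1 lam2 Qb) :
  let w := pod Gam gam in
  let a := anchor Dc in
  let dec := decay K rho w None in
  let QCD := cd_alg w a lam0 tau c1 C Qb in
  let dCD := cd_dim w lam0 c1 C in
  (* well-definedness of the algorithms and of the maximum *)
  (forall eps, 0 < eps -> finite_set (cd_sets w lam0 tau c1 C eps)) /\
  (\forall eps \near 0^'+, exists m, is_max (cd_dims w lam0 c1 C eps) m) /\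
  (* error *)
  (exists2 h : R -> R, h eps @[eps --> 0^'+] --> 0 &
     \forall eps \near 0^'+,
       (err_gamma mu a Hgam (QCD eps) <= (eps `^ (1 - h eps))%:E)%E) /\
  (* cost *)
  (fun eps => cost_unr cst (QCD eps))
    =O_ (0^'+) (fun eps => cst (dCD eps) * eps `^ (- tau^-1)) /\
  (fun eps => (dCD eps)%:R : R)
    =O_ (0^'+) (fun eps => ln eps^-1 / ln (ln eps^-1)) /\
  (fun eps => (dCD eps)%:R : R) =o_ (0^'+) (fun eps => ln eps^-1) /\
  (* tractability *)
  ((exists2 l : R, 0 <= l & cst =O_ \oo (fun k => expR (l * k%:R))) ->
   strongly_tractable mu a Hgam cst /\
   (p_unr mu a Hgam cst <= maxe (tau^-1)%:E (2%:E / (dec - 1)))%E /\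
   (* optimality *)
   forall alpha : R,
     cst =Omega_ \oo (fun k => k%:R : R) ->
     (exists2 b : R, 0 < b & \forall n \near \oo,
        ((b * n%:R `^ (- alpha))%:E <= min_err rho H n)%E) ->
     (forall delta, 0 < delta -> exists2 tau' : R,
        0 < tau' /\ `|tau' - alpha| < delta &
        exists c1' C' lam1' lam2' Qb',
          building_blocks rho mu Hu tau' c1' C' lam1' lam2' Qb') ->
     p_unr mu a Hgam cst = maxe (alpha^-1)%:E (2%:E / (dec - 1))%E).
Proof.
have Kcc : K (anchor Dc) (anchor Dc) = 0 := Kanchor.
move=> w a dec QCD dCD; split.
  by move=> eps; apply: (pod_cd_sets_finite mean_gt0 gam_ge0 gam_noninc Gam0 Gam1
    Gam_ge0 weights_nontrivial decay1_gt1 Gam_growth lam0_gt0 lam0_lt tau_gt0 tau_lt Qb_cond).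
split.
  exact: (cd_dims_max mean_gt0 gam_ge0 gam_noninc Gam0 Gam1
    Gam_ge0 weights_nontrivial decay1_gt1 Gam_growth lam0_gt0 lam0_lt Qb_cond).
split.
  exact: (cd_error_asymptotic muE Kmeas H mean_fin mean_gt0 Kcc gam_ge0 gam_noninc Gam0 Gam1
    Gam_ge0 weights_summable weights_nontrivial Hgam decay1_gt1 Gam_growth
    lam0_gt0 lam0_lt tau_gt0 tau_lt Qb_cond).
split.
  exact: (cd_cost_bigO mean_gt0 a gam_ge0 gam_noninc Gam0 Gam1
    Gam_ge0 weights_nontrivial cst_ge1 cst_mono decay1_gt1 Gam_growth
    lam0_gt0 lam0_lt tau_gt0 tau_lt Qb_cond).
split.
  exact: (cd_dim_bigO mean_gt0 gam_ge0 gam_noninc Gam0 Gam1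
    Gam_ge0 weights_nontrivial decay1_gt1 Gam_growth lam0_gt0 lam0_lt Qb_cond).
split.
  exact: (cd_dim_littleo mean_gt0 gam_ge0 gam_noninc Gam0 Gam1
    Gam_ge0 weights_nontrivial decay1_gt1 Gam_growth lam0_gt0 lam0_lt Qb_cond).
move=> cst_exp.
have [st pu] := p_unr_le muE Kmeas H mean_fin mean_gt0 Kcc gam_ge0 gam_noninc Gam0 Gam1
  Gam_ge0 weights_summable weights_nontrivial Hgam cst_ge1 cst_mono decay1_gt1 Gam_growth
  lam0_gt0 lam0_lt tau_gt0 tau_lt Qb_cond cst_exp.
split => //; split; first by apply: (le_trans pu); rewrite le_max lexx.
move=> alpha cst_lin [b b0 eP] bbs.
have alpha0 := alpha_positive muE Kmeas mean_fin mean_gt0 b0 eP tau_gt0 Qb_cond.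
exact: (p_unrE muE Kmeas mean_fin mean_gt0 Kcc gam_ge0 gam_noninc Gam0 Gam1
  Gam_ge0 weights_summable weights_nontrivial Hgam cst_ge1 cst_mono decay1_gt1 Gam_growth
  cst_exp alpha0 b0 eP cst_lin bbs).
Qed.
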